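(* For a given undirected weighted graph $G$ with $n$ vertices, there is an incremental (1-failure) distance sensitivity oracle that can be constructed in $\tilde{O}(n^3)$ time, such that when an edge $e$ is inserted into $G$ the oracle can be maintained in worst-case $\tilde{O}(n^2)$ time. The oracle uses $\tilde{O}(n^2)$ space and answers queries in $\tilde{O}(1)$ time.
   Context: A (1-failure) distance sensitivity oracle (DSO) for a weighted graph $G$ is a data structure that, given any two vertices $u,v$ and any edge $f$, returns the length of the shortest $u$-$v$ path in $G-\{f\}$ (the graph $G$ with edge $f$ removed). An incremental DSO additionally supports insertions of new weighted edges into the current graph, after which queries refer to the updated graph. $\tilde{O}(\cdot)$ hides polylogarithmic factors in $n$. *)

(* Defs.v *)
From mathcomp Require Import all_boot all_order all_algebra.

Set Implicit Arguments.
Unset Strict Implicit.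
Unset Printing Implicit Defensive.

Import Order.TTheory GRing.Theory Num.Theory.

(* An encoding of simple graphs.
   [G u v = Some r] : there is an edge uv, of weight r;
   [G u v = None]   : there is no edge uv. *)
Definition wgraph (R : Type) (n : nat) : Type := 'I_n -> 'I_n -> option R.

Section Graphs.
Variables (R : realDomainType) (n : nat).
Implicit Types (G : wgraph R n) (u v a b : 'I_n) (p : seq 'I_n).
Local Open Scope ring_scope.

Record is_wgraph G : Prop := IsWGraph {
  wgraph_sym : forall u v, G u v = G v u;
  wgraph_irr : forall u, G u u = None;
  wgraph_ge0 : forall u v r, G u v = Some r -> 0 <= r }.

Definition adj G : rel 'I_n := fun u v => isSome (G u v).

Definition same_pair a b u v : bool :=
  ((u == a) && (v == b)) || ((u == b) && (v == a)).

Definition insert_edge G a b (w : R) : wgraph R n :=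
  fun u v => if same_pair a b u v then Some w else G u v.

Definition remove_edge G a b : wgraph R n :=
  fun u v => if same_pair a b u v then None else G u v.

(* Vertex sequences follow the convention of path.v: the path is [u :: p]. *)
Definition is_path G u v p : Prop :=
  [/\ path (adj G) u p, uniq (u :: p) & last u p = v].

Fixpoint path_length G u p : R :=
  if p is v :: p' then odflt 0 (G u v) + path_length G v p' else 0.

(* [None] is the infinite distance between disconnected vertices. *)
Definition is_dist G u v (d : option R) : Prop :=
  if d is Some r then
    (exists2 p, is_path G u v p & path_length G u p = r) /\
    (forall p, is_path G u v p -> r <= path_length G u p)
  else forall p, ~ is_path G u v p.

End Graphs.

(* A unit-cost RAM.  Words are naturals, reduced modulo [M = 2 ^ (word size)].
   Edge weights are atomic values, kept in registers and memory cells of their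
   own; they can only be moved, added, subtracted and compared, so information
   can be extracted from a weight only by comparing it with another one. *)

Inductive wop := Add | Sub | Mul | Div | Mod.

Inductive wexp :=
| WConst of nat
| WReg of nat
| WLoad of wexp
| WBin of wop & wexp & wexp.

Inductive xexp :=
| XZero
| XReg of nat
| XLoad of wexp
| XAdd of xexp & xexp
| XSub of xexp & xexp.

Inductive bexp :=
| BLt of wexp & wexp
| BEq of wexp & wexp
| BXle of xexp & xexp
| BNot of bexp
| BAnd of bexp & bexp.

Inductive com :=
| Skip
| WSet of nat & wexp
| XSet of nat & xexp
| WStore of wexp & wexp
| XStore of wexp & xexp
| Seq of com & com
| If of bexp & com & com
| While of bexp & com.

(* Evaluation costs one unit per operation, register access or memory access. *)
Fixpoint wcost (e : wexp) : nat :=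
  match e with
  | WConst _ | WReg _ => 1
  | WLoad e1 => (wcost e1).+1
  | WBin _ e1 e2 => (wcost e1 + wcost e2).+1
  end.

Fixpoint xcost (e : xexp) : nat :=
  match e with
  | XZero | XReg _ => 1
  | XLoad e1 => (wcost e1).+1
  | XAdd e1 e2 | XSub e1 e2 => (xcost e1 + xcost e2).+1
  end.

Fixpoint bcost (e : bexp) : nat :=
  match e with
  | BLt e1 e2 | BEq e1 e2 => (wcost e1 + wcost e2).+1
  | BXle e1 e2 => (xcost e1 + xcost e2).+1
  | BNot e1 => (bcost e1).+1
  | BAnd e1 e2 => (bcost e1 + bcost e2).+1
  end.

(* The natural-number operations, hence subtraction is truncated at 0. *)
Definition wop_fun (o : wop) : nat -> nat -> nat :=
  match o with
  | Add => addn | Sub => subn | Mul => muln | Div => divn | Mod => modn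
  end.

Section Machine.
Variable R : realDomainType.
Local Open Scope ring_scope.

Record state := State {
  wreg : nat -> nat;
  xreg : nat -> R;
  wmem : nat -> nat;
  xmem : nat -> R }.

Implicit Type s : state.

Definition set_wreg s r x :=
  State [eta wreg s with r |-> x] (xreg s) (wmem s) (xmem s).
Definition set_xreg s r x :=
  State (wreg s) [eta xreg s with r |-> x] (wmem s) (xmem s).
Definition set_wmem s i x :=
  State (wreg s) (xreg s) [eta wmem s with i |-> x] (xmem s).
Definition set_xmem s i x :=
  State (wreg s) (xreg s) (wmem s) [eta xmem s with i |-> x].

Fixpoint weval (M : nat) s (e : wexp) : nat :=
  match e with
  | WConst c => (c %% M)%N
  | WReg r => wreg s r
  | WLoad e1 => wmem s (weval M s e1)
  | WBin o e1 e2 => (wop_fun o (weval M s e1) (weval M s e2) %% M)%N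
  end.

Fixpoint xeval (M : nat) s (e : xexp) : R :=
  match e with
  | XZero => 0
  | XReg r => xreg s r
  | XLoad e1 => xmem s (weval M s e1)
  | XAdd e1 e2 => xeval M s e1 + xeval M s e2
  | XSub e1 e2 => xeval M s e1 - xeval M s e2
  end.

Fixpoint beval (M : nat) s (e : bexp) : bool :=
  match e with
  | BLt e1 e2 => (weval M s e1 < weval M s e2)%N
  | BEq e1 e2 => (weval M s e1 == weval M s e2)%N
  | BXle e1 e2 => xeval M s e1 <= xeval M s e2
  | BNot e1 => ~~ beval M s e1
  | BAnd e1 e2 => beval M s e1 && beval M s e2
  end.

(* [exec M S c s t s'] : started in s, the command c halts in s' after t time
   units, writing only to memory cells of address < S.  A store outside this
   range has no transition: S bounds the space used, working space included. *)
Inductive exec (M S : nat) : com -> state -> nat -> state -> Prop :=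
| ESkip s : exec M S Skip s 1 s
| EWSet s r e :
    exec M S (WSet r e) s (wcost e).+1 (set_wreg s r (weval M s e))
| EXSet s r e :
    exec M S (XSet r e) s (xcost e).+1 (set_xreg s r (xeval M s e))
| EWStore s i e : (weval M s i < S)%N ->
    exec M S (WStore i e) s (wcost i + wcost e).+1
      (set_wmem s (weval M s i) (weval M s e))
| EXStore s i e : (weval M s i < S)%N ->
    exec M S (XStore i e) s (wcost i + xcost e).+1
      (set_xmem s (weval M s i) (xeval M s e))
| ESeq c1 c2 s1 t1 s2 t2 s3 :
    exec M S c1 s1 t1 s2 -> exec M S c2 s2 t2 s3 ->
    exec M S (Seq c1 c2) s1 (t1 + t2) s3
| EIf b c1 c2 s t s' :
    exec M S (if beval M s b then c1 else c2) s t s' ->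
    exec M S (If b c1 c2) s (bcost b + t).+1 s'
| EWhileF b c s : ~~ beval M s b ->
    exec M S (While b c) s (bcost b).+1 s
| EWhileT b c s1 t1 s2 t2 s3 : beval M s1 b ->
    exec M S c s1 t1 s2 -> exec M S (While b c) s2 t2 s3 ->
    exec M S (While b c) s1 (bcost b + t1 + t2).+1 s3.

(* Arguments are passed in the first registers; the rest of the machine is
   left as the previous operation left it. *)
Definition set_args s (ws : seq nat) (xs : seq R) : state :=
  State (fun r => if (r < size ws)%N then nth 0%N ws r else wreg s r)
        (fun r => if (r < size xs)%N then nth 0 xs r else xreg s r)
        (wmem s) (xmem s).

(* Initial state: n is in word register 0, the n x n adjacency matrix (as 0/1
   words) and the weight matrix are laid out in row-major order at the start
   of the two memories, and everything else is zero. *)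
Definition matrix_entry n (G : wgraph R n) (i : nat) : option R :=
  if (insub (i %/ n)%N, insub (i %% n)%N) is (Some u, Some v)
  then G u v else None.

Definition input_state n (G : wgraph R n) : state :=
  State [eta (fun=> 0%N) with 0%N |-> n] (fun=> 0)
        (fun i => nat_of_bool (isSome (matrix_entry G i)))
        (fun i => odflt 0 (matrix_entry G i)).

(* A result: word register 0 tells whether the distance is finite, in which
   case it is in weight register 0. *)
Definition answer s : option R :=
  if wreg s 0%N == 0%N then None else Some (xreg s 0%N).

End Machine.

Record oracle := Oracle {
  build : com;
  insert : com;
  query : com }.

(* Words have k * (floor (log2 n) + 1) bits. *)
Definition modulus (k n : nat) : nat := 2 ^ (k * (trunc_log 2 n).+1).

Section DSO.
Variables (R : realDomainType) (O : oracle) (k n S : nat).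
Local Open Scope ring_scope.

Local Notation run := (@exec R (modulus k n) S).

(* [oracle_state G s] : s is the state of the machine after building the
   oracle on some initial graph and then performing some sequence of
   insertions and queries, G being the current graph. *)
Inductive oracle_state : wgraph R n -> state R -> Prop :=
| OBuild (G : wgraph R n) t s : is_wgraph G ->
    run (build O) (input_state G) t s ->
    oracle_state G s
| OInsert (G : wgraph R n) s (a b : 'I_n) (w : R) t s' : oracle_state G s ->
    a != b -> G a b = None -> 0 <= w ->
    run (insert O) (set_args s [:: a : nat; b : nat] [:: w]) t s' ->
    oracle_state (insert_edge G a b w) s'
| OQuery (G : wgraph R n) s (u v a b : 'I_n) t s' : oracle_state G s ->
    adj G a b ->
    run (query O) (set_args s [:: u : nat; v : nat; a : nat; b : nat] [::]) t s' ->
    oracle_state G s'.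

Record incremental_DSO (Tbuild Tinsert Tquery : nat) : Prop :=
  IncrementalDSO {
  DSO_build : forall G : wgraph R n, is_wgraph G ->
    exists t s, run (build O) (input_state G) t s /\ (t <= Tbuild)%N;
  DSO_insert : forall (G : wgraph R n) s (a b : 'I_n) (w : R),
    oracle_state G s -> a != b -> G a b = None -> 0 <= w ->
    exists t s', run (insert O) (set_args s [:: a : nat; b : nat] [:: w]) t s' /\
                 (t <= Tinsert)%N;
  DSO_query : forall (G : wgraph R n) s (u v a b : 'I_n),
    oracle_state G s -> adj G a b ->
    exists t s',
      [/\ run (query O) (set_args s [:: u : nat; v : nat; a : nat; b : nat] [::]) t s',
          (t <= Tquery)%N
        & is_dist (remove_edge G a b) u v (answer s')] }.

End DSO.

(* f = O~(g) : the successor keeps the logarithmic factor positive at n = 1. *)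
Definition soft_O (f g : nat -> nat) : Prop :=
  exists C c, forall n, 0 < n -> f n <= C * (g n * (trunc_log 2 n).+1 ^ c).

(* Main.v *)
Require Import Defs.
From mathcomp Require Import all_boot all_order all_algebra.
From mathcomp Require Import zify lra.

(* The oracle keeps a system of shortest paths P(x,y) that is closed under
   subpaths and reversal, together with values DI(x,y,l,r), one for each pair of
   vertices and l, r <= log n.  DI(x,y,l,r) is attached to the interval of edges
   of P(x,y) that starts 2^l - 1 edges after x and ends 2^r - 1 edges before y.
   It need not be an exact distance: it is only required to be at most the
   length of every walk avoiding the whole interval, and at least the distance
   avoiding any single edge of the interval ("good" values).  For an interval
   reduced to one edge this is the exact replacement distance.

   - Query.  Let I be any interval of P(x,y), let x' lie 2^l - 1 edges before I
     with l maximal, and y' symmetrically 2^r - 1 edges after I.  A walk avoiding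
     I either meets the stretch from x' to I, and may be rerouted through x', or
     avoids that stretch too, hence avoids the interval of DI(x,_,l,_); likewise
     on the side of y.  So the best of four table entries is good for I.  If I
     lies on P(x,c), then I may be replaced by its part on the common prefix of
     P(x,c) and P(x,z) to get a good value for (x,z).
   - Update.  When an edge ab of weight w arrives, P'(x,y) is P(x,y), or
     P(x,a).ab.P(b,y) or P(x,b).ba.P(a,y) if that is strictly shorter, and a good
     value for an interval of P'(x,y) is obtained from good values for (x,y),
     (x,a), (b,y), (x,b), (a,y), each by the previous remark.
   - Construction.  The same update with a = b = k, w = 0 and no edge is a step of
     the Floyd-Warshall algorithm, which allows k as an interior vertex of walks.

   Vertices of P(x,y) are located by bisection on stored midpoints, and common
   prefixes by binary search. *)

Set Implicit Arguments.
Unset Strict Implicit.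
Unset Printing Implicit Defensive.

Import Order.TTheory GRing.Theory Num.Theory.

(** * Walks and good values *)

Section Pairs.
Local Open Scope ring_scope.
Variable n : nat.
Implicit Types (a b u v x y z : 'I_n) (F : rel 'I_n) (s : seq 'I_n).

Lemma same_pairC a b u v : same_pair a b u v = same_pair a b v u.
Proof. by rewrite /same_pair orbC ![(u == _) && _]andbC. Qed.

Lemma same_pairAC a b u v : same_pair a b u v = same_pair b a u v.
Proof. by rewrite /same_pair orbC. Qed.

Lemma same_pair_swap a b u v : same_pair a b u v = same_pair u v a b.
Proof.
rewrite /same_pair [a == u]eq_sym [b == v]eq_sym [a == v]eq_sym [b == u]eq_sym.
by rewrite [(v == a) && _]andbC.
Qed.

Lemma same_pairP a b u v :
  reflect ((u = a /\ v = b) \/ (u = b /\ v = a)) (same_pair a b u v).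
Proof.
apply: (iffP orP) => -[].
- by move=> /andP[/eqP-> /eqP->]; left.
- by move=> /andP[/eqP-> /eqP->]; right.
- by move=> [-> ->]; left; rewrite !eqxx.
- by move=> [-> ->]; right; rewrite !eqxx.
Qed.

Lemma same_pair_sym a b : symmetric (same_pair a b).
Proof. by move=> u v; rewrite same_pairC. Qed.

Definition seg s i j : rel 'I_n := fun u v =>
  has (fun k => [&& i <= k, k < j & same_pair (nth u s k) (nth u s k.+1) u v]%N)
      (iota 0 (size s).-1).

Lemma segP x0 s i j u v :
  reflect (exists k, [/\ (i <= k < j)%N, (k.+1 < size s)%N
             & same_pair (nth x0 s k) (nth x0 s k.+1) u v])
          (seg s i j u v).
Proof.
apply: (iffP hasP) => [[k]|[k [/andP[ik kj] ks sp]]].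
  rewrite mem_iota => ks /and3P[ik kj sp]; exists k; split; first by rewrite ik.
    by lia.
  by rewrite !(set_nth_default u) //; lia.
exists k; first by rewrite mem_iota; lia.
by rewrite ik kj /= !(set_nth_default x0) //; lia.
Qed.

Lemma seg_sym s i j : symmetric (seg s i j).
Proof.
move=> u v; apply/(segP u)/(segP u) => -[k [h1 h2 h3]]; exists k; split=> //;
  by rewrite same_pairC.
Qed.

Lemma seg_rev s i j u v : (j <= (size s).-1)%N ->
  seg (rev s) ((size s).-1 - j)%N ((size s).-1 - i)%N u v = seg s i j u v.
Proof.
move=> js; apply/(segP u)/(segP u); rewrite ?size_rev => -[k [h1 h2 h3]];
  exists (size s - k.+2)%N; split; rewrite ?size_rev; try lia.
  move: h3; rewrite !nth_rev; try lia.
  have -> : (size s - k.+1 = (size s - k.+2).+1)%N by lia.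
  by rewrite same_pairAC.
rewrite !nth_rev; try lia.
have -> : (size s - (size s - k.+2).+1 = k.+1)%N by lia.
have -> : (size s - (size s - k.+2).+2 = k)%N by lia.
by rewrite same_pairAC.
Qed.

Lemma seg_sub s i j i' j' u v : (i' <= i)%N -> (j <= j')%N ->
  seg s i j u v -> seg s i' j' u v.
Proof. by move=> ii jj /(segP u)[k [h1 h2 h3]]; apply/(segP u); exists k; split=> //; lia. Qed.

Lemma seg_take s i j m u v : (j < m)%N -> seg (take m s) i j u v = seg s i j u v.
Proof.
move=> jm; apply/(segP u)/(segP u) => -[k [h1 h2 h3]]; exists k; split=> //.
- by move: h2; rewrite size_take_min; lia.
- by move: h3; rewrite !nth_take //; lia.
- by rewrite size_take_min; lia.
- by rewrite !nth_take //; lia.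
Qed.

Lemma seg_drop s i j m u v :
  seg (drop m s) i j u v = seg s (m + i)%N (m + j)%N u v.
Proof.
apply/(segP u)/(segP u) => -[k [h1 h2 h3]].
  exists (m + k)%N; split; first lia.
    by move: h2; rewrite size_drop; lia.
  by move: h3; rewrite !nth_drop addnS.
exists (k - m)%N; split; first by lia.
  by rewrite size_drop; lia.
by rewrite !nth_drop addnS subnKC //; lia.
Qed.

End Pairs.

Section Walks.
Local Open Scope ring_scope.
Variables (R : realDomainType) (n : nat).
Implicit Types (G : wgraph R n) (K : pred 'I_n) (F : rel 'I_n) (a b u v x y z : 'I_n).

(* [wk G K F x y r]: some walk of length at most [r] goes from [x] to [y] with
   interior vertices in [K], using no edge of [F]. *)
Inductive wk G K F : 'I_n -> 'I_n -> R -> Prop :=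
| WkNil x r : 0 <= r -> wk G K F x x r
| WkEdge x y w r : G x y = Some w -> ~~ F x y -> w <= r -> wk G K F x y r
| WkCat x z y r1 r2 r : K z -> wk G K F x z r1 -> wk G K F z y r2 ->
    r1 + r2 <= r -> wk G K F x y r.

Arguments WkNil {G K F x r}.
Arguments WkEdge {G K F x y w r}.
Arguments WkCat {G K F x z y r1 r2 r}.

Lemma wk_le G K F x y r r' : wk G K F x y r -> r <= r' -> wk G K F x y r'.
Proof.
case=> {x y r} [x r r0|x y w r h1 h2 h3|x z y r1 r2 r h1 h2 h3 h4] le.
- by apply: WkNil; apply: le_trans le.
- by apply: (WkEdge h1 h2); apply: le_trans le.
- by apply: (WkCat h1 h2 h3); apply: le_trans le.
Qed.

Lemma wk_ge0 G K F x y r : is_wgraph G -> wk G K F x y r -> 0 <= r.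
Proof.
move=> wG; elim=> {x y r} [//|x y w r h1 h2|x z y r1 r2 r _ _ h1 _ h2].
  by apply: le_trans; apply: (wgraph_ge0 wG h1).
by apply: le_trans; apply: addr_ge0.
Qed.

Lemma wk_sym G K F x y r : is_wgraph G -> symmetric F ->
  wk G K F x y r -> wk G K F y x r.
Proof.
move=> wG sF; elim=> {x y r} [x r r0|x y w r h1 h2 h3|x z y r1 r2 r Kz _ h1 _ h2 le].
- exact: WkNil.
- by apply: (WkEdge _ _ h3); rewrite 1?(wgraph_sym wG) // sF.
- by apply: (WkCat Kz h2 h1); rewrite addrC.
Qed.

Lemma wk_mono G K F F' x y r : (forall u v, F' u v -> F u v) ->
  wk G K F x y r -> wk G K F' x y r.
Proof.
move=> sub; elim=> {x y r} [x r r0|x y w r h1 h2 h3|x z y r1 r2 r Kz _ h1 _ h2 le].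
- exact: WkNil.
- by apply: (WkEdge h1 _ h3); apply: contra h2; apply: sub.
- exact: (WkCat Kz h1 h2 le).
Qed.

Lemma wk_cat G K F x z y r1 r2 r : is_wgraph G -> K z \/ z = x \/ z = y ->
  wk G K F x z r1 -> wk G K F z y r2 -> r1 + r2 <= r -> wk G K F x y r.
Proof.
move=> wG Kz w1 w2 le; have := wk_ge0 wG w1; have := wk_ge0 wG w2 => r2_0 r1_0.
case: Kz => [Kz|[zx|zy]]; first exact: WkCat Kz w1 w2 le.
  by rewrite -zx; apply: wk_le w2 _; lra.
by rewrite -zy; apply: wk_le w1 _; lra.
Qed.

Lemma wk_touch G K F (Z : pred 'I_n) x y r : is_wgraph G -> wk G K F x y r ->
  (exists z r1 r2, [/\ Z z, wk G K F x z r1, wk G K F z y r2 & r1 + r2 <= r])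
  \/ wk G K (fun u v => [|| F u v, Z u | Z v]) x y r.
Proof.
move=> wG; elim=> {x y r} [x r r0|x y w r h1 h2 h3|x z y r1 r2 r Kz w1 IH1 w2 IH2 le].
- by right; apply: WkNil.
- have w0 : 0 <= w := wgraph_ge0 wG h1.
  case: (boolP (Z x)) => Zx.
    left; exists x, 0, w; split=> //; rewrite ?add0r //; first exact: WkNil.
    by apply: (WkEdge h1 h2).
  case: (boolP (Z y)) => Zy.
    left; exists y, w, 0; split=> //; rewrite ?addr0 //; last exact: WkNil.
    by apply: (WkEdge h1 h2).
  by right; apply: (WkEdge h1 _ h3); rewrite negb_or h2 negb_or Zx Zy.
case: IH1 => [[u [q1 [q2 [Zu v1 v2 le']]]]|IH1].
  left; exists u, q1, (q2 + r2); split=> //; first by apply: (WkCat Kz v2 w2).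
  lra.
case: IH2 => [[u [q1 [q2 [Zu v1 v2 le']]]]|IH2].
  left; exists u, (r1 + q1), q2; split=> //; first by apply: (WkCat Kz w1 v1).
  lra.
by right; apply: (WkCat Kz IH1 IH2 le).
Qed.

(* The single forbidden edge [st] ranges over [F] and, through [s = t], over
   loops, which forbid nothing. *)
Definition good G K F x y (v : option R) : Prop :=
  (forall r, wk G K F x y r -> exists2 q, v = Some q & q <= r) /\
  (forall q, v = Some q ->
     forall s t, s = t \/ F s t -> wk G K (same_pair s t) x y q).

Lemma good_ext G K F F' x y (v : option R) : (forall s t, F s t = F' s t) ->
  good G K F x y v -> good G K F' x y v.
Proof.
move=> e [h1 h2]; split=> [r w|q vq s t st].
  by apply: h1; apply: wk_mono w => s t; rewrite e.
by apply: (h2 _ vq); rewrite e.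
Qed.

End Walks.

Arguments WkNil {R n G K F x r}.
Arguments WkEdge {R n G K F x y w r}.
Arguments WkCat {R n G K F x z y r1 r2 r}.

(** * Systems of shortest paths *)

Section Systems.
Local Open Scope ring_scope.
Variables (R : realDomainType) (n : nat).
Implicit Types (G : wgraph R n) (K : pred 'I_n) (F : rel 'I_n).

(* [P x y] lists the vertices of the chosen shortest path from [x] to [y], both
   ends included; it is empty when [y] cannot be reached from [x]. *)
Record path_system G K (P : 'I_n -> 'I_n -> seq 'I_n) (D : 'I_n -> 'I_n -> R)
  : Prop := PathSystem {
  ps_refl : forall x, P x x = [:: x];
  ps_head : forall x y, (0 < size (P x y))%N -> nth x (P x y) 0 = x;
  ps_rev : forall x y, P y x = rev (P x y);
  ps_sub : forall x y i (z := nth x (P x y) i), (i < size (P x y))%N ->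
    [/\ P x z = take i.+1 (P x y), P z y = drop i (P x y),
        D x y = D x z + D z y & K z \/ z = x \/ z = y];
  ps_avoid : forall F x y, symmetric F -> (0 < size (P x y))%N ->
    (forall k, (k.+1 < size (P x y))%N ->
       ~~ F (nth x (P x y) k) (nth x (P x y) k.+1)) ->
    wk G K F x y (D x y);
  ps_min : forall F x y r, wk G K F x y r ->
    (0 < size (P x y))%N /\ D x y <= r }.

Section Theory.
Variables (G : wgraph R n) (K : pred 'I_n).
Variables (P : 'I_n -> 'I_n -> seq 'I_n) (D : 'I_n -> 'I_n -> R).
Hypotheses (wG : is_wgraph G) (S : path_system G K P D).
Implicit Types (x y z u v p q : 'I_n).

Lemma ps_size_rev x y : size (P y x) = size (P x y).
Proof. by rewrite (ps_rev S) size_rev. Qed.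

Lemma ps_D0 x : D x x = 0.
Proof. by have [] := ps_sub S (i := 0) (x := x) (y := x); rewrite (ps_refl S) //= => _ _; lra. Qed.

Lemma ps_last x y k : (k.+1 = size (P x y))%N -> nth x (P x y) k = y.
Proof.
move=> ks; have h : (0 < size (P y x))%N by rewrite ps_size_rev -ks.
rewrite -[RHS](ps_head S h) (ps_rev S x y) nth_rev; last by rewrite -ks.
by rewrite -ks subSS subn0; apply: set_nth_default; rewrite -ks.
Qed.

Lemma ps_size_pre x y i : (i < size (P x y))%N -> size (P x (nth x (P x y) i)) = i.+1.
Proof. by move=> h; have [-> _ _ _] := ps_sub S h; rewrite size_takel. Qed.

Lemma ps_size_suf x y i : (i < size (P x y))%N ->
  size (P (nth x (P x y) i) y) = (size (P x y) - i)%N.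
Proof. by move=> h; have [_ -> _ _] := ps_sub S h; rewrite size_drop. Qed.

Lemma ps_inj x y i j : (i < size (P x y))%N -> (j < size (P x y))%N ->
  nth x (P x y) i = nth x (P x y) j -> i = j.
Proof. by move=> hi hj e; have := ps_size_pre hi; rewrite e ps_size_pre //; case. Qed.

Lemma ps_uniq x y : uniq (P x y).
Proof. by apply/(uniqP x) => i j hi hj; apply: ps_inj. Qed.

Lemma ps_size_le x y : (size (P x y) <= n)%N.
Proof. by rewrite -[n in leqRHS]card_ord -(card_uniqP (ps_uniq x y)) max_card. Qed.

Lemma ps_ge0 x y : (0 < size (P x y))%N -> 0 <= D x y.
Proof.
move=> h; apply: (wk_ge0 wG (K := K) (F := fun _ _ => false)).
by apply: (ps_avoid S).
Qed.

Lemma ps_wk x y : (0 < size (P x y))%N -> wk G K (fun _ _ => false) x y (D x y).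
Proof. by move=> h; apply: (ps_avoid S). Qed.

Lemma ps_Dsym x y : (0 < size (P x y))%N -> D x y = D y x.
Proof.
have H u v : (0 < size (P u v))%N -> D v u <= D u v.
  move=> h; have [] // := ps_min S (F := fun _ _ => false) (x := v) (y := u) (r := D u v).
  exact: wk_sym (ps_wk h).
by move=> h; apply/le_anti; rewrite !H // ps_size_rev.
Qed.

Lemma ps_tri x z y : K z \/ z = x \/ z = y -> (0 < size (P x z))%N ->
  (0 < size (P z y))%N -> (0 < size (P x y))%N /\ D x y <= D x z + D z y.
Proof.
move=> Kz h1 h2; apply: (ps_min S (F := fun _ _ => false)).
exact: wk_cat wG Kz (ps_wk h1) (ps_wk h2) (lexx _).
Qed.

Lemma ps_pos x y k m : (k.+1 < size (P x y))%N -> (m.+1 < size (P x y))%N ->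
  same_pair (nth x (P x y) k) (nth x (P x y) k.+1)
            (nth x (P x y) m) (nth x (P x y) m.+1) -> k = m.
Proof.
move=> hk hm /same_pairP[[e1 e2]|[e1 e2]]; first by apply: ps_inj (esym e1); lia.
have := ps_inj _ _ e1; have := ps_inj _ _ e2; lia.
Qed.

Lemma ps_avoid1 x y p q : (0 < size (P x y))%N ->
  p = q \/ ~~ seg (P x y) 0 (size (P x y)) p q ->
  wk G K (same_pair p q) x y (D x y).
Proof.
move=> h H; apply: (ps_avoid S) => //; first exact: same_pair_sym.
move=> k hk; apply/negP => /[dup] sp /same_pairP E; case: H => [pq|/negP[]].
  have e : nth x (P x y) k = nth x (P x y) k.+1 by rewrite pq in E; case: E => -[-> ->].
  by have := ps_inj _ _ e; lia.
by apply/(segP x); exists k; split=> //; [lia|rewrite same_pair_swap].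
Qed.

Lemma ps_pre1 x y p q i j i1 : (i1 < size (P x y))%N ->
  (i1 <= i)%N -> p = q \/ seg (P x y) i j p q ->
  wk G K (same_pair p q) x (nth x (P x y) i1) (D x (nth x (P x y) i1)).
Proof.
set z := nth x (P x y) i1.
move=> h1 h H; have [e _ _ _] := ps_sub S h1; rewrite -/z in e.
apply: ps_avoid1; first by rewrite e size_takel.
case: H => [|/(segP x)[m [mi ms sp]]]; first by left.
right; rewrite e; apply/negP => /(segP x)[k [_]]; rewrite size_takel // => ki.
rewrite !nth_take //; last by lia.
rewrite same_pair_swap => sp'; suff: k = m by lia.
apply: (@ps_pos x y); try lia.
by move: sp sp' => /same_pairP[] [-> ->] /same_pairP[] [-> ->];
  apply/same_pairP; auto.
Qed.

Lemma ps_suf1 x y p q i j j1 : (j1 < size (P x y))%N ->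
  (j <= j1)%N -> p = q \/ seg (P x y) i j p q ->
  wk G K (same_pair p q) (nth x (P x y) j1) y (D (nth x (P x y) j1) y).
Proof.
set z := nth x (P x y) j1.
move=> h1 h H; set s := P x y in h1.
have h1' : (j1 < size (P x y))%N by [].
have ez : z = nth y (P y x) ((size s).-1 - j1).
  rewrite (ps_rev S x y) nth_rev; last by rewrite -/s; lia.
  rewrite -/s (_ : size s - _ = j1)%N; last by lia.
  by apply: set_nth_default.
have zs : (0 < size (P z y))%N by rewrite ps_size_suf //; lia.
rewrite ps_Dsym //; apply: wk_sym => //; first exact: same_pair_sym.
rewrite ez; apply: (@ps_pre1 _ _ _ _ ((size s).-1 - j)%N ((size s).-1 - i)%N).
- by rewrite ps_size_rev -/s; lia.
- by lia.
case: H => [|H]; [by left|right]; rewrite (ps_rev S x y) -/s.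
by rewrite seg_rev //; lia.
Qed.

End Theory.
End Systems.

Section OptionOps.
Local Open Scope ring_scope.
Variable R : realDomainType.
Implicit Types u v : option R.

Definition oadd u v := if u is Some r then if v is Some q then Some (r + q) else None else None.
Definition omin u v :=
  if u is Some r then if v is Some q then Some (if r <= q then r else q) else u else v.
Definition omax u v :=
  if u is Some r then if v is Some q then Some (if r <= q then q else r) else None else None.

Definition ole v (r : R) := exists2 q, v = Some q & q <= r.

Lemma ole_min u v r : ole u r \/ ole v r -> ole (omin u v) r.
Proof.
case=> -[q -> le].
  case: v => [t|] /=; last by exists q.
  by case: (lerP q t) => h; [exists q|exists t] => //; lra.
case: u => [t|] /=; last by exists q.
by case: (lerP t q) => h; [exists t|exists q] => //; lra.
Qed.

Lemma ole_max u v r : ole u r -> ole v r -> ole (omax u v) r.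
Proof. by case=> q -> le [t -> le']; rewrite /omax; case: ifP => _; [exists t|exists q]. Qed.

Lemma omin_some u v r : omin u v = Some r -> u = Some r \/ v = Some r.
Proof. by case: u v => [a|] [b|] //=; auto; case: ifP => _; auto. Qed.

Lemma omax_some u v r : omax u v = Some r ->
  exists a b, [/\ u = Some a, v = Some b, a <= r & b <= r].
Proof.
case: u v => [a|] [b|] //= [<-]; exists a, b; case: ifP; rewrite ?lexx //.
by case: (lerP a b) => // h _; split=> //; lra.
Qed.

Lemma oadd_some u v r : oadd u v = Some r ->
  exists a b, [/\ u = Some a, v = Some b & a + b = r].
Proof. by case: u v => [a|] [b|] //= [<-]; exists a, b. Qed.

End OptionOps.

Section Interval.
Local Open Scope ring_scope.
Variables (R : realDomainType) (n : nat).
Variables (G : wgraph R n) (K : pred 'I_n).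
Variables (P : 'I_n -> 'I_n -> seq 'I_n) (D : 'I_n -> 'I_n -> R).
Hypotheses (wG : is_wgraph G) (S : path_system G K P D).
Implicit Types (x y z p q : 'I_n).

Lemma detour_left x y i1 i0 j r :
  (i1 <= i0)%N -> (i0 < j)%N -> (j < size (P x y))%N ->
  wk G K (seg (P x y) i0 j) x y r ->
  (exists r', wk G K (seg (P x y) i0 j) (nth x (P x y) i1) y r' /\
     D x (nth x (P x y) i1) + r' <= r) \/
  wk G K (seg (P x y) i1 j) x y r.
Proof.
set s := P x y; set x' := nth x s i1.
move=> h1 h2 h3 w; pose Z z := has (fun k => nth x s k == z) (iota i1 (i0.+1 - i1)).
case: (wk_touch Z wG w) => [[z [r1 [r2 [/hasP[k]]]]]|w'].
  rewrite mem_iota => hk /eqP ez w1 w2 le; left.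
  have hks : (k < size (P x y))%N by rewrite -/s; lia.
  have [ePz eSz eDz Kz] := ps_sub S hks; rewrite -/s ez in ePz eSz eDz Kz.
  have [_ le1] := ps_min S w1.
  have h1z : (i1 < size (P x z))%N by rewrite ePz size_takel -/s; lia.
  have ex' : nth x (P x z) i1 = x' by rewrite ePz nth_take //; lia.
  have [e1 e2 e3 _] := ps_sub S h1z; rewrite ex' in e1 e2 e3.
  exists (D x' z + r2); split; last by lra.
  have Kz' : K z \/ z = x' \/ z = y.
    case: Kz => [|[zx|]]; auto; right; left; rewrite zx.
    have k0 : k = 0%N.
      apply: (ps_inj S (x := x) (y := y)); rewrite -/s; [lia|lia|].
      by rewrite ez zx (ps_head S) // -/s; lia.
    have -> : x' = nth x s 0 by congr nth; lia.
    by rewrite (ps_head S) // -/s; lia.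
  apply: (wk_cat wG Kz' _ w2 (lexx _)).
  apply: (ps_avoid S); first exact: seg_sym.
    by rewrite e2 size_drop; lia.
  move=> m; rewrite e2 size_drop ePz size_takel // => hm.
  rewrite !(set_nth_default x) ?size_drop ?size_takel //; try lia.
  rewrite !nth_drop !nth_take; try lia.
  apply/negP => /(segP x)[m' [hm' hs']] sp.
  have := ps_pos S (x := x) (y := y) (k := m') (m := i1 + m) hs'.
  rewrite -/s -addnS => /(_ _ sp); lia.
right; apply: wk_mono w' => u v /(segP x)[k [hk hs sp]].
case: (leqP i0 k) => ik.
  by apply/orP; left; apply/(segP x); exists k; split=> //; lia.
apply/orP; right; apply/orP.
have Zk m : (i1 <= m <= i0)%N -> Z (nth x s m).
  by move=> hm; apply/hasP; exists m => //; rewrite mem_iota; lia.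
by case/same_pairP: sp => -[-> ->]; [left|right]; apply: Zk; lia.
Qed.

Lemma nth_rev_path x y k : (k < size (P x y))%N ->
  nth y (P y x) ((size (P x y)).-1 - k) = nth x (P x y) k.
Proof.
move=> h; rewrite (ps_rev S x y) nth_rev; last by lia.
by rewrite (_ : size _ - _ = k)%N; [apply: set_nth_default|lia].
Qed.

Lemma detour_right x y i j0 j1 r :
  (i < j0)%N -> (j0 <= j1)%N -> (j1 < size (P x y))%N ->
  wk G K (seg (P x y) i j0) x y r ->
  (exists r', wk G K (seg (P x y) i j0) x (nth x (P x y) j1) r' /\
     r' + D (nth x (P x y) j1) y <= r) \/
  wk G K (seg (P x y) i j1) x y r.
Proof.
set s := P x y; set y' := nth x s j1.
move=> h1 h2 h3 w; pose m k := ((size s).-1 - k)%N.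
have es i' j' : (j' <= (size s).-1)%N -> forall u v,
    seg (P y x) (m j') (m i') u v = seg s i' j' u v.
  by move=> hj u v; rewrite (ps_rev S x y) seg_rev.
have ey' : nth y (P y x) (m j1) = y' by rewrite nth_rev_path.
have w' : wk G K (seg (P y x) (m j0) (m i)) y x r.
  apply: wk_sym => //; first exact: seg_sym.
  by apply: wk_mono w => u v; rewrite es //; lia.
have := @detour_left y x (m j1) (m j0) (m i) r.
rewrite (ps_size_rev S) -/s ey'.
move=> /(_ _ _ _ w')[|||[r' [v le]]|v]; rewrite /m; try lia.
- left; exists r'; split.
    apply: wk_sym => //; first exact: seg_sym.
    by apply: wk_mono v => u v; rewrite es //; lia.
  by rewrite addrC (ps_Dsym wG S) // (ps_size_suf S (i := j1)) // subn_gt0.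
- right; apply: wk_sym => //; first exact: seg_sym.
  by apply: wk_mono v => u v; rewrite es //; lia.
Qed.

Lemma interval_good x y i j pi pr (s := P x y)
    (x' := nth x s (i - pi)%N) (y' := nth x s (j + pr)%N) v11 v12 v21 v22 :
  (i < j)%N -> (pi <= i <= pi.*2)%N -> (j + pr < size s)%N ->
  (size s <= j + pr.*2.+1)%N ->
  good G K (seg (P x' y') pi (size (P x' y') - pr.+1)%N) x' y' v11 ->
  good G K (seg (P x' y) pi (size (P x' y) - pr.+1)%N) x' y v12 ->
  good G K (seg (P x y') pi (size (P x y') - pr.+1)%N) x y' v21 ->
  good G K (seg s pi (size s - pr.+1)%N) x y v22 ->
  good G K (seg s i j) x y
    (omin (omin (oadd (oadd v11 (Some (D x x'))) (Some (D y' y)))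
                (oadd v12 (Some (D x x'))))
          (omin (oadd v21 (Some (D y' y))) v22)).
Proof.
move=> ij /andP[pi1 pi2] pr1 pr2 g11 g12 g21 g22.
have hx' : (i - pi < size (P x y))%N by rewrite -/s; lia.
have hy' : (j + pr < size (P x y))%N by [].
have [ex1 ex2 ex3 Kx] := ps_sub S hx'.
have [ey1 ey2 ey3 Ky] := ps_sub S hy'.
rewrite -/s -/x' -/y' in ex1 ex2 ex3 Kx ey1 ey2 ey3 Ky.
have sx'y : size (P x' y) = (size s - (i - pi))%N by rewrite ex2 size_drop.
have sxy' : size (P x y') = (j + pr).+1 by rewrite ey1 size_takel.
have hxy' : (i - pi < size (P x y'))%N by rewrite sxy'; lia.
have nxy' : nth x (P x y') (i - pi) = x' by rewrite ey1 nth_take //; lia.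
have [exy1 exy2 exy3 _] := ps_sub S hxy'; rewrite nxy' in exy1 exy2 exy3.
have sx'y' : size (P x' y') = (j + pr - (i - pi)).+1.
  by rewrite exy2 size_drop sxy'; lia.
have e11 u v : seg (P x' y') pi (size (P x' y') - pr.+1) u v = seg s i j u v.
  rewrite exy2 seg_drop -/(P x' y') -exy2 sx'y' ey1 subnK // seg_take; last by lia.
  by congr seg; lia.
have e12 u v : seg (P x' y) pi (size (P x' y) - pr.+1) u v = seg s i (size s - pr.+1) u v.
  by rewrite sx'y ex2 seg_drop subnK //; congr seg; lia.
have e21 u v : seg (P x y') pi (size (P x y') - pr.+1) u v = seg s pi j u v.
  by rewrite sxy' ey1 seg_take; [congr seg|]; lia.
split=> [r w|q vq a b ab].
- rewrite -/(ole _ r).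
  have := @detour_left x y (i - pi) i j r; rewrite -/s -/x'.
  case/(_ _ _ _ w) => [|||[r' [w' le]]|w']; try lia.
  + have := @detour_right x' y pi (j - (i - pi)) (j + pr - (i - pi)) r'.
    have e u v : seg (P x' y) pi (j - (i - pi)) u v = seg s i j u v.
      by rewrite ex2 seg_drop; congr seg; lia.
    have ny' : nth x' (P x' y) (j + pr - (i - pi)) = y'.
      rewrite ex2 nth_drop (_ : _ + _ = j + pr)%N; last by lia.
      exact: set_nth_default.
    rewrite ny' sx'y; case=> [||||[r2 [w2 le2]]|w2]; try lia.
    * by apply: wk_mono w' => u v; rewrite e.
    * have /g11.1 H : wk G K (seg (P x' y') pi (size (P x' y') - pr.+1)) x' y' r2.
        by apply: wk_mono w2 => u v; rewrite e e11.
      apply: ole_min; left; apply: ole_min; left.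
      case: H => q -> qle; exists (q + D x x' + D y' y) => //; lra.
    * have /g12.1 H : wk G K (seg (P x' y) pi (size (P x' y) - pr.+1)) x' y r'.
        by apply: wk_mono w2 => u v; apply: seg_sub; rewrite ?sx'y; lia.
      apply: ole_min; left; apply: ole_min; right.
      case: H => q -> qle; exists (q + D x x') => //; lra.
  + have {}w' : wk G K (seg s pi j) x y r.
      by apply: wk_mono w' => u v; apply: seg_sub; lia.
    have := @detour_right x y pi j (j + pr) r; rewrite -/s -/y'.
    case/(_ _ _ _ w') => [|||[r2 [w2 le2]]|w2]; try lia.
    * have /g21.1 H : wk G K (seg (P x y') pi (size (P x y') - pr.+1)) x y' r2.
        by apply: wk_mono w2 => u v; rewrite e21.
      apply: ole_min; right; apply: ole_min; left.
      case: H => q -> qle; exists (q + D y' y) => //; lra.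
    * apply: ole_min; right; apply: ole_min; right; apply: g22.1.
      by apply: wk_mono w2 => u v; apply: seg_sub; lia.
have wx : wk G K (same_pair a b) x x' (D x x').
  exact: (ps_pre1 S hx' (leq_subr _ _) ab).
have wy : wk G K (same_pair a b) y' y (D y' y).
  exact: (ps_suf1 wG S hy' (leq_addr _ _) ab).
have Kx' : K x' \/ x' = x \/ x' = y by [].
have Ky' : K y' \/ y' = x \/ y' = y by [].
case/omin_some: vq => /omin_some[].
- case/oadd_some => [q1 [q2 [/oadd_some[q3 [q4 [h3 [h4] h5]]] [h6] h7]]].
  have w := g11.2 _ h3 a b; rewrite e11 in w.
  apply: (wk_cat wG Ky' (r1 := q1)); [|exact: wy|lra].
  have Kx2 : K x' \/ x' = x \/ x' = y'.
    case: Kx => [|[|xy]]; auto; exfalso.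
    have := ps_inj S hx' (j := (size s).-1); rewrite -/s -/x'.
    rewrite (ps_last S (y := y)); last by rewrite -/s; lia.
    by move=> /(_ _ xy); lia.
  by apply: (wk_cat wG Kx2 wx (w ab)); lra.
- case/oadd_some => [q3 [q4 [h3 [h4] h5]]].
  have w : wk G K (same_pair a b) x' y q3.
    apply: (g12.2 _ h3 a b); case: ab => [|ab]; [by left|right].
    by rewrite e12; apply: seg_sub ab; lia.
  by apply: (wk_cat wG Kx' wx w); lra.
- case/oadd_some => [q3 [q4 [h3 [h4] h5]]].
  have w : wk G K (same_pair a b) x y' q3.
    apply: (g21.2 _ h3 a b); case: ab => [|ab]; [by left|right].
    by rewrite e21; apply: seg_sub ab; lia.
  by apply: (wk_cat wG Ky' w wy); lra.
- move=> h3; apply: (g22.2 _ h3 a b); case: ab => [|ab]; [by left|right].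
  by apply: seg_sub ab; lia.
Qed.

Definition agree x c z k :=
  [/\ (k < size (P x c))%N, (k < size (P x z))%N & nth x (P x c) k = nth x (P x z) k].

Lemma agree_le x c z k m : (m <= k)%N -> agree x c z k -> agree x c z m.
Proof.
move=> mk [h1 h2 e]; split; [lia|lia|].
have [e1 _ _ _] := ps_sub S h1; have [e2 _ _ _] := ps_sub S h2.
rewrite e in e1; rewrite -(nth_take (n0 := k.+1) x (i := m)) -?e1; last by lia.
by rewrite e2 nth_take //; lia.
Qed.

Lemma agree0 x c z : (0 < size (P x c))%N -> (0 < size (P x z))%N -> agree x c z 0.
Proof. by move=> h1 h2; split=> //; rewrite !(ps_head S). Qed.

Lemma clip_good x c z i j k v (m := minn j k) : agree x c z k ->
  (forall k', agree x c z k' -> (k' <= k)%N) ->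
  ((i < m)%N -> good G K (seg (P x z) i m) x z v) ->
  (~~ (i < m)%N -> v = Some (D x z)) ->
  good G K (seg (P x c) i j) x z v.
Proof.
move=> ak amax gv vD; have [h1 h2 e] := ak.
have es a b : seg (P x c) i m a b = seg (P x z) i m a b.
  apply/(segP x)/(segP x) => -[l [hl hs sp]]; exists l; split=> //; try lia.
    have [_ _ <-] : agree x c z l by apply: agree_le ak; lia.
    by have [_ _ <-] : agree x c z l.+1 by apply: agree_le ak; lia.
  have [_ _ ->] : agree x c z l by apply: agree_le ak; lia.
  by have [_ _ ->] : agree x c z l.+1 by apply: agree_le ak; lia.
have off a b : seg (P x c) i j a b -> ~~ seg (P x c) i m a b ->
    ~~ seg (P x z) 0 (size (P x z)) a b.
  case/(segP x) => l [hl hs sp] nm; apply/negP => /(segP x)[l' [hl' hs' sp']].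
  have kl : (k <= l)%N.
    rewrite leqNgt; apply: contra nm => lk; apply/(segP x); exists l; split=> //; lia.
  have s1 := ps_size_pre S (ltnW hs); have s2 := ps_size_pre S hs.
  have s1' := ps_size_pre S (ltnW hs'); have s2' := ps_size_pre S hs'.
  have [ea eb] : nth x (P x c) l = nth x (P x z) l' /\ nth x (P x c) l.+1 = nth x (P x z) l'.+1.
    case/same_pairP: sp => -[ea eb]; case/same_pairP: sp' => -[ea' eb'];
    by rewrite ea eb in ea' eb'; rewrite -?ea' -?eb' ?s1 ?s2 in s1' s2'; split=> //; lia.
  have ll : l = l' by rewrite ea s1' in s1; lia.
  have := amax l.+1; rewrite /agree ll -eb -ll => H.
  by have := H (And3 hs _ erefl); rewrite ll; lia.
have lowD (q : R) a b : D x z <= q -> a = b \/ seg (P x c) i j a b ->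
    ~~ ((i < m)%N && seg (P x c) i m a b) ->
    wk G K (same_pair a b) x z q.
  move=> le ab nm; apply: wk_le le; apply: (ps_avoid1 S); first by lia.
  case: ab => [|ab]; [by left|right]; apply: off => //.
  apply: contra nm => /[dup] + ->; rewrite andbT => /(segP x)[l []]; lia.
case: (ltnP i m) => im; last first.
  have -> : v = Some (D x z) by apply: vD; rewrite -leqNgt.
  split=> [r w|q [<-] a b ab]; first by exists (D x z) => //; case: (ps_min S w).
  by apply: lowD => //; rewrite ltnNge im.
have [g1 g2] := gv im; split=> [r w|q vq a b ab].
  by apply: g1; apply: wk_mono w => a b; rewrite -es; apply: seg_sub => //; lia.
case: (boolP (seg (P x c) i m a b)) => abm.
  by apply: (g2 _ vq); right; rewrite -es.
have Dq : D x z <= q.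
  by have [] := ps_min S (g2 _ vq a a (or_introl erefl)).
by apply: lowD => //; rewrite im.
Qed.

End Interval.

(** * Updating the path system and the interval values *)

Section MoreSeg.
Local Open Scope ring_scope.
Variable n : nat.
Implicit Types (s t : seq 'I_n).

Lemma seg_catl s t i j p q : seg s i j p q -> seg (s ++ t) i j p q.
Proof.
case/(segP p) => k [hk hs sp]; apply/(segP p); exists k; split=> //.
  by rewrite size_cat; lia.
by rewrite !nth_cat hs ltnW.
Qed.

End MoreSeg.

Section Adjacent.
Local Open Scope ring_scope.
Variables (R : realDomainType) (n : nat) (G : wgraph R n) (K : pred 'I_n).

Lemma wk_blocked (F : rel 'I_n) x y r : (forall u v, G u v <> None -> F u v) ->
  wk G K F x y r -> x = y.
Proof.
move=> blk; elim=> {x y r} // [x y w r e nF _|x z y r1 r2 r _ _ -> _ -> //].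
by rewrite blk // e in nF.
Qed.

Lemma wk_absent (F : rel 'I_n) p q x y r : is_wgraph G -> G p q = None ->
  wk G K F x y r -> wk G K (same_pair p q) x y r.
Proof.
move=> wG e; elim=> {x y r} [x r r0|x y w r h1 h2 h3|x z y r1 r2 r Kz _ h1 _ h2 le].
- exact: WkNil.
- apply: (WkEdge h1) => //; apply/negP => /same_pairP[] [ex ey].
    by rewrite ex ey e in h1.
  by rewrite ex ey (wgraph_sym wG) e in h1.
- exact: WkCat Kz h1 h2 le.
Qed.

Lemma ps_adj P D x y i j p q : is_wgraph G -> path_system G K P D ->
  seg (P x y) i j p q -> G p q <> None.
Proof.
move=> wG S /(segP x)[k [_ hk sp]].
set u := nth x (P x y) k in sp; set v := nth x (P x y) k.+1 in sp.
suff : G u v <> None.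
  by case/same_pairP: sp => -[-> ->] //; rewrite (wgraph_sym wG).
move=> e; have [_ h2 _ _] := ps_sub S (ltnW hk); rewrite -/u in h2.
have hk' : (1 < size (P u y))%N by rewrite h2 size_drop; lia.
have [h3 _ _ _] := ps_sub S hk'.
have ev : nth u (P u y) 1 = v.
  by rewrite h2 nth_drop addn1; apply: set_nth_default.
rewrite ev in h3; pose F s t := ~~ same_pair u v s t.
have uv : u <> v by move/(ps_inj S (ltnW hk) hk); lia.
apply: uv; apply: (@wk_blocked F u v (D u v)).
  move=> s t; apply: contraPN => /same_pairP[] [-> ->]; first by rewrite e.
  by rewrite (wgraph_sym wG) e.
apply: (ps_avoid S); first by move=> s t; rewrite /F same_pairC.
  by rewrite h3 size_takel.
rewrite h3 size_takel // => -[|//] _; rewrite /F negbK !nth_take // ev.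
by rewrite (ps_head S); [apply/same_pairP; left|lia].
Qed.

End Adjacent.

Section Relax.
Local Open Scope ring_scope.
Variables (R : realDomainType) (n : nat).
Variables (G G' : wgraph R n) (K K' : pred 'I_n).
Variables (P : 'I_n -> 'I_n -> seq 'I_n) (D : 'I_n -> 'I_n -> R).
Variables (a b : 'I_n) (w : R) (lam : bool).
Implicit Types (c d g x y z p q : 'I_n) (F : rel 'I_n).

Definition link c c' := (c = a /\ c' = b) \/ (c = b /\ c' = a).

(* Passing from [(G, K)] to [(G', K')] lets walks use one more connection: the
   new edge [ab] when [lam] holds, the new interior vertex [a = b] otherwise. *)
Record extension : Prop := Extension {
  ext_wg : is_wgraph G';
  ext_w0 : 0 <= w;
  ext_K : forall x, K x -> K' x;
  ext_Ka : K' a;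
  ext_Kb : K' b;
  ext_edge : lam -> [/\ G a b = None, a <> b, K a & K b];
  ext_vertex : ~~ lam -> a = b /\ w = 0;
  ext_split : forall F x y r, symmetric F -> wk G' K' F x y r ->
    wk G K F x y r \/ exists c c' r1 r2, [/\ link c c', (lam -> ~~ F a b),
      wk G K F x c r1, wk G K F c' y r2 & r1 + w + r2 <= r];
  ext_old : forall F x y r, wk G K F x y r -> wk G' K' F x y r;
  ext_via : forall F x y c c' r1 r2, symmetric F -> link c c' -> (lam -> ~~ F a b) ->
    wk G K F x c r1 -> wk G K F c' y r2 -> wk G' K' F x y (r1 + w + r2) }.

Definition improves c c' x y :=
  [&& (0 < size (P x c))%N, (0 < size (P c' y))%N &
      ~~ ((0 < size (P x y))%N && (D x y <= D x c + w + D c' y))].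

Definition newP x y :=
  if improves a b x y then P x a ++ drop (~~ lam) (P b y)
  else if improves b a x y then P x b ++ drop (~~ lam) (P a y)
  else P x y.

Definition newD x y :=
  if improves a b x y then D x a + w + D b y
  else if improves b a x y then D x b + w + D a y
  else D x y.

Hypotheses (wG : is_wgraph G) (S : path_system G K P D) (E : extension).
Let wG' := ext_wg E.
Let w0 := ext_w0 E.

Let addwC (u v : R) : u + w + v = v + w + u. Proof. lra. Qed.

Lemma link_sym c c' : link c c' -> link c' c.
Proof. by case=> -[-> ->]; [right|left]. Qed.

Lemma link_K c c' : link c c' -> K' c.
Proof. by case=> -[-> _]; [apply: (ext_Ka E)|apply: (ext_Kb E)]. Qed.

Lemma link_lamK c c' : lam -> link c c' -> K c.
Proof. by move=> /(ext_edge E)[_ _ Ka Kb] [] [-> _]. Qed.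

Lemma link_eq c c' : ~~ lam -> link c c' -> c = a /\ c' = a.
Proof. by move=> /(ext_vertex E)[ab _]; case=> -[-> ->]; rewrite -?ab. Qed.

Lemma improves_sym c c' x y : improves c c' x y = improves c' c y x.
Proof.
rewrite /improves !(ps_size_rev S x) !(ps_size_rev S c').
case: ltnP => //= h1; case: ltnP => //= h2; rewrite (ps_Dsym wG S h1) (ps_Dsym wG S h2).
case: ltnP => //= h3; rewrite (ps_Dsym wG S h3).
by rewrite addwC.
Qed.

Lemma improves_excl x y : improves a b x y -> improves b a x y -> a = b.
Proof.
case/and3P=> h1 h2 i1 /and3P[h3 h4 i2].
case: (boolP lam) => [/(ext_edge E)[_ _ Ka Kb]|/(ext_vertex E)[] //].
have [s1 t1] := ps_tri wG S (or_introl Ka) h1 h4.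
have [s2 t2] := ps_tri wG S (or_introl Kb) h3 h2.
exfalso; move: i1 i2 w0; rewrite s1 /= -!ltNge; lra.
Qed.

Lemma newP_link c c' x y : link c c' -> improves c c' x y ->
  newP x y = P x c ++ drop (~~ lam) (P c' y) /\ newD x y = D x c + w + D c' y.
Proof.
rewrite /newP /newD; case=> -[-> ->] i1; first by rewrite i1.
case: ifP => i2; last by rewrite i1.
by rewrite -(improves_excl i2 i1).
Qed.

Lemma newP_cases x y :
  (exists c c', [/\ link c c', improves c c' x y,
      newP x y = P x c ++ drop (~~ lam) (P c' y) & newD x y = D x c + w + D c' y])
  \/ [/\ forall c c', link c c' -> ~~ improves c c' x y, newP x y = P x y & newD x y = D x y].
Proof.
case i1: (improves a b x y).
  have l : link a b by left.
  by left; exists a, b; have [-> ->] := newP_link l i1.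
case i2: (improves b a x y).
  have l : link b a by right.
  by left; exists b, a; have [-> ->] := newP_link l i2.
right; rewrite /newP /newD i1 i2; split=> // c c' [] [-> ->]; by rewrite ?i1 ?i2.
Qed.

Lemma newP_rev x y : newP y x = rev (newP x y).
Proof.
case: (newP_cases x y) => [[c [c' [l i e _]]]|[ni e _]].
  have l' := link_sym l; have [-> _] := newP_link l' (etrans (esym (improves_sym c c' x y)) i).
  rewrite e rev_cat; case/and3P: i => h1 h2 _.
  case: (boolP lam) => /= hl; first by rewrite !drop0 -!(ps_rev S).
  have [ec ec'] := link_eq hl l; rewrite ec ec' in h1 h2 *.
  have ea u : (0 < size (P a u))%N -> P a u = a :: drop 1 (P a u).
    by move=> h; have := ps_head S h; case: (P a u) h => //= t s _ ->; rewrite drop0.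
  have h1' : (0 < size (P a x))%N by rewrite (ps_size_rev S).
  rewrite -(ps_rev S x a) (ps_rev S a y) (ea _ h2) (ea _ h1') /= !drop0.
  by rewrite rev_cons cat_rcons.
rewrite e -(ps_rev S); case: (newP_cases y x) => [[c [c' [l i _ _]]]|[]//].
by case/negP: (ni c' c (link_sym l)); rewrite improves_sym.
Qed.

Lemma newD_sym x y : (0 < size (newP x y))%N -> newD y x = newD x y.
Proof.
case: (newP_cases x y) => [[c [c' [l i e ->]]]|[ni e ->]] h.
  have l' := link_sym l; have [_ ->] := newP_link l' (etrans (esym (improves_sym c c' x y)) i).
  case/and3P: i => h1 h2 _.
  by rewrite (ps_Dsym wG S h1) (ps_Dsym wG S h2) addwC.
case: (newP_cases y x) => [[c [c' [l i _ _]]]|[_ _ ->]].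
  by case/negP: (ni c' c (link_sym l)); rewrite improves_sym.
by rewrite (ps_Dsym wG S) // (ps_size_rev S) -e.
Qed.

Lemma newD_le_old x y : (0 < size (P x y))%N ->
  (0 < size (newP x y))%N /\ newD x y <= D x y.
Proof.
move=> h; case: (newP_cases x y) => [[c [c' [l i -> ->]]]|[ni -> ->]] //.
case/and3P: i => h1 h2; rewrite h /= -ltNge => lt.
by rewrite size_cat ltn_addr // ltW.
Qed.

Lemma newD_le_link c c' x y : link c c' -> (0 < size (P x c))%N -> (0 < size (P c' y))%N ->
  (0 < size (newP x y))%N /\ newD x y <= D x c + w + D c' y.
Proof.
move=> l h1 h2; case: (newP_cases x y) => [[d [d' [l' i -> ->]]]|[ni -> ->]].
  split; first by case/and3P: i => ? _ _; rewrite size_cat ltn_addr.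
  case i2: (improves c c' x y).
    by have [_ <-] := newP_link l i2; have [_ <-] := newP_link l' i.
  move/negbT: i2; rewrite /improves h1 h2 negbK => /andP[h3 le].
  by case/and3P: i; rewrite h3 /= -ltNge => _ _; lra.
by have := ni _ _ l; rewrite /improves h1 h2 negbK => /andP.
Qed.

Lemma new_wk x y : (0 < size (newP x y))%N -> wk G' K' (fun _ _ => false) x y (newD x y).
Proof.
case: (newP_cases x y) => [[c [c' [l i -> ->]]]|[ni -> ->]] h.
  case/and3P: i => h1 h2 _.
  by apply: (ext_via E _ l) => //; apply: (ps_wk S).
by apply: (ext_old E); apply: (ps_wk S).
Qed.

Lemma new_min F x y r : wk G' K' F x y r -> (0 < size (newP x y))%N /\ newD x y <= r.
Proof.
have w1 : wk G' K' F x y r -> wk G' K' (fun _ _ => false) x y r by apply: wk_mono.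
move/w1; case/(ext_split E) => // [/(ps_min S)[h le]|].
  by have [h' le'] := newD_le_old h; split=> //; lra.
case=> c [c' [r1 [r2 [l _ /(ps_min S)[h1 le1] /(ps_min S)[h2 le2] le]]]].
by have [h' le'] := newD_le_link l h1 h2; split=> //; lra.
Qed.

Lemma not_improves x y : (0 < size (P x y))%N -> D x y <= newD x y ->
  newP x y = P x y /\ newD x y = D x y.
Proof.
move=> h le; case: (newP_cases x y) => [[c [c' [l i _ e]]]|[_ -> ->]] //.
by case/and3P: i; rewrite h /= -e -ltNge => _ _; lra.
Qed.

Lemma new_half c c' x y i z : link c c' -> improves c c' x y ->
  (i < size (P x c))%N -> z = nth x (P x c) i ->
  [/\ newP x z = P x z, newD x z = D x z,
      newP z y = P z c ++ drop (~~ lam) (P c' y)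
    & newD z y = D z c + w + D c' y].
Proof.
move=> l im hi ez; have [eP eD] := newP_link l im; have [h1 h2 nim] := and3P im.
have [z1 z2 z3 Kz] := ps_sub S hi; rewrite -ez in z1 z2 z3 Kz.
have hxz : (0 < size (P x z))%N by rewrite z1 size_takel.
have hzc : (0 < size (P z c))%N by rewrite z2 size_drop subn_gt0.
have [sxz lxz] := newD_le_old hxz.
have Kz' : K' z \/ z = x \/ z = y.
  by case: Kz => [/(ext_K E)|[]]; auto => ->; left; apply: link_K l.
have [e1 e2] : newP x z = P x z /\ newD x z = D x z.
  apply: not_improves => //.
  have w1 := new_wk sxz.
  have w2 : wk G' K' (fun _ _ => false) z y (D z c + w + D c' y).
    by apply: (ext_via E _ l) => //; apply: (ps_wk S).
  by have [_] := new_min (wk_cat wG' Kz' w1 w2 (lexx _)); rewrite eD; lra.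
rewrite e1 e2; case imz: (improves c c' z y).
  by have [-> ->] := newP_link l imz.
move/negbT: imz; rewrite /improves hzc h2 negbK => /andP[hzy le].
have nK : ~ (K z \/ z = x \/ z = y).
  move=> Kz2; have [hxy le2] := ps_tri wG S Kz2 hxz hzy.
  by move: nim; rewrite hxy /= -ltNge; lra.
have zc : z = c by case: Kz => [?|[?|//]]; case: nK; auto.
have nl : ~~ lam by apply/negP => hl; apply: nK; left; rewrite zc; apply: link_lamK l.
have [ec ec'] := link_eq nl l; have [_ ew] := ext_vertex E nl.
have [-> ->] : newP z y = P z y /\ newD z y = D z y.
  case: (newP_cases z y) => [[d [d' [ld]]]|[]//].
  have [-> ->] := link_eq nl ld; rewrite zc ec /improves (ps_D0 S) ew.
  by rewrite zc ec in hzy; rewrite hzy !add0r lexx !andbF.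
rewrite zc ec ec' (ps_refl S) (ps_D0 S) ew nl /=; split=> //; last by lra.
have hay : (0 < size (P a y))%N by rewrite -ec'.
by have := ps_head S hay; case: (P a y) hay => //= t s _ ->; rewrite drop0.
Qed.

Lemma size_newP c c' x y : link c c' -> improves c c' x y ->
  size (newP x y) = (size (P x c) + size (P c' y) - ~~ lam)%N.
Proof.
move=> l i; have [-> _] := newP_link l i; case/and3P: i => h1 h2 _.
by rewrite size_cat size_drop; case: lam => /=; lia.
Qed.

Lemma new_sub_half c c' x y i (z := nth x (newP x y) i) :
  link c c' -> improves c c' x y -> (i < size (P x c))%N ->
  [/\ newP x z = take i.+1 (newP x y), newP z y = drop i (newP x y),
      newD x y = newD x z + newD z y & K' z \/ z = x \/ z = y].
Proof.
move=> l im hi; have [eP eD] := newP_link l im.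
have ez : z = nth x (P x c) i by rewrite /z eP nth_cat hi.
have [-> -> -> ->] := new_half l im hi ez.
have [z1 z2 z3 Kz] := ps_sub S hi; rewrite -ez in z1 z2 z3 Kz.
rewrite eP eD z1 z2 takel_cat // drop_cat hi; split=> //; first by lra.
by case: Kz => [/(ext_K E)|[]]; auto => ->; left; apply: link_K l.
Qed.

Lemma new_sub_old x y i (z := nth x (P x y) i) : newP x y = P x y ->
  newD x y = D x y -> (i < size (P x y))%N -> newP x z = P x z /\ newD x z = D x z.
Proof.
move=> eP eD hi; have [z1 z2 z3 Kz] := ps_sub S hi; rewrite -/z in z1 z2 z3 Kz.
have hxz : (0 < size (P x z))%N by rewrite z1 size_takel.
have hzy : (0 < size (P z y))%N by rewrite z2 size_drop subn_gt0.
have [sxz lxz] := newD_le_old hxz; have [szy lzy] := newD_le_old hzy.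
have Kz' : K' z \/ z = x \/ z = y by case: Kz => [/(ext_K E)|[]]; auto.
apply: not_improves => //.
by have [_] := new_min (wk_cat wG' Kz' (new_wk sxz) (new_wk szy) (lexx _)); rewrite eD; lra.
Qed.

Lemma new_seg_split c c' x y i j p q :
  link c c' -> improves c c' x y -> (i < j)%N -> (j < size (newP x y))%N ->
  seg (newP x y) i j p q ->
  [\/ seg (P x c) i j p q,
      seg (P y c') ((size (newP x y)).-1 - j) ((size (newP x y)).-1 - i) p q |
      [/\ lam, same_pair a b p q, (i < size (P x c))%N & (size (P x c) <= j)%N]].
Proof.
move=> l im ij js /(segP x)[k [hk hs sp]].
have [eP eD] := newP_link l im; have [h1 h2 _] := and3P im.
have sz := size_newP l im.
case: (ltnP k.+1 (size (P x c))) => hkc.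
  constructor 1; apply/(segP x); exists k; split=> //.
  by rewrite eP !nth_cat hkc ltnW // in sp.
have im' : improves c' c y x by rewrite -improves_sym.
have [eP' eD'] := newP_link (link_sym l) im'.
case: (boolP (lam && (k.+1 == size (P x c)))) => [/andP[hl /eqP ek]|hne].
  constructor 3; split=> //; try lia.
  rewrite eP hl /= drop0 !nth_cat ek leqnn ltnn subnn in sp.
  rewrite (ps_last S ek) (set_nth_default c') // (ps_head S h2) in sp.
  by case: l sp => -[-> ->] //; rewrite same_pairAC.
constructor 2; apply/(segP y).
have hk2 : ((size (newP x y) - k.+2).+1 < size (P y c'))%N.
  rewrite (ps_size_rev S c' y); move: hne sz; case: lam => /= hne sz; lia.
exists (size (newP x y) - k.+2)%N; split=> //; first by lia.
have e m : (m < size (P y c'))%N -> (m < size (newP x y))%N ->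
    nth y (P y c') m = nth x (newP x y) (size (newP x y) - m.+1).
  move=> hm hm'; have -> : nth y (P y c') m = nth y (newP y x) m by rewrite eP' nth_cat hm.
  by rewrite newP_rev nth_rev //; apply: set_nth_default; lia.
rewrite !e //; try lia.
have -> : (size (newP x y) - (size (newP x y) - k.+2).+2 = k)%N by lia.
have -> : (size (newP x y) - (size (newP x y) - k.+2).+1 = k.+1)%N by lia.
by rewrite same_pairAC.
Qed.

Lemma new_system : path_system G' K' newP newD.
Proof.
have hd x y : (0 < size (newP x y))%N -> nth x (newP x y) 0 = x.
  case: (newP_cases x y) => [[c [c' [_ i -> _]]]|[_ -> _]]; last exact: (ps_head S).
  by case/and3P: i => h _ _ _; rewrite nth_cat h (ps_head S).
have nD0 x : newP x x = P x x /\ newD x x = D x x.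
  have hx : (0 < size (P x x))%N by rewrite (ps_refl S).
  apply: not_improves => //; rewrite (ps_D0 S).
  have [h _] := newD_le_old hx.
  exact: wk_ge0 wG' (new_wk h).
split=> //.
- by move=> x; have [-> _] := nD0 x; apply: (ps_refl S).
- exact: newP_rev.
- move=> x y i z hi; case: (newP_cases x y) => [[c [c' [l im eP eD]]]|[ni eP eD]].
    case: (ltnP i (size (P x c))) => hic; first exact: new_sub_half l im hic.
    have im' : improves c' c y x by rewrite -improves_sym.
    have sz := size_newP l im; have [h1 h2 _] := and3P im.
    have hi2 : ((size (newP x y)).-1 - i < size (P y c'))%N.
      by rewrite (ps_size_rev S c' y); move: sz; case: lam => /= sz; lia.
    have := new_sub_half (link_sym l) im' hi2.
    have -> : nth y (newP y x) ((size (newP x y)).-1 - i) = z.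
      rewrite newP_rev nth_rev; last by lia.
      by rewrite (_ : _ - _ = i)%N; [apply: set_nth_default|lia].
    case=> e1 e2 e3 Kz.
    have hsz : size (newP y x) = size (newP x y) by rewrite newP_rev size_rev.
    have hz1 : (0 < size (newP x z))%N.
      by rewrite newP_rev e2 size_rev size_drop hsz; lia.
    have hz2 : (0 < size (newP z y))%N.
      by rewrite newP_rev e1 size_rev size_take_min hsz; lia.
    split.
    + rewrite newP_rev e2 (newP_rev x y) drop_rev revK; congr take; lia.
    + rewrite newP_rev e1 (newP_rev x y) take_rev revK; congr drop; lia.
    + by rewrite -(newD_sym hz1) -(newD_sym hz2) -(newD_sym (leq_ltn_trans (leq0n i) hi)) e3 addrC.
    + by case: Kz => [|[]]; auto.
  rewrite {}/z; rewrite eP in hi *; rewrite eD; set z := nth _ _ _.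
  have [z1 z2 z3 Kz] := ps_sub S hi; rewrite -/z in z1 z2 z3 Kz.
  have [-> ->] := new_sub_old eP eD hi; rewrite -/z.
  have eP' : newP y x = P y x by rewrite newP_rev eP -(ps_rev S).
  have hxy : (0 < size (newP x y))%N by rewrite eP; lia.
  have hxy' : (0 < size (P x y))%N by lia.
  have eD' : newD y x = D y x by rewrite newD_sym // eD (ps_Dsym wG S).
  have hi' : ((size (P x y)).-1 - i < size (P y x))%N by rewrite (ps_size_rev S x y); lia.
  have := new_sub_old eP' eD' hi'.
  rewrite (nth_rev_path S hi) -/z => -[e1 e2].
  have hzy : (0 < size (P z y))%N by rewrite z2 size_drop subn_gt0.
  have e3 : newP z y = P z y by rewrite newP_rev e1 -(ps_rev S).
  have e4 : newD z y = D z y.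
    by rewrite -newD_sym ?e3 // e2 (ps_Dsym wG S) // (ps_size_rev S).
  rewrite e3 e4; split=> //.
  by case: Kz => [/(ext_K E)|[]]; auto.
- move=> F x y sF h av; case: (newP_cases x y) => [[c [c' [l im eP eD]]]|[ni eP eD]]; last first.
    by rewrite eD; apply: (ext_old E); rewrite eP in h av; apply: (ps_avoid S).
  have [h1 h2 _] := and3P im; have sz := size_newP l im; rewrite eD.
  have im' : improves c' c y x by rewrite -improves_sym.
  have [eP' eD'] := newP_link (link_sym l) im'.
  have avF p q i j : seg (newP x y) i j p q -> ~~ F p q.
    case/(segP x) => k [_ hs sp]; have := av k hs.
    by case/same_pairP: sp => -[-> ->] //; rewrite sF.
  apply: (ext_via E sF l).
  + move=> hl; rewrite hl subn0 in sz.
    apply: (avF _ _ (size (P x c)).-1 (size (P x c))); apply/(segP x).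
    exists (size (P x c)).-1; split; try lia.
    rewrite eP hl drop0 prednK // !nth_cat ltnn prednK // leqnn subnn.
    rewrite (ps_last S (y := c)) ?prednK // (set_nth_default c') // (ps_head S) //.
    by case: l => -[-> ->]; apply/same_pairP; auto.
  + apply: (ps_avoid S) => // k hk; apply: (avF _ _ k k.+1).
    rewrite eP; apply: seg_catl; apply/(segP x); exists k; split=> //; first by lia.
    by apply/same_pairP; auto.
  + rewrite (ps_Dsym wG S h2); apply: wk_sym => //.
    apply: (ps_avoid S) => //; first by rewrite (ps_size_rev S).
    move=> k hk; have : seg (newP y x) k k.+1 (nth y (P y c') k) (nth y (P y c') k.+1).
      rewrite eP'; apply: seg_catl; apply/(segP y); exists k; split=> //; first by lia.
      by apply/same_pairP; auto.
    rewrite newP_rev => sg; have sz' : size (newP y x) = size (newP x y).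
      by rewrite newP_rev size_rev.
    have hk' : (k.+1 < size (newP y x))%N by rewrite eP' size_cat; lia.
    have := @seg_rev _ (newP x y) ((size (newP x y)).-1 - k.+1) ((size (newP x y)).-1 - k)
      (nth y (P y c') k) (nth y (P y c') k.+1) (leq_subr _ _).
    rewrite !subKn; try lia.
    by move=> e; rewrite e in sg; apply: avF sg.
- by move=> F x y r; apply: new_min.
Qed.

Lemma improves_cross c c' g g' x y i j p q :
  link c c' -> improves c c' x y -> seg (P x c) i j p q ->
  link g g' -> (0 < size (P x g))%N -> (0 < size (P g' y))%N ->
  seg (P g' y) 0 (size (P g' y)) p q ->
  wk G' K' (same_pair p q) x y (D x g + w + D g' y).
Proof.
move=> l im sg1 lg hxg hgy sg2.
case/(segP x): (sg1) => k [hk hs sp1]; case/(segP g'): (sg2) => m [hm hms sp2].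
set u := nth x (P x c) k in sp1; set v := nth x (P x c) k.+1 in sp1.
have [_ _ eu Ku] := ps_sub S (ltnW hs); rewrite -/u in eu Ku.
have hxu : (0 < size (P x u))%N by rewrite (ps_size_pre S (ltnW hs)).
have huc : (0 < size (P u c))%N by rewrite (ps_size_suf S (ltnW hs)); lia.
have [h1 h2 nim] := and3P im.
have : (nth g' (P g' y) m = v /\ nth g' (P g' y) m.+1 = u) \/
       (nth g' (P g' y) m = u /\ nth g' (P g' y) m.+1 = v).
  by case/same_pairP: sp1 sp2 => -[-> ->] /same_pairP[] [<- <-]; auto.
case=> -[em em1].
  have [_ e2 e3 _] := ps_sub S hms; rewrite em1 in e2 e3.
  have hgu : (0 < size (P g' u))%N by rewrite -em1 (ps_size_pre S hms).
  have w1 : wk G K (same_pair p q) x u (D x u).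
    apply: (ps_pre1 S (ltnW hs) (i := k) (j := k.+1)) => //.
    by right; apply/(segP x); exists k; split=> //; rewrite leqnn ltnSn.
  have w2 : wk G K (same_pair p q) u y (D u y).
    rewrite -em1; apply: (ps_suf1 wG S hms (i := m) (j := m.+1)) => //.
    by right; apply/(segP g'); exists m; split=> //; rewrite leqnn ltnSn.
  have Ku' : K' u \/ u = x \/ u = y.
    by case: Ku => [/(ext_K E)|[]]; auto => ->; left; apply: link_K l.
  apply: (wk_cat wG' Ku' (ext_old E w1) (ext_old E w2)).
  have [_ eDu _ _] := new_half l im (ltnW hs) (erefl u).
  have [_] := newD_le_link lg hxg hgu; rewrite eDu; lra.
have uc : u <> c.
  move=> euc; have := ps_inj S (ltnW hs) (j := (size (P x c)).-1).
  by rewrite (ps_last S (k := (size (P x c)).-1)) => [/(_ _ euc)|]; lia.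
case: (boolP (g == c)) => [/eqP gc|gc].
  have gc' : g' = c'.
    case: l lg => -[e1 e2] [] [e3 e4]; rewrite ?e1 ?e2 ?e3 ?e4 // in gc *;
    by rewrite ?gc // -gc.
  rewrite gc' in em em1 hms hgy *; rewrite gc.
  have [_ _ e3 _] := ps_sub S (ltnW hms); rewrite em in e3.
  have huy : (0 < size (P u y))%N by rewrite -em (ps_size_suf S (ltnW hms)); lia.
  have hcu : (0 < size (P c' u))%N by rewrite -em (ps_size_pre S (ltnW hms)).
  have Ku2 : K u \/ u = x \/ u = y by case: Ku => [|[]]; auto.
  have [hxy le] := ps_tri wG S Ku2 hxu huy.
  have := ps_ge0 wG S huc; have := ps_ge0 wG S hcu; have := w0.
  by move: nim; rewrite hxy /= -ltNge; lra.
have eg : g' = c.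
  by case: l lg gc => -[-> _] [] [-> ->]; rewrite ?eqxx.
rewrite eg in em em1 hms; exfalso.
have := ps_size_pre S (ltnW hms); have := ps_size_pre S hms.
rewrite em em1 (ps_size_rev S v c) (ps_size_rev S u c).
rewrite (ps_size_suf S hs) (ps_size_suf S (ltnW hs)); lia.
Qed.

(* The new shortest path from [x] to [y] starts along [P x c] and ends along
   [P c' y]; it crosses the new connection, or both are all of [P x y]. *)
Definition route c c' x y :=
  (link c c' /\ improves c c' x y) \/
  [/\ c = y, c' = x & forall d d', link d d' -> ~~ improves d d' x y].

Definition crosses c c' x y i j :=
  [&& size (P x c) + size (P c' y) == size (newP x y), i < size (P x c)
    & size (P x c) <= j]%N.

Lemma new_interval_good c c' x y i j (h := (size (newP x y)).-1)
    vxy vyx vxa vyb vxb vya :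
  route c c' x y -> (i < j)%N -> (j < size (newP x y))%N ->
  good G K (seg (P x c) i j) x y vxy ->
  good G K (seg (P y c') (h - j)%N (h - i)%N) y x vyx ->
  (~~ crosses c c' x y i j ->
    [/\ good G K (seg (P x c) i j) x a vxa,
        good G K (seg (P y c') (h - j)%N (h - i)%N) y b vyb,
        good G K (seg (P x c) i j) x b vxb &
        good G K (seg (P y c') (h - j)%N (h - i)%N) y a vya]) ->
  good G' K' (seg (newP x y) i j) x y
    (omin (omax vxy vyx)
          (if crosses c c' x y i j then None
           else omin (oadd (oadd vxa (Some w)) vyb)
                     (oadd (oadd vxb (Some w)) vya))).
Proof.
move=> rt ij js gxy gyx gab; set F := seg (newP x y) i j.
pose F1 := seg (P x c) i j; pose F2 := seg (P y c') (h - j)%N (h - i)%N.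
have sF : symmetric F by apply: seg_sym.
have jh : (j <= h)%N by rewrite /h; lia.
have split_F p q : F p q -> [\/ F1 p q, F2 p q |
    [/\ lam, same_pair a b p q & crosses c c' x y i j]].
  case: rt => [[l im]|[cy _ ni]].
    case/(new_seg_split l im ij js) => [|f|[hl sp h1 h2]]; [by apply: Or31| |].
      by apply: Or32.
    apply: Or33; split=> //.
    by rewrite /crosses h1 h2 (size_newP l im) hl subn0 eqxx.
  case: (newP_cases x y) => [[d [d' [l im]]]|[_ e _]]; last by rewrite /F /F1 e cy; apply: Or31.
  by move: (ni _ _ l); rewrite im.
have sub1 p q : F1 p q -> F p q.
  case: rt => [[l im]|[cy _ ni]].
    by have [e _] := newP_link l im; rewrite /F e; apply: seg_catl.
  case: (newP_cases x y) => [[d [d' [l im]]]|[_ e _]]; last by rewrite /F /F1 e cy.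
  by move: (ni _ _ l); rewrite im.
have sub2 p q : F2 p q -> F p q.
  have eF : seg (newP y x) (h - j)%N (h - i)%N p q = F p q by rewrite newP_rev seg_rev.
  rewrite -eF /F2; case: rt => [[l im]|[_ -> ni]].
    have [e _] := newP_link (link_sym l) (etrans (esym (improves_sym c c' x y)) im).
    by rewrite e; apply: seg_catl.
  case: (newP_cases y x) => [[d [d' [l im]]]|[_ -> _]] //.
  by move: (ni _ _ (link_sym l)); rewrite -improves_sym im.
have cross_ab : crosses c c' x y i j -> lam /\ F a b.
  case/and3P=> /eqP e ic cj; case: rt => [[l im]|[cy c'x ni]].
    have [h1 h2 _] := and3P im; have sz := size_newP l im.
    have hl : lam by apply: contraT => nl; rewrite nl in sz; lia.
    have [eP _] := newP_link l im.
    split=> //; apply/(segP x); exists (size (P x c)).-1; split; try lia.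
    rewrite eP hl /= drop0 prednK // !nth_cat ltnn prednK // leqnn subnn.
    rewrite (ps_last S (y := c)) ?prednK // (set_nth_default c') // (ps_head S) //.
    by case: l => -[-> ->]; apply/same_pairP; auto.
  case: (newP_cases x y) => [[d [d' [l im]]]|[_ eP _]].
    by move: (ni _ _ l); rewrite im.
  by move: e ic; rewrite cy c'x eP; lia.
have old_ab p q (xx yy : 'I_n) (ii jj : nat) :
    lam -> seg (P xx yy) ii jj p q -> ~~ same_pair p q a b.
  move=> /(ext_edge E)[e _ _ _] sg; apply/negP => /same_pairP[] [ea eb].
    by apply: (ps_adj wG S sg); rewrite -ea -eb.
  by apply: (ps_adj wG S sg); rewrite (wgraph_sym wG) -ea -eb.
split=> [r wr|v].
  rewrite -/(ole _ r); case: (ext_split E sF wr) => [wo|[d [d' [r1 [r2 [l nab w1 w2 le]]]]]].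
    apply: ole_min; left; apply: ole_max; first by apply: gxy.1; apply: wk_mono wo.
    by apply: gyx.1; apply: wk_mono sub2 _; apply: wk_sym.
  apply: ole_min; right.
  case: ifP => [/cross_ab[hl hab]|/negbT/gab[gxa gyb gxb gya]].
    by rewrite hab in nab; have := nab hl.
  have q v1 v2 : good G K F1 x d v1 -> good G K F2 y d' v2 ->
      ole (oadd (oadd v1 (Some w)) v2) r.
    move=> g1 g2; have [t1 -> le1] : ole v1 r1 by apply: g1.1; apply: wk_mono w1.
    have [t2 -> le2] : ole v2 r2.
      by apply: g2.1; apply: wk_mono sub2 _; apply: wk_sym.
    by exists (t1 + w + t2) => //; lra.
  by apply: ole_min; case: l q => -[-> ->] q; [left|right]; apply: q.
have via g g' u1 u2 : link g g' -> ~~ crosses c c' x y i j ->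
    good G K F1 x g u1 -> good G K F2 y g' u2 ->
    oadd (oadd u1 (Some w)) u2 = Some v ->
    forall s t, s = t \/ F s t -> wk G' K' (same_pair s t) x y v.
  move=> lg ncr g1 g2 /oadd_some[v1 [v2 [/oadd_some[v1' [_ [e1 [<-] e3]]] e2 e4]]] s t st.
  have symst : symmetric (same_pair s t) by apply: same_pair_sym.
  have [hxg D1] := ps_min S (g1.2 _ e1 s s (or_introl erefl)).
  have [hyg D2] := ps_min S (g2.2 _ e2 s s (or_introl erefl)).
  have hgy : (0 < size (P g' y))%N by rewrite (ps_size_rev S).
  have cross1 : F1 s t -> ~ F2 s t -> wk G' K' (same_pair s t) x y v.
    move=> f1 nf2; case: rt => [[l im]|[ecy ec'x ni]]; last first.
      case: nf2; rewrite /F2 /F1 ec'x ecy in f1 *.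
      case: (newP_cases x y) => [[d [d' [l im]]]|[_ eP _]].
        by move: (ni _ _ l); rewrite im.
      by rewrite (ps_rev S x y) /h eP seg_rev // -ltnS prednK -eP //; lia.
    case: (boolP (seg (P g' y) 0 (size (P g' y)) s t)) => sg.
      apply: wk_le (improves_cross l im f1 lg hxg hgy sg) _.
      by rewrite (ps_Dsym wG S hgy); lra.
    have w1 := g1.2 _ e1 s t (or_intror f1).
    have w2 : wk G K (same_pair s t) g' y (D g' y) by apply: (ps_avoid1 S) => //; right.
    apply: wk_le (ext_via E symst lg _ w1 w2) _; first by move=> hl; apply: old_ab f1.
    by rewrite (ps_Dsym wG S hgy); lra.
  have cross2 : F2 s t -> ~ F1 s t -> wk G' K' (same_pair s t) x y v.
    move=> f2 nf1; case: rt => [[l im]|[ecy ec'x ni]]; last first.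
      case: nf1; rewrite /F2 /F1 ec'x ecy in f2 *.
      case: (newP_cases x y) => [[d [d' [l im]]]|[_ eP _]].
        by move: (ni _ _ l); rewrite im.
      by rewrite (ps_rev S x y) /h eP seg_rev // -ltnS prednK -eP // in f2; lia.
    have im' : improves c' c y x by rewrite -improves_sym.
    have hgx : (0 < size (P g x))%N by rewrite (ps_size_rev S).
    case: (boolP (seg (P g x) 0 (size (P g x)) s t)) => sg.
      apply: wk_sym => //.
      apply: wk_le (improves_cross (link_sym l) im' f2 (link_sym lg) hyg hgx sg) _.
      by rewrite (ps_Dsym wG S hgx); lra.
    have w2 := g2.2 _ e2 s t (or_intror f2).
    have w1 : wk G K (same_pair s t) g x (D g x) by apply: (ps_avoid1 S) => //; right.
    have w1' := wk_sym wG symst w1; have w2' := wk_sym wG symst w2.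
    apply: wk_le (ext_via E symst lg _ w1' w2') _; first by move=> hl; apply: old_ab f2.
    by rewrite (ps_Dsym wG S hgx); lra.
  have both : s = t \/ F1 s t /\ F2 s t -> wk G' K' (same_pair s t) x y v.
    move=> st2.
    have w1 : wk G K (same_pair s t) x g v1' by apply: g1.2; case: st2 => [|[]]; auto.
    have w2 : wk G K (same_pair s t) y g' v2 by apply: g2.2; case: st2 => [|[]]; auto.
    have w2' := wk_sym wG symst w2.
    apply: wk_le (ext_via E symst lg _ w1 w2') _; last by lra.
    move=> hl; case: st2 => [est|[f1 _]]; last exact: old_ab f1.
    have [_ ab _ _] := ext_edge E hl.
    by apply/negP => /same_pairP[] [ea eb]; apply: ab; rewrite ea eb est.
  case: st => [est|/split_F]; first by apply: both; left.
  case: (boolP (F1 s t)) => f1; case: (boolP (F2 s t)) => f2.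
  - by move=> _; apply: both; right.
  - by move=> _; apply: cross1 => //; apply/negP.
  - by move=> _; apply: cross2 => //; apply/negP.
  - by case=> [||[_ _ cr]]; rewrite ?(negbTE f1) ?(negbTE f2) ?cr // in ncr *.
case/omin_some => [/omax_some[v1 [v2 [e1 e2 le1 le2]]]|e0] s t.
  have symst : symmetric (same_pair s t) by apply: same_pair_sym.
  have w1 p q : p = q \/ F1 p q -> wk G K (same_pair p q) x y v.
    by move=> H; apply: wk_le le1; apply: gxy.2.
  case=> [est|/split_F[f1|f2|[hl sp _]]].
  - by apply: (ext_old E); apply: w1; left.
  - by apply: (ext_old E); apply: w1; right.
  - apply: (ext_old E); apply: wk_sym => //; apply: wk_le le2; apply: gyx.2 => //.
    by right.
  have [e _ _ _] := ext_edge E hl; apply: (ext_old E).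
  apply: (wk_absent wG _ (w1 s s (or_introl erefl))).
  by case/same_pairP: sp => -[-> ->] //; rewrite (wgraph_sym wG).
move: e0; case: ifP => // /negbT ncr; have [gxa gyb gxb gya] := gab ncr; case/omin_some=> e.
  exact: (via a b _ _ (or_introl (conj erefl erefl)) ncr gxa gyb e).
exact: (via b a _ _ (or_intror (conj erefl erefl)) ncr gxb gya e).
Qed.

End Relax.

(** * Edge insertion and Floyd-Warshall steps *)

Section Instances.
Local Open Scope ring_scope.
Variables (R : realDomainType) (n : nat).
Implicit Types (G : wgraph R n) (K : pred 'I_n) (a b u v x y z : 'I_n) (w r : R).

Lemma insert_wgraph G a b w : is_wgraph G -> a <> b -> 0 <= w ->
  is_wgraph (insert_edge G a b w).
Proof.
move=> [sG iG pG] ab w0; split.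
- by move=> u v; rewrite /insert_edge same_pairC sG.
- move=> u; rewrite /insert_edge; case: same_pairP => // -[] [ua ub]; case: ab;
  by rewrite -ua -ub.
- by move=> u v r; rewrite /insert_edge; case: ifP => _; [case=> <-|apply: pG].
Qed.

Lemma insert_extension G K a b w : (forall x, K x) -> is_wgraph G -> a <> b ->
  G a b = None -> 0 <= w -> extension G (insert_edge G a b w) K K a b w true.
Proof.
move=> HK wG ab eG w0; set G' := insert_edge G a b w.
have wG' : is_wgraph G' by apply: insert_wgraph.
have old F x y r : wk G K F x y r -> wk G' K F x y r.
  elim=> {x y r} [x r r0|x y v r h1 h2 h3|x z y r1 r2 r Kz _ h1 _ h2 le].
  - exact: WkNil.
  - apply: (WkEdge (w := v)) => //; rewrite /G' /insert_edge.
    case: same_pairP => // -[] [ex ey]; move: h1; rewrite ex ey ?eG //.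
    by rewrite (wgraph_sym wG) eG.
  - exact: (WkCat Kz h1 h2 le).
split=> //; try by [].
  move=> F x y r sF; elim=> {x y r} [x r r0|x y v r h1 h2 h3|x z y r1 r2 r _ w1 IH1 w2 IH2 le].
  - by left; apply: WkNil.
  - move: h1; rewrite /G' /insert_edge; case: same_pairP => [sp [wv]|_ h1]; last first.
      by left; apply: (WkEdge h1).
    right; exists x, y, 0, 0; rewrite add0r addr0 wv; split=> //; try exact: WkNil.
    by move=> _; case: sp h2 => -[-> ->] //; rewrite sF.
  have := wk_ge0 wG' w1; have := wk_ge0 wG' w2 => p2 p1.
  case: IH1 => [o1|[c [c' [q1 [q2 [l1 n1 v1 v2 le1]]]]]];
  case: IH2 => [o2|[d [d' [s1 [s2 [l2 n2 u1 u2 le2]]]]]].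
  - by left; exact: (WkCat (HK _) o1 o2 le).
  - right; exists d, d', (r1 + s1), s2; split=> //; last by lra.
    exact: (WkCat (HK _) o1 u1 (lexx _)).
  - right; exists c, c', q1, (q2 + r2); split=> //; last by lra.
    exact: (WkCat (HK _) v2 o2 (lexx _)).
  have := wk_ge0 wG v2; have := wk_ge0 wG u1 => pv2 pu1.
  have := wk_ge0 wG v1; have := wk_ge0 wG u2 => pv1 pu2.
  case: (boolP (c == d)) => [/eqP cd|cd].
    right; exists c, d', q1, s2; split=> //; last by lra.
    by case: l1 l2 cd => -[-> _] [] [-> ->] cd; rewrite /link; auto.
  have {}cd : d' = c by case: l1 l2 cd => -[-> _] [] [-> ->] //; rewrite eqxx.
  left; rewrite cd in u2; apply: (WkCat (HK _) v1 u2); lra.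
move=> F x y c c' r1 r2 sF l nF /old w1 /old w2.
have we : wk G' K F c c' w.
  apply: (WkEdge (w := w)) => //.
    by rewrite /G' /insert_edge; case: same_pairP => // -[]; case: l => -[-> ->]; auto.
  by case: l (nF isT) => -[-> ->] //; rewrite sF.
apply: (WkCat (z := c') (HK _) _ w2 (lexx _)).
exact: (WkCat (z := c) (HK _) w1 we (lexx _)).
Qed.

Lemma vertex_extension G K K' k : (forall x, K' x = (x == k) || K x) -> is_wgraph G ->
  extension G G K K' k k 0 false.
Proof.
move=> HK wG; have old F x y r : wk G K F x y r -> wk G K' F x y r.
  elim=> {x y r} [x r r0|x y v r h1 h2 h3|x z y r1 r2 r Kz _ h1 _ h2 le].
  - exact: WkNil.
  - exact: (WkEdge h1).
  - by apply: (WkCat _ h1 h2 le); rewrite HK Kz orbT.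
split=> //=; try by rewrite HK ?eqxx.
  by move=> x Kx; rewrite HK Kx orbT.
  move=> F x y r sF; elim=> {x y r} [x r r0|x y v r h1 h2 h3|x z y r1 r2 r Kz w1 IH1 w2 IH2 le].
  - by left; apply: WkNil.
  - by left; apply: (WkEdge h1).
  have lk c c' : link k k c c' -> c = k /\ c' = k by case.
  have := wk_ge0 wG w1; have := wk_ge0 wG w2 => p2 p1.
  have A1 : (exists2 r', wk G K F x k r' & exists2 r'', wk G K F k z r'' & r' + r'' <= r1)
            \/ wk G K F x z r1.
    case: IH1 => [o1|[c [c' [q1 [q2 [/lk[-> ->] _ v1 v2 le1]]]]]]; auto.
    by left; exists q1 => //; exists q2 => //; lra.
  have A2 : (exists2 r', wk G K F z k r' & exists2 r'', wk G K F k y r'' & r' + r'' <= r2)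
            \/ wk G K F z y r2.
    case: IH2 => [o2|[d [d' [s1 [s2 [/lk[-> ->] _ u1 u2 le2]]]]]]; auto.
    by left; exists s1 => //; exists s2 => //; lra.
  have fin q1 q2 : wk G K F x k q1 -> wk G K F k y q2 -> q1 + q2 <= r ->
      wk G K F x y r \/ exists c c' r1 r2, [/\ link k k c c', (false -> ~~ F k k),
      wk G K F x c r1, wk G K F c' y r2 & r1 + 0 + r2 <= r].
    by move=> h1 h2 h; right; exists k, k, q1, q2; split=> //; [left|rewrite addr0].
  case: A1 => [[q1 v1 [q2 v2 le1]]|o1]; case: A2 => [[s1 u1 [s2 u2 le2]]|o2].
  - have := wk_ge0 wG v2; have := wk_ge0 wG u1 => pv2 pu1.
    by apply: (fin q1 s2) => //; lra.
  - move: Kz; rewrite HK => /orP[/eqP zk|Kz].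
      have pv2 := wk_ge0 wG v2.
      by apply: (fin q1 r2) => //; [rewrite -zk|lra].
    by apply: (fin q1 (q2 + r2)) => //; [exact: (WkCat Kz v2 o2 (lexx _))|lra].
  - move: Kz; rewrite HK => /orP[/eqP zk|Kz].
      have pu1 := wk_ge0 wG u1.
      by apply: (fin r1 s2) => //; [rewrite -zk|lra].
    by apply: (fin (r1 + s1) s2) => //; [exact: (WkCat Kz o1 u1 (lexx _))|lra].
  - move: Kz; rewrite HK => /orP[/eqP zk|Kz]; last by left; exact: (WkCat Kz o1 o2 le).
    by apply: (fin r1 r2) => //; rewrite -zk.
move=> F x y c c' r1 r2 sF [] [-> ->] _ /old w1 /old w2;
by apply: (WkCat _ w1 w2); rewrite ?HK ?eqxx ?addr0.
Qed.

Definition edgeP G x y : seq 'I_n :=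
  if x == y then [:: x] else if G x y is Some _ then [:: x; y] else [::].
Definition edgeD G x y : R := if x == y then 0 else odflt 0 (G x y).

Lemma wk_pred0 G F x y r : wk G pred0 F x y r ->
  (x = y /\ 0 <= r) \/ exists w, [/\ G x y = Some w, ~~ F x y & w <= r].
Proof. by case=> // {}x {}y => [{}r|w {}r]; [left|right; exists w]. Qed.

Lemma edge_system G : is_wgraph G -> path_system G pred0 (edgeP G) (edgeD G).
Proof.
move=> wG; have ePG x y : x != y -> edgeP G x y = if G x y is Some _ then [:: x; y] else [::].
  by rewrite /edgeP => /negbTE->.
split.
- by move=> x; rewrite /edgeP eqxx.
- by move=> x y; rewrite /edgeP; case: ifP => // _; case: (G x y).
- move=> x y; rewrite /edgeP eq_sym (wgraph_sym wG); case: eqP => [->|_] //.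
  by case: (G x y).
- move=> x y i z; rewrite {}/z /edgeP /edgeD; case: (eqVneq x y) => [<-|xy].
    by case: i => // _; rewrite /= eqxx addr0; split; auto.
  case e: (G x y) => [w|//]; case: i => [|[|//]] _ /=; rewrite ?eqxx ?(negbTE xy) ?e.
    by rewrite add0r; split; auto.
  by rewrite addr0; split; auto.
- move=> F x y sF; rewrite /edgeP /edgeD; case: (eqVneq x y) => [<-|xy].
    by move=> _ _; apply: WkNil.
  case e: (G x y) => [w|//] _ /(_ 0%N isT) /= nF; exact: (WkEdge e nF).
move=> F x y r /wk_pred0[[<- r0]|[w [e nF le]]]; first by rewrite /edgeP /edgeD eqxx.
have xy : x != y by apply: contraPneq e => ->; rewrite (wgraph_irr wG).
by rewrite /edgeP /edgeD (negbTE xy) e.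
Qed.

Lemma edge_good G x y : is_wgraph G -> x != y -> good G pred0 (seg (edgeP G x y) 0 1) x y None.
Proof.
move=> wG xy; split=> // r /wk_pred0[[/eqP exy]|[w [e]]]; first by rewrite exy in xy.
case/negP; apply/(segP x); exists 0%N; split=> //; rewrite /edgeP (negbTE xy) e //=.
by apply/same_pairP; left.
Qed.

Lemma remove_path_wk G K a b x p : (forall z, K z) -> is_wgraph G ->
  path (adj (remove_edge G a b)) x p ->
  wk G K (same_pair a b) x (last x p) (path_length (remove_edge G a b) x p).
Proof.
move=> HK wG; elim: p x => [|y p IH] x /=; first by move=> _; apply: WkNil.
case/andP=> axy /IH w2; apply: (WkCat (z := y) (HK _) _ w2 (lexx _)).
move: axy; rewrite /adj /remove_edge; case: ifP => //= nsp; case e: (G x y) => [t|//] _.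
by apply: (WkEdge e); rewrite ?nsp.
Qed.

Lemma wk_path G K a b x y r : is_wgraph G -> wk G K (same_pair a b) x y r ->
  exists p, [/\ path (adj (remove_edge G a b)) x p, last x p = y
    & path_length (remove_edge G a b) x p <= r].
Proof.
move=> wG; elim=> {x y r} [x r r0|x y v r h1 h2 h3|x z y r1 r2 r Kz _ [p [p1 p2 p3]] _ [q [q1 q2 q3]] le].
- by exists [::].
- exists [:: y]; rewrite /= /adj /remove_edge (negbTE h2) h1; split=> //=.
  by rewrite addr0.
exists (p ++ q); rewrite cat_path last_cat p2; split=> //; first by rewrite p1.
have -> : path_length (remove_edge G a b) x (p ++ q) =
    path_length (remove_edge G a b) x p + path_length (remove_edge G a b) z q.
  rewrite -p2; elim: p x {p1 p2 p3} => [|t p IH] x /=; first by rewrite add0r.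
  by rewrite IH addrA.
lra.
Qed.

Lemma path_simple G x p : (forall u v r, G u v = Some r -> 0 <= r) ->
  path (adj G) x p ->
  exists q, is_path G x (last x p) q /\ path_length G x q <= path_length G x p.
Proof.
move=> G0; elim: p x => [|y p IH] x /=; first by move=> _; exists [::].
case/andP=> axy /IH[q [[q1 q2 q3] q4]].
have w0 : 0 <= odflt 0 (G x y) by case e: (G x y) => [t|] //=; apply: G0 e.
case: (boolP (x \in y :: q)) => [|nx]; last first.
  exists (y :: q); split; last by rewrite /=; lra.
  split=> //=; first by rewrite axy.
  by rewrite nx.
have pl0 z s : 0 <= path_length G z s.
  elim: s z => //= t s IHs z; apply: addr_ge0 => //.
  by case e: (G z t) => [r|] //=; apply: G0 e.
have drop_le t s s' : path_length G x s' <= path_length G t (s ++ x :: s').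
  elim: s t => [|u s IHs] t /=.
    suff : 0 <= odflt 0 (G t x) by lra.
    by case e: (G t x) => [r|] //=; apply: G0 e.
  suff : 0 <= odflt 0 (G t u) by have := IHs u; lra.
  by case e: (G t u) => [r|] //=; apply: G0 e.
rewrite in_cons => /orP[/eqP xy|].
  exists q; split; last by rewrite xy in w0 *; lra.
  by rewrite xy.
move=> xq; case/splitPr: xq q1 q2 q3 q4 => s s' q1 q2 q3 q4.
exists s'; split; last first.
  by apply: le_trans (drop_le y s s') _; lra.
move: q1 q2 q3; rewrite cat_path /= last_cat /= cat_uniq.
by case/andP=> _ /andP[_ h1] /andP[_ /and3P[_ _ /andP[h2 h3]]] h4; split=> //=; rewrite h2.
Qed.

Lemma good_is_dist G K a b x y d : (forall z, K z) -> is_wgraph G ->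
  good G K (same_pair a b) x y d -> is_dist (remove_edge G a b) x y d.
Proof.
move=> HK wG [g1 g2]; have lo p : is_path (remove_edge G a b) x y p ->
    exists2 q, d = Some q & q <= path_length (remove_edge G a b) x p.
  by case=> h1 _ h3; apply: g1; rewrite -h3; apply: remove_path_wk.
case: d g1 g2 lo => [r|] g1 g2 lo; last by move=> p /lo[].
have lo' p : is_path (remove_edge G a b) x y p -> r <= path_length (remove_edge G a b) x p.
  by move=> /lo[q [->]].
split=> //; have w := g2 r erefl a b.
have {}w : wk G K (same_pair a b) x y r by apply: w; right; apply/same_pairP; left.
have [p [p1 p2 p3]] := wk_path wG w.
have G0 u v t : remove_edge G a b u v = Some t -> 0 <= t.
  by rewrite /remove_edge; case: ifP => // _; apply: (wgraph_ge0 wG).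
have [q [q1 q2]] := path_simple G0 p1; rewrite p2 in q1.
by exists q => //; apply/le_anti; rewrite lo' // andbT (le_trans q2).
Qed.

Lemma avoid_good G K P D (a b x y : 'I_n) : path_system G K P D ->
  (0 < size (P x y))%N -> ~~ seg (P x y) 0 (size (P x y)) a b ->
  good G K (same_pair a b) x y (Some (D x y)).
Proof.
move=> S h nf; split=> [r w|q [<-] s t st].
  by exists (D x y) => //; case: (ps_min S w).
apply: (ps_avoid1 S h); case: st => [|/same_pairP sp]; [by left|right].
apply: contra nf => /(segP x)[k [hk hs sp']]; apply/(segP x); exists k; split=> //.
by case: sp sp' => -[-> ->] //; rewrite same_pairC.
Qed.

Lemma edge_of_path_good G K (a b x y p q : 'I_n) s i (v : option R) : (i.+1 < size s)%N ->
  nth x s i = p -> nth x s i.+1 = q -> same_pair p q a b ->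
  good G K (seg s i i.+1) x y v -> good G K (same_pair a b) x y v.
Proof.
move=> hs ep eq sp; apply: good_ext => u t; apply/(segP x)/idP.
  case=> k [hk _]; have -> : k = i by lia.
  by rewrite ep eq; case/same_pairP: sp => -[-> ->]; rewrite // same_pairAC.
move=> sp2; exists i; split=> //; first by lia.
by rewrite ep eq; case/same_pairP: sp sp2 => -[-> ->]; rewrite // same_pairAC.
Qed.

End Instances.

(** * Total correctness with a static cost *)

Section Cost.
Variables n L : nat.

(* Every loop counts up to word register 10 or 11, which hold [n] and [L]. *)
Definition lbound (r : nat) : nat := if r == 10 then n else if r == 11 then L else 0.

Fixpoint cost (c : com) : nat :=
  match c with
  | Skip => 1
  | WSet _ e => (wcost e).+1
  | XSet _ e => (xcost e).+1
  | WStore i e => (wcost i + wcost e).+1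
  | XStore i e => (wcost i + xcost e).+1
  | Seq c1 c2 => cost c1 + cost c2
  | If b c1 c2 => (bcost b + (cost c1 + cost c2)).+1
  | While b c1 =>
    (bcost b).+1 +
      (if b is BLt _ (WReg r) then lbound r else 0) * (bcost b + cost c1).+1
  end.

End Cost.

Fixpoint deg (r : nat) (c : com) : nat :=
  match c with
  | Seq c1 c2 | If _ c1 c2 => maxn (deg r c1) (deg r c2)
  | While (BLt _ (WReg q)) c1 => (q == r) + deg r c1
  | While _ c1 => deg r c1
  | _ => 0
  end.

Lemma cost_poly c : exists C, forall n L, 0 < n -> 0 < L ->
  cost n L c <= C * (n ^ deg 10 c * L ^ deg 11 c).
Proof.
have pos n L a b : 0 < n -> 0 < L -> 0 < n ^ a * L ^ b.
  by move=> n0 L0; rewrite muln_gt0 !expn_gt0 n0 L0.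
have base k a b : exists C, forall n L, 0 < n -> 0 < L -> k <= C * (n ^ a * L ^ b).
  by exists k => n L n0 L0; rewrite leq_pmulr ?pos.
have two c1 c2 k : (exists C, forall n L, 0 < n -> 0 < L ->
      cost n L c1 <= C * (n ^ deg 10 c1 * L ^ deg 11 c1)) ->
    (exists C, forall n L, 0 < n -> 0 < L ->
      cost n L c2 <= C * (n ^ deg 10 c2 * L ^ deg 11 c2)) ->
    exists C, forall n L, 0 < n -> 0 < L -> k + (cost n L c1 + cost n L c2) <=
      C * (n ^ maxn (deg 10 c1) (deg 10 c2) * L ^ maxn (deg 11 c1) (deg 11 c2)).
  move=> [C1 h1] [C2 h2]; exists (k + (C1 + C2)) => n L n0 L0; rewrite !mulnDl.
  apply: leq_add; first by rewrite leq_pmulr ?pos.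
  by apply: leq_add; [apply: leq_trans (h1 n L n0 L0) _|apply: leq_trans (h2 n L n0 L0) _];
    rewrite leq_mul2l leq_mul ?orbT // leq_pexp2l ?leq_maxl ?leq_maxr.
have loop c1 k r : (exists C, forall n L, 0 < n -> 0 < L ->
      cost n L c1 <= C * (n ^ deg 10 c1 * L ^ deg 11 c1)) ->
    exists C, forall n L, 0 < n -> 0 < L -> k.+1 + lbound n L r * (k + cost n L c1).+1 <=
      C * (n ^ ((r == 10) + deg 10 c1) * L ^ ((r == 11) + deg 11 c1)).
  move=> [C h]; exists (k.+1 + (k.+1 + C)) => n L n0 L0.
  rewrite mulnDl; apply: leq_add; first by rewrite leq_pmulr ?pos.
  rewrite !expnD mulnACA mulnCA; apply: leq_mul.
    rewrite /lbound; case: (eqVneq r 10) => [->|_]; first by rewrite /= muln1.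
    by case: (eqVneq r 11) => _ //; rewrite mul1n.
  by rewrite -addSn mulnDl leq_add ?h // leq_pmulr ?pos.
elim: c => [|r e|r e|i e|i e|c1 h1 c2 h2|b c1 h1 c2 h2|b c1 h1];
  try exact: base.
- have [C h] := two _ _ 0 h1 h2; exists C => n L n0 L0.
  by have := h n L n0 L0; rewrite add0n.
- exact: two _ _ (bcost b).+1 h1 h2.
- rewrite /=; move: (bcost b) => k.
  have h0 : exists C, forall n L, 0 < n -> 0 < L -> k.+1 + 0 * (k + cost n L c1).+1 <=
      C * (n ^ deg 10 c1 * L ^ deg 11 c1).
    have [C h] := base k.+1 (deg 10 c1) (deg 11 c1); exists C => n L n0 L0.
    by rewrite mul0n addn0; apply: h.
  case: b => [e1 [q|r|e|o e e']|e1 e2|e1 e2|b'|b1 b2] //.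
  exact: loop.
Qed.

Section Logic.
Variables (R : realDomainType) (M Sp n L : nat).
Implicit Types (s : state R) (Q : state R -> Prop).

Lemma exec_det c s t s' : exec M Sp c s t s' ->
  forall t2 s2, exec M Sp c s t2 s2 -> s2 = s'.
Proof.
elim=> {c s t s'}.
- by move=> s t2 s2 h; inversion h.
- by move=> s r e t2 s2 h; inversion h.
- by move=> s r e t2 s2 h; inversion h.
- by move=> s i e lt t2 s2 h; inversion h.
- by move=> s i e lt t2 s2 h; inversion h.
- move=> c1 c2 s1 t1 s2 t2 s3 _ IH1 _ IH2 t s h; inversion h; subst.
  match goal with h1 : exec _ _ c1 s1 _ ?s4, h2 : exec _ _ c2 ?s4 _ _ |- _ =>
    by apply: IH2; rewrite -(IH1 _ _ h1); exact: h2 end.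
- by move=> b c1 c2 s t s' _ IH t2 s2 h; inversion h; subst; apply: IH; eassumption.
- move=> b c s nb t s2 h; inversion h; subst => //.
  by match goal with h' : is_true (beval _ _ _) |- _ => rewrite h' in nb end.
- move=> b c s1 t1 s2 t2 s3 b1 _ IH1 _ IH2 t s h; inversion h; subst.
    by match goal with h' : is_true (~~ _) |- _ => rewrite b1 in h' end.
  match goal with h1 : exec _ _ c s1 _ ?s4, h2 : exec _ _ (While b c) ?s4 _ _ |- _ =>
    by apply: IH2; rewrite -(IH1 _ _ h1); exact: h2 end.
Qed.

Definition ht c s Q := exists t s', [/\ exec M Sp c s t s', t <= cost n L c & Q s'].

Lemma ht_skip s Q : Q s -> ht Skip s Q.
Proof. by move=> h; exists 1, s; split=> //; apply: ESkip. Qed.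

Lemma ht_wset v s r e Q : weval M s e = v -> Q (set_wreg s r v) -> ht (WSet r e) s Q.
Proof. by move=> <- h; eexists; eexists; split; [apply: EWSet| |exact: h]. Qed.

Lemma ht_xset v s r e Q : xeval M s e = v -> Q (set_xreg s r v) -> ht (XSet r e) s Q.
Proof. by move=> <- h; eexists; eexists; split; [apply: EXSet| |exact: h]. Qed.

Lemma ht_wstore a v s i e Q : weval M s i = a -> weval M s e = v -> a < Sp ->
  Q (set_wmem s a v) -> ht (WStore i e) s Q.
Proof. by move=> <- <- lt h; eexists; eexists; split; [apply: EWStore| |exact: h]. Qed.

Lemma ht_xstore a v s i e Q : weval M s i = a -> xeval M s e = v -> a < Sp ->
  Q (set_xmem s a v) -> ht (XStore i e) s Q.
Proof. by move=> <- <- lt h; eexists; eexists; split; [apply: EXStore| |exact: h]. Qed.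

Lemma ht_seq c1 c2 s Q : ht c1 s (fun s' => ht c2 s' Q) -> ht (Seq c1 c2) s Q.
Proof.
move=> [t1 [s1 [h1 l1 [t2 [s2 [h2 l2 q]]]]]]; exists (t1 + t2), s2; split=> //.
  exact: ESeq h1 h2.
exact: leq_add.
Qed.

Lemma ht_if v b c1 c2 s Q : beval M s b = v -> (v -> ht c1 s Q) ->
  (~~ v -> ht c2 s Q) -> ht (If b c1 c2) s Q.
Proof.
case: v => bv H1 H2; [have [t [s' [h l q]]] := H1 isT|have [t [s' [h l q]]] := H2 isT];
  exists (bcost b + t).+1, s'; split=> //; try (by apply: EIf; rewrite bv);
  by rewrite /= ltnS leq_add2l; apply: leq_trans l _; rewrite ?leq_addr ?leq_addl.
Qed.

Definition For rc rb body : com :=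
  Seq (WSet rc (WConst 0))
      (While (BLt (WReg rc) (WReg rb))
             (Seq body (WSet rc (WBin Add (WReg rc) (WConst 1))))).

Lemma ht_for (Inv : nat -> state R -> Prop) N rc rb body s Q :
  lbound n L rb = N -> N < M -> 1 < M ->
  (forall i s', Inv i s' -> wreg s' rb = N) ->
  Inv 0 (set_wreg s rc 0) ->
  (forall i s', i < N -> wreg s' rc = i -> Inv i s' ->
     ht body s' (fun s2 => wreg s2 rc = i /\ Inv i.+1 (set_wreg s2 rc i.+1))) ->
  (forall s', Inv N s' -> Q s') ->
  ht (For rc rb body) s Q.
Proof.
move=> eN NM M1 Irb I0 Istep IQ; apply: ht_seq; apply: (ht_wset (v := 0)).
  by rewrite /= mod0n.
set s0 := set_wreg s rc 0 in I0 *.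
have loop k i s1 : N - i = k -> i <= N -> wreg s1 rc = i -> Inv i s1 ->
    exists t s', [/\ exec M Sp (While (BLt (WReg rc) (WReg rb))
             (Seq body (WSet rc (WBin Add (WReg rc) (WConst 1))))) s1 t s',
       t <= 4 + k * (3 + cost n L (Seq body (WSet rc (WBin Add (WReg rc) (WConst 1))))).+1
     & Q s'].
  elim: k i s1 => [|k IH] i s1 ek le ei Ii.
    have eiN : i = N by lia.
    exists 4, s1; split=> //; last by apply: IQ; rewrite -eiN.
    apply: EWhileF.
    by rewrite /= ei (Irb _ _ Ii) eiN ltnn.
  have iN : i < N by lia.
  have [t1 [s2 [h1 l1 [e2 I2]]]] := Istep i s1 iN ei Ii.
  have e3 : wreg (set_wreg s2 rc i.+1) rc = i.+1 by rewrite /= eqxx.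
  have [t2 [s3 [h2 l2 q]]] := IH i.+1 _ (ltac:(lia)) iN e3 I2.
  have h3 : exec M Sp (WSet rc (WBin Add (WReg rc) (WConst 1))) s2 4 (set_wreg s2 rc i.+1).
    have -> : i.+1 = weval M s2 (WBin Add (WReg rc) (WConst 1)).
      by rewrite /= e2 (modn_small M1) addn1 modn_small //; lia.
    exact: EWSet.
  eexists; exists s3; split; last exact: q.
    have bt : beval M s1 (BLt (WReg rc) (WReg rb)) by rewrite /= ei (Irb _ _ Ii).
    exact: (EWhileT bt (ESeq h1 h3) h2).
  by move: l1 l2; rewrite /= mulSn; lia.
have [t [s' [h l q]]] := loop N 0 s0 (subn0 _) (leq0n _) (ltac:(by rewrite /= eqxx)) I0.
by exists t, s'; split=> //; apply: leq_trans l _; rewrite /= eN.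
Qed.

Definition keeps k s s' := [/\ forall r, r < k -> wreg s' r = wreg s r,
  forall r, r < k -> xreg s' r = xreg s r, wmem s' = wmem s & xmem s' = xmem s].

Lemma keeps_refl k s : keeps k s s. Proof. by split. Qed.

Lemma keeps_trans k k' s1 s2 s3 : k <= k' -> keeps k' s2 s3 -> keeps k s1 s2 -> keeps k s1 s3.
Proof.
move=> le [w2 x2 m2 n2] [w1 x1 m1 n1]; split; rewrite ?m2 ?n2 //.
  by move=> r rk; rewrite w2 ?w1 //; apply: leq_trans le.
by move=> r rk; rewrite x2 ?x1 //; apply: leq_trans le.
Qed.

Lemma keeps_wset k s1 s2 r v : k <= r -> keeps k s1 s2 -> keeps k s1 (set_wreg s2 r v).
Proof.
move=> le; apply: keeps_trans (leqnn k) _; split=> // q qk /=.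
by rewrite ifN //; lia.
Qed.

Lemma keeps_xset k s1 s2 r v : k <= r -> keeps k s1 s2 -> keeps k s1 (set_xreg s2 r v).
Proof.
move=> le; apply: keeps_trans (leqnn k) _; split=> // q qk /=.
by rewrite ifN //; lia.
Qed.

Lemma kw k s s' : keeps k s s' -> forall r, r < k -> wreg s' r = wreg s r.
Proof. by case. Qed.
Lemma kx k s s' : keeps k s s' -> forall r, r < k -> xreg s' r = xreg s r.
Proof. by case. Qed.
Lemma kwm k s s' : keeps k s s' -> wmem s' = wmem s. Proof. by case. Qed.
Lemma kxm k s s' : keeps k s s' -> xmem s' = xmem s. Proof. by case. Qed.

(* A weight or [None] in a pair of registers of the same number. *)
Definition oreg s r : option R := if wreg s r == 0 then None else Some (xreg s r).

Definition only r s s' := [/\ forall q, q != r -> wreg s' q = wreg s q,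
  forall q, q != r -> xreg s' q = xreg s q, wmem s' = wmem s & xmem s' = xmem s].

Lemma keeps_only k r s1 s2 s3 : k <= r -> only r s2 s3 -> keeps k s1 s2 -> keeps k s1 s3.
Proof.
move=> le [w2 x2 m2 n2]; apply: keeps_trans (leqnn k) _; split=> // q qk.
  by rewrite w2 //; lia.
by rewrite x2 //; lia.
Qed.

Lemma only_oreg r q s s' : only r s s' -> q != r -> oreg s' q = oreg s q.
Proof. by case=> w x _ _ qr; rewrite /oreg w // x. Qed.

Lemma keeps_oreg k q s s' : keeps k s s' -> q < k -> oreg s' q = oreg s q.
Proof. by case=> w x _ _ qr; rewrite /oreg w // x. Qed.

Lemma only_w r s s' : only r s s' -> forall q, q != r -> wreg s' q = wreg s q.
Proof. by case. Qed.
Lemma only_x r s s' : only r s s' -> forall q, q != r -> xreg s' q = xreg s q.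
Proof. by case. Qed.
Lemma only_refl r s : only r s s. Proof. by split. Qed.

Lemma only_wset r s1 s2 v : only r s1 s2 -> only r s1 (set_wreg s2 r v).
Proof. by case=> w x m mm; split=> // q qr; rewrite /= (negbTE qr) w. Qed.

Lemma only_xset r s1 s2 v : only r s1 s2 -> only r s1 (set_xreg s2 r v).
Proof. by case=> w x m mm; split=> // q qr; rewrite /= (negbTE qr) x. Qed.

Definition c_min d a : com :=
  If (BEq (WReg a) (WConst 0)) Skip
    (If (BAnd (BNot (BEq (WReg d) (WConst 0))) (BXle (XReg d) (XReg a))) Skip
       (Seq (WSet d (WConst 1)) (XSet d (XReg a)))).
Definition c_max d a : com :=
  If (BEq (WReg a) (WConst 0)) (WSet d (WConst 0))
    (If (BAnd (BNot (BEq (WReg d) (WConst 0))) (BXle (XReg d) (XReg a)))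
       (XSet d (XReg a)) Skip).
Definition c_add d a : com :=
  If (BEq (WReg a) (WConst 0)) (WSet d (WConst 0)) (XSet d (XAdd (XReg d) (XReg a))).
Definition c_addx d e : com := XSet d (XAdd (XReg d) e).
Definition c_copy d a : com := Seq (WSet d (WReg a)) (XSet d (XReg a)).

Hypothesis M1 : 1 < M.

Lemma ht_min d a s Q : a != d ->
  (forall s', only d s s' -> oreg s' d = omin (oreg s d) (oreg s a) -> Q s') ->
  ht (c_min d a) s Q.
Proof.
move=> ad H; apply: (ht_if (v := wreg s a == 0)); first by rewrite /= mod0n.
  move=> a0; apply: ht_skip; apply: H; first exact: only_refl.
  by rewrite {3}/oreg a0; case: (oreg s d).
move=> a0; apply: (ht_if (erefl _)) => /=; rewrite mod0n => h.
  apply: ht_skip; apply: H; first exact: only_refl.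
  by move/andP: h => [h1 h2]; rewrite /oreg (negbTE h1) (negbTE a0) /= h2.
apply: ht_seq; apply: (ht_wset (v := 1)); first by rewrite /= modn_small.
apply: (ht_xset (erefl _)); apply: H; first by apply/only_xset/only_wset/only_refl.
rewrite /oreg /= !eqxx /= (negbTE a0); case: eqP h => //= _.
by case: (xreg s d <= xreg s a)%R.
Qed.

Lemma ht_max d a s Q : a != d ->
  (forall s', only d s s' -> oreg s' d = omax (oreg s d) (oreg s a) -> Q s') ->
  ht (c_max d a) s Q.
Proof.
move=> ad H; apply: (ht_if (v := wreg s a == 0)); first by rewrite /= mod0n.
  move=> a0; apply: (ht_wset (v := 0)); first by rewrite /= mod0n.
  apply: H; first by apply/only_wset/only_refl.
  by rewrite {3}/oreg a0 /oreg /= eqxx /=; case: ifP.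
move=> a0; apply: (ht_if (erefl _)) => /=; rewrite mod0n => h.
  apply: (ht_xset (erefl _)); apply: H; first by apply/only_xset/only_refl.
  by move/andP: h => [h1 h2]; rewrite /oreg /= eqxx (negbTE h1) (negbTE a0) /= h2.
apply: ht_skip; apply: H; first exact: only_refl.
rewrite /oreg (negbTE a0); case: eqP h => //= _.
by case: (xreg s d <= xreg s a)%R.
Qed.

Lemma ht_add d a s Q : a != d ->
  (forall s', only d s s' -> oreg s' d = oadd (oreg s d) (oreg s a) -> Q s') ->
  ht (c_add d a) s Q.
Proof.
move=> ad H; apply: (ht_if (v := wreg s a == 0)); first by rewrite /= mod0n.
  move=> a0; apply: (ht_wset (v := 0)); first by rewrite /= mod0n.
  apply: H; first by apply/only_wset/only_refl.
  by rewrite {3}/oreg a0 /oreg /= eqxx /=; case: ifP.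
move=> a0; apply: (ht_xset (erefl _)); apply: H; first by apply/only_xset/only_refl.
by rewrite /oreg /= eqxx (negbTE a0); case: eqP.
Qed.

Lemma ht_addx v d e s Q : xeval M s e = v ->
  (forall s', only d s s' -> oreg s' d = oadd (oreg s d) (Some v) -> Q s') ->
  ht (c_addx d e) s Q.
Proof.
move=> ev H; apply: (ht_xset (v := (xreg s d + v)%R)); first by rewrite /= ev.
apply: H; first by apply/only_xset/only_refl.
by rewrite /oreg /= eqxx; case: eqP.
Qed.

Lemma ht_copy d a s Q : a != d ->
  (forall s', only d s s' -> oreg s' d = oreg s a -> Q s') -> ht (c_copy d a) s Q.
Proof.
move=> ad H; apply: ht_seq; apply: (ht_wset (erefl _)); apply: (ht_xset (erefl _)).
apply: H; first by apply/only_xset/only_wset/only_refl.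
by rewrite /oreg /= !eqxx.
Qed.

End Logic.

Arguments ht_wset {R M Sp n L v s r e Q}.
Arguments ht_xset {R M Sp n L v s r e Q}.
Arguments ht_skip {R M Sp n L s Q}.
Arguments ht_wstore {R M Sp n L a v s i e Q}.
Arguments ht_xstore {R M Sp n L a v s i e Q}.
Arguments ht_min {R M Sp n L} M1 {d a s Q}.
Arguments ht_max {R M Sp n L d a s Q}.
Arguments ht_add {R M Sp n L d a s Q}.
Arguments ht_addx {R M Sp n L v d e s Q}.
Arguments ht_copy {R M Sp n L d a s Q}.
Arguments ht_seq {R M Sp n L c1 c2 s Q}.

Ltac keeps_tac :=
  repeat first
  [ exact: keeps_refl
  | match goal with
    | |- keeps _ _ (set_wreg _ _ _) => apply: keeps_wset; first by []
    | |- keeps _ _ (set_xreg _ _ _) => apply: keeps_xset; first by []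
    | H : keeps _ _ ?s |- keeps _ _ ?s => first [exact: H | apply: (keeps_trans _ H); first by []]
    | H : only _ _ ?s |- keeps _ _ ?s => apply: (keeps_only _ H); first by []
    end ].

(** * The programs *)

Local Notation "$ r" := (WReg r) (at level 1, r at level 0, format "$ r").
Local Notation "# c" := (WConst c) (at level 1, c at level 0, format "# c").
Local Infix "+'" := (WBin Add) (at level 50, left associativity).
Local Infix "-'" := (WBin Defs.Sub) (at level 50, left associativity).
Local Infix "*'" := (WBin Mul) (at level 40, left associativity).
Local Infix "/'" := (WBin Div) (at level 40, left associativity).
Local Infix ";;" := Seq (at level 60, right associativity).

Fixpoint args k es c : com :=
  if es is e :: es' then WSet k e ;; args k.+1 es' c else c.

Fixpoint wbelow k e : bool :=
  match e with
  | WConst _ => true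
  | WReg r => r < k
  | WLoad e1 => wbelow k e1
  | WBin _ e1 e2 => wbelow k e1 && wbelow k e2
  end.

(* Memory is a stack of [n x n] planes.  From the plane in register 14 on come
   the numbers of vertices and lengths of the paths, their midpoints, and the
   [L * L] planes of interval values.  Two such stacks are used in turn: an update
   fills the idle one, [planes - o], from the current one, [o].
   Routines take their arguments in consecutive registers and only modify
   registers from there on, so callees work in higher registers than callers. *)
Definition cell j x y : wexp := (j *' $10 +' x) *' $10 +' y.
Definition sizeE x y : wexp := WLoad (cell $14 x y).
Definition midE x y : wexp := WLoad (cell ($14 +' #1) x y).
Definition distE x y : xexp := XLoad (cell $14 x y).
Definition c_fetch r j x y : com := WSet r (WLoad (cell j x y)) ;; XSet r (XLoad (cell j x y)).

Definition anc : com :=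
  For 93 11
    (WSet 94 ((sizeE $90 $91 -' #1) /' #2) ;;
     WSet 95 (midE $90 $91) ;;
     If (BLt $94 $92) (WSet 90 $95 ;; WSet 92 ($92 -' $94)) (WSet 91 $95)) ;;
  If (BEq $92 #0) Skip (WSet 90 $91).

Definition cprefix : com :=
  WSet 78 #0 ;; WSet 79 $13 ;;
  For 80 11
    (WSet 79 ($79 /' #2) ;;
     If (BAnd (BLt ($78 +' $79) (sizeE $75 $76)) (BLt ($78 +' $79) (sizeE $75 $77)))
       (args 90 [:: $75; $76; $78 +' $79] anc ;;
        WSet 81 $90 ;;
        args 90 [:: $75; $77; $78 +' $79] anc ;;
        If (BEq $81 $90) (WSet 78 ($78 +' $79)) Skip)
       Skip).

Definition level : com :=
  WSet 71 #0 ;; WSet 72 #1 ;;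
  For 73 11
    (If (BLt ($70 +' #1) ($72 +' $72)) Skip
       (WSet 72 ($72 +' $72) ;; WSet 71 ($71 +' #1))).

Definition interval_query : com :=
  args 70 [:: $52] level ;; WSet 54 $71 ;; WSet 55 $72 ;;
  args 70 [:: sizeE $50 $51 -' #1 -' $53] level ;; WSet 56 $71 ;; WSet 57 $72 ;;
  args 90 [:: $50; $51; $52 -' ($55 -' #1)] anc ;; WSet 58 $90 ;;
  args 90 [:: $50; $51; $53 +' ($57 -' #1)] anc ;; WSet 59 $90 ;;
  WSet 60 ($14 +' (#2 +' ($54 *' $11 +' $56))) ;;
  c_fetch 62 $60 $58 $59 ;; c_addx 62 (distE $50 $58) ;; c_addx 62 (distE $59 $51) ;;
  c_fetch 63 $60 $58 $51 ;; c_addx 63 (distE $50 $58) ;; c_min 62 63 ;;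
  c_fetch 63 $60 $50 $59 ;; c_addx 63 (distE $59 $51) ;;
  c_fetch 64 $60 $50 $51 ;; c_min 63 64 ;; c_min 62 63 ;; c_copy 54 62.

Definition clip : com :=
  If (BEq (sizeE $40 $42) #0) (WSet 45 #0)
    (args 75 [:: $40; $41; $42] cprefix ;;
     If (BLt $44 $78) (WSet 46 $44) (WSet 46 $78) ;;
     If (BLt $43 $46) (args 50 [:: $40; $42; $43; $46] interval_query ;; c_copy 45 54)
       (WSet 45 #1 ;; XSet 45 (distE $40 $42))).

Definition improvesE p q : bexp :=
  BAnd (BLt #0 (sizeE $20 $p)) (BAnd (BLt #0 (sizeE $q $21))
    (BNot (BAnd (BLt #0 (sizeE $20 $21))
      (BXle (distE $20 $21) (XAdd (XAdd (distE $20 $p) (XReg 0)) (distE $q $21)))))).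

Definition set_via p q : com :=
  WSet 24 (sizeE $20 $p +' sizeE $q $21 -' (#1 -' $2)) ;;
  XSet 24 (XAdd (XAdd (distE $20 $p) (XReg 0)) (distE $q $21)) ;;
  WSet 22 $p ;; WSet 23 $q.

Definition choose_route : com :=
  If (improvesE 0 1) (set_via 0 1)
    (If (improvesE 1 0) (set_via 1 0)
       (WSet 24 (sizeE $20 $21) ;; XSet 24 (distE $20 $21) ;;
        WSet 22 $21 ;; WSet 23 $20)).

Definition c_store j r : com :=
  WStore (cell ($12 -' $14 +' j) $20 $21) $r ;;
  XStore (cell ($12 -' $14 +' j) $20 $21) (XReg r).

Definition new_mid : com :=
  WSet 25 (($24 -' #1) /' #2) ;;
  If (BLt $25 (sizeE $20 $22))
    (args 90 [:: $20; $22; $25] anc)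
    (args 90 [:: $21; $23; $24 -' #1 -' $25] anc) ;;
  c_store #1 90.

Definition clip_x z : com := args 40 [:: $20; $22; $z; $27 -' #1; $24 -' $28] clip.
Definition clip_y z : com := args 40 [:: $21; $23; $z; $28 -' #1; $24 -' $27] clip.

Definition crossesE : bexp :=
  BAnd (BEq (sizeE $20 $22 +' sizeE $23 $21) $24)
    (BAnd (BLt ($27 -' #1) (sizeE $20 $22))
          (BNot (BLt ($24 -' $28) (sizeE $20 $22)))).

Definition new_entry : com :=
  clip_x 21 ;; c_copy 29 45 ;; clip_y 20 ;; c_max 29 45 ;;
  If crossesE Skip
    (clip_x 0 ;; c_copy 30 45 ;; c_addx 30 (XReg 0) ;; clip_y 1 ;; c_add 30 45 ;;
     clip_x 1 ;; c_copy 31 45 ;; c_addx 31 (XReg 0) ;; clip_y 0 ;; c_add 31 45 ;;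
     c_min 30 31 ;; c_min 29 30).

Definition new_table : com :=
  WSet 27 #1 ;;
  For 25 11
    (WSet 28 #1 ;;
     For 26 11
       (If (BLt $24 ($27 +' $28)) Skip
          (new_entry ;; c_store (#2 +' ($25 *' $11 +' $26)) 29) ;;
        WSet 28 ($28 +' $28)) ;;
     WSet 27 ($27 +' $27)).

Definition relax_pair : com :=
  choose_route ;; c_store #0 24 ;; If (BLt #0 $24) (new_mid ;; new_table) Skip.

Definition relax : com :=
  For 20 10 (For 21 10 relax_pair) ;; WSet 14 ($12 -' $14).

Definition init_pair : com :=
  If (BEq $20 $21) (WStore (cell $14 $20 $21) #1)
    (WStore (cell $14 $20 $21) (sizeE $20 $21 +' sizeE $20 $21)) ;;
  WStore (cell ($14 +' #1) $20 $21) $20.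

Definition init_registers : com :=
  WSet 10 $0 ;; WSet 11 #0 ;; WSet 13 #1 ;;
  For 4 10
    (If (BLt $10 $13) Skip (WSet 13 ($13 +' $13) ;; WSet 11 ($11 +' #1))) ;;
  WSet 12 (#2 +' $11 *' $11) ;; WSet 14 #0.

Definition c_build : com :=
  init_registers ;;
  For 20 10 (For 21 10 init_pair) ;;
  For 4 10 (WSet 0 $4 ;; WSet 1 $4 ;; WSet 2 #0 ;; XSet 0 XZero ;; relax).

Definition c_insert : com := WSet 2 #1 ;; relax.

Definition try_edge p q : com :=
  If (BAnd (BLt #0 (sizeE $0 $p)) (BLt (sizeE $0 $p) (sizeE $0 $1)))
    (args 90 [:: $0; $1; sizeE $0 $p -' #1] anc ;; WSet 6 $90 ;;
     args 90 [:: $0; $1; sizeE $0 $p] anc ;;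
     If (BAnd (BEq $6 $p) (BEq $90 $q))
       (args 50 [:: $0; $1; sizeE $0 $p -' #1; sizeE $0 $p] interval_query ;;
        c_copy 5 54)
       Skip)
    Skip.

Definition c_query : com :=
  If (BEq (sizeE $0 $1) #0) (WSet 0 #0)
    (WSet 5 #1 ;; XSet 5 (distE $0 $1) ;; try_edge 2 3 ;; try_edge 3 2 ;; c_copy 0 5).

Section Args.
Variables (R : realDomainType) (M Sp n L : nat).
Implicit Types (s : state R) (Q : state R -> Prop).
Local Notation ht := (@ht R M Sp n L).

Lemma weval_keeps k s s' e : keeps k s s' -> wbelow k e -> weval M s' e = weval M s e.
Proof.
case=> w x m mm; elim: e => [c|r|e1 IH|o e1 IH1 e2 IH2] //=.
- by move=> rk; rewrite w.
- by move=> /IH ->; rewrite m.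
- by case/andP=> /IH1 -> /IH2 ->.
Qed.

Lemma ht_args k es c s Q : all (wbelow k) es ->
  (forall s', keeps k s s' ->
     (forall i, i < size es -> wreg s' (k + i) = weval M s (nth #0 es i)) ->
     (forall r, k + size es <= r -> oreg s' r = oreg s r) -> ht c s' Q) ->
  ht (args k es c) s Q.
Proof.
move=> below H.
suff {H} gen k' s1 : k <= k' -> keeps k s s1 -> 
    (forall s', keeps k s s' -> (forall r, r < k' -> wreg s' r = wreg s1 r) ->
      (forall r, k' + size es <= r -> oreg s' r = oreg s1 r) ->
      (forall i, i < size es -> wreg s' (k' + i) = weval M s (nth #0 es i)) -> ht c s' Q) ->
    ht (args k' es c) s1 Q.
  by apply: (gen k s (leqnn k) (keeps_refl _ _)) => s' h1 _ h2 h3; apply: H.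
elim: es k' s1 below => [|e es IH] k' s1 /=; first by move=> _ h1 h2; apply.
case/andP=> be bes kk' ks H; have ev := weval_keeps ks be.
apply: ht_seq; apply: (ht_wset (v := weval M s e)); first exact: ev.
apply: IH => //; [by apply: leqW|exact: keeps_wset|].
move=> s' ks' lo hi vals; apply: H => //.
- by move=> r rk; rewrite lo; [rewrite /= ifN // neq_ltn rk|exact: leqW].
- move=> r /= rk; have nk : (r == k') = false by lia.
  by rewrite hi; [rewrite /oreg /= nk|lia].
- case=> [|i] hi'; first by rewrite addn0 lo //= eqxx.
  by rewrite addnS -addSn vals.
Qed.

Lemma wadd s e1 e2 v1 v2 : weval M s e1 = v1 -> weval M s e2 = v2 ->
  v1 + v2 < M -> weval M s (e1 +' e2) = v1 + v2.
Proof. by move=> /= -> -> lt; rewrite modn_small. Qed.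
Lemma wmul s e1 e2 v1 v2 : weval M s e1 = v1 -> weval M s e2 = v2 ->
  v1 * v2 < M -> weval M s (e1 *' e2) = v1 * v2.
Proof. by move=> /= -> -> lt; rewrite modn_small. Qed.
Lemma wsub s e1 e2 v1 v2 : weval M s e1 = v1 -> weval M s e2 = v2 ->
  v1 < M -> weval M s (e1 -' e2) = v1 - v2.
Proof. by move=> /= -> -> lt; rewrite modn_small //; lia. Qed.
Lemma wdiv s e1 e2 v1 v2 : weval M s e1 = v1 -> weval M s e2 = v2 ->
  v1 < M -> weval M s (e1 /' e2) = v1 %/ v2.
Proof. by move=> /= -> -> lt; rewrite modn_small //; apply: leq_ltn_trans (leq_div _ _) lt. Qed.
Lemma wconst s c : c < M -> weval M s #c = c.
Proof. by move=> lt; rewrite /= modn_small. Qed.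

Lemma blt s e1 e2 v1 v2 : weval M s e1 = v1 -> weval M s e2 = v2 ->
  beval M s (BLt e1 e2) = (v1 < v2).
Proof. by move=> /= -> ->. Qed.
Lemma beq s e1 e2 v1 v2 : weval M s e1 = v1 -> weval M s e2 = v2 ->
  beval M s (BEq e1 e2) = (v1 == v2).
Proof. by move=> /= -> ->. Qed.
Lemma bnot s b v : beval M s b = v -> beval M s (BNot b) = ~~ v.
Proof. by move=> /= ->. Qed.
Lemma band s b1 b2 v1 v2 : beval M s b1 = v1 -> beval M s b2 = v2 ->
  beval M s (BAnd b1 b2) = v1 && v2.
Proof. by move=> /= -> ->. Qed.
End Args.

Arguments ht_args {R M Sp n L k es c s Q}.

Definition planes L := 2 + L * L.
Definition mem_size n L := 2 * planes L * n * n.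

Definition addr n j x y := (j * n + x) * n + y.

Definition oval (R : realDomainType) (f : nat) (v : R) := if f == 0 then None else Some v.

Ltac rd := repeat (rewrite /=; match goal with
  | H : keeps ?k ?s0 ?s |- context [wreg ?s ?r] => rewrite (@kw _ k s0 s H r isT)
  | H : keeps ?k ?s0 ?s |- context [xreg ?s ?r] => rewrite (@kx _ k s0 s H r isT)
  | H : keeps ?k ?s0 ?s |- context [oreg ?s ?r] => rewrite (@keeps_oreg _ k r s0 s H isT)
  | H : only ?d ?s0 ?s |- context [oreg ?s ?r] => rewrite (@only_oreg _ d r s0 s H isT)
  | H : only ?d ?s0 ?s |- context [wreg ?s ?r] => rewrite (@only_w _ d s0 s H r isT)
  | H : only ?d ?s0 ?s |- context [xreg ?s ?r] => rewrite (@only_x _ d s0 s H r isT)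
  end); try done; try eassumption.

Ltac ev := lazymatch goal with
  | |- weval _ _ (_ +' _) = _ => apply: wadd; [ev | ev | try lia]
  | |- weval _ _ (_ -' _) = _ => apply: wsub; [ev | ev | try lia]
  | |- weval _ _ (_ *' _) = _ => apply: wmul; [ev | ev | try lia]
  | |- weval _ _ (_ /' _) = _ => apply: wdiv; [ev | ev | try lia]
  | |- weval _ _ (WConst _) = _ => apply: wconst; try lia
  | |- weval _ _ (WReg _) = _ => rd
  | |- _ => idtac
  end.

Ltac be := lazymatch goal with
  | |- beval _ _ (BLt _ _) = _ => apply: blt; ev
  | |- beval _ _ (BEq _ _) = _ => apply: beq; ev
  | |- beval _ _ (BNot _) = _ => apply: bnot; be
  | |- beval _ _ (BAnd _ _) = _ => apply: band; be
  | |- _ => idtac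
  end.

Ltac arg a i := apply: (etrans (a i isT)); rewrite [nth _ _ _]/=; ev.

(** * Correctness of the programs *)

Section TableContents.
Variables (R : realDomainType) (n L : nat) (G : wgraph R n) (K : pred 'I_n).
Variables (P : 'I_n -> 'I_n -> seq 'I_n) (D : 'I_n -> 'I_n -> R).
Implicit Types (s : state R).

Definition entries o s (x y : 'I_n) : Prop :=
  [/\ wmem s (addr n o x y) = size (P x y),
      0 < size (P x y) -> xmem s (addr n o x y) = D x y,
      0 < size (P x y) ->
        wmem s (addr n (o + 1) x y) = nth x (P x y) ((size (P x y)).-1 %/ 2)
    & forall l r, 2 ^ l + 2 ^ r <= size (P x y) ->
        good G K (seg (P x y) (2 ^ l - 1) (size (P x y) - 2 ^ r)) x y
          (oval (wmem s (addr n (o + (2 + (l * L + r))) x y))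
                (xmem s (addr n (o + (2 + (l * L + r))) x y)))].

Definition regs_ok o s := [/\ wreg s 10 = n, wreg s 11 = L, wreg s 12 = planes L,
  wreg s 13 = 2 ^ L & wreg s 14 = o].

Definition machine_ok o s := regs_ok o s /\ forall x y, entries o s x y.

End TableContents.

Section Programs.
Variables (R : realDomainType) (M n L : nat).
Implicit Types (s : state R) (Q : state R -> Prop).
Local Notation PP := (planes L).
Local Notation Sp := (mem_size n L).
Local Notation ht := (@ht R M Sp n L).

Hypotheses (n0 : 0 < n) (nL : n < 2 ^ L) (Ln : 2 ^ L <= n.*2) (SM : 4 * Sp + 16 <= M).

Lemma L_gt0 : 0 < L.
Proof. by case: (L) nL => //; rewrite expn0; lia. Qed.

Lemma bnds : [/\ 2 <= PP, PP <= Sp, n <= Sp, L <= Sp & 2 ^ L <= Sp].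
Proof.
have L0 := L_gt0; have P0 : 0 < PP by [].
have h : PP <= Sp by rewrite /mem_size -!mulnA mulnCA leq_pmulr // !muln_gt0 n0.
have h2 : n.*2 <= Sp.
  by rewrite /mem_size -mul2n -!mulnA leq_mul2l /= mulnA leq_pmull // muln_gt0 P0.
by split=> //; [lia|rewrite /planes in h; nia|lia].
Qed.

Lemma addr_lt j J x y : j < J -> x < n -> y < n -> addr n j x y < J * n * n.
Proof. by rewrite /addr; nia. Qed.

Lemma addr_inj j j' x x' y y' : x < n -> x' < n -> y < n -> y' < n ->
  addr n j x y = addr n j' x' y' -> [/\ j = j', x = x' & y = y'].
Proof.
move=> hx hx' hy hy' e; have := congr1 (divn^~ n) e; have := congr1 (modn^~ n) e.
rewrite /addr !modnMDl !modn_small // !divnMDl // !(divn_small hy) !(divn_small hy') !addn0.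
move=> ey e2; have := congr1 (divn^~ n) e2; have := congr1 (modn^~ n) e2.
by rewrite !modnMDl !modn_small // !divnMDl // !(divn_small hx) !(divn_small hx') !addn0.
Qed.

Lemma wcell s ej ex ey j x y : wreg s 10 = n -> weval M s ej = j -> weval M s ex = x ->
  weval M s ey = y -> j < 2 * PP -> x < n -> y < n ->
  weval M s (cell ej ex ey) = addr n j x y.
Proof.
move=> e10 h1 h2 h3 hj hx hy; have := addr_lt hj hx hy; rewrite -/(mem_size n L) => lt.
rewrite /cell /addr in lt *.
have n1 := n0; apply: wadd => //; last by lia.
apply: wmul => //; last by lia.
apply: wadd => //; last by nia.
by apply: wmul => //; nia.
Qed.

Section Tables.
Variables (G : wgraph R n) (K : pred 'I_n).
Variables (P : 'I_n -> 'I_n -> seq 'I_n) (D : 'I_n -> 'I_n -> R).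
Local Notation ctx := (machine_ok L G K P D).

Lemma ctx_keeps k o s s' : 14 < k -> keeps k s s' -> ctx o s -> ctx o s'.
Proof.
move=> k14 [w x m mm] [[h1 h2 h3 h4 h5] t]; split.
  by split; rewrite w //; apply: leq_trans k14.
by move=> u v; rewrite /entries m mm; apply: t.
Qed.

Hypotheses (wG : is_wgraph G) (S : path_system G K P D).
Variables (o : nat).
Hypothesis (oP : o <= PP).

Lemma regs10 s : ctx o s -> wreg s 10 = n. Proof. by case=> -[]. Qed.
Lemma regs11 s : ctx o s -> wreg s 11 = L. Proof. by case=> -[]. Qed.
Lemma regs12 s : ctx o s -> wreg s 12 = PP. Proof. by case=> -[]. Qed.
Lemma regs13 s : ctx o s -> wreg s 13 = 2 ^ L. Proof. by case=> -[]. Qed.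
Lemma regs14 s : ctx o s -> wreg s 14 = o. Proof. by case=> -[]. Qed.

Lemma size_lt x y : size (P x y) < 2 ^ L.
Proof. by apply: leq_ltn_trans (ps_size_le S x y) nL. Qed.

Lemma wsize s ex ey (x y : 'I_n) : ctx o s -> weval M s ex = x -> weval M s ey = y ->
  weval M s (sizeE ex ey) = size (P x y).
Proof.
move=> c hx hy.
have -> : weval M s (sizeE ex ey) = wmem s (weval M s (cell $14 ex ey)) by [].
rewrite (wcell (ej := $14) (regs10 c) (regs14 c) hx hy) ?ltn_ord //.
  by case: c => _ /(_ x y)[].
by have [? ? ? ? ?] := bnds; lia.
Qed.

Lemma wmid s ex ey (x y : 'I_n) : ctx o s -> weval M s ex = x -> weval M s ey = y ->
  0 < size (P x y) -> weval M s (midE ex ey) = nth x (P x y) ((size (P x y)).-1 %/ 2).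
Proof.
move=> c hx hy h.
have [? ? ? ? ?] := bnds.
have e : weval M s ($14 +' #1) = o + 1.
  apply: wadd; [exact: regs14 c|apply: wconst; lia|lia].
have -> : weval M s (midE ex ey) = wmem s (weval M s (cell ($14 +' #1) ex ey)) by [].
rewrite (wcell (regs10 c) e hx hy) ?ltn_ord //.
  by case: c => _ /(_ x y)[_ _ /(_ h)].
by have [? ? ? ? ?] := bnds; lia.
Qed.

Lemma xdist s ex ey (x y : 'I_n) : ctx o s -> weval M s ex = x -> weval M s ey = y ->
  0 < size (P x y) -> xeval M s (distE ex ey) = D x y.
Proof.
move=> c hx hy h.
have -> : xeval M s (distE ex ey) = xmem s (weval M s (cell $14 ex ey)) by [].
rewrite (wcell (ej := $14) (regs10 c) (regs14 c) hx hy) ?ltn_ord //.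
  by case: c => _ /(_ x y)[_ /(_ h)].
by have [? ? ? ? ?] := bnds; lia.
Qed.

Lemma nat_lt x y i : i < size (P x y) -> i < M.
Proof.
by move=> h; have := size_lt x y; have [? ? ? ? ?] := bnds; lia.
Qed.

Lemma anc_ok (x y : 'I_n) m s Q : ctx o s -> wreg s 90 = x -> wreg s 91 = y ->
  wreg s 92 = m -> m < size (P x y) ->
  (forall s', keeps 90 s s' -> wreg s' 90 = nth x (P x y) m -> Q s') -> ht anc s Q.
Proof.
move=> c e0 e1 e2 hm H; have [b1 b2 b3 b4 b5] := bnds; apply: ht_seq.
apply: (ht_for (N := L) (Inv := fun i s' => keeps 90 s s' /\ exists (x' y' : 'I_n) m',
  [/\ wreg s' 90 = x', wreg s' 91 = y', wreg s' 92 = m', m' < size (P x' y')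
    & nth x' (P x' y') m' = nth x (P x y) m /\ size (P x' y') <= (2 ^ (L - i)).+1])) => //; try lia.
- by move=> i s' [k _]; rd; apply: regs11 c.
- split; first by keeps_tac.
  exists x, y, m; split; try rd; split=> //; rewrite subn0.
  by have := size_lt x y; lia.
- move=> i s' iL ei [k [x' [y' [m' [h0 h1 h2 hm' [en sz]]]]]].
  have c' : ctx o s' by apply: ctx_keeps k c.
  set h := (size (P x' y')).-1 %/ 2; pose z := nth x' (P x' y') h.
  have hh : h < size (P x' y') by rewrite /h; lia.
  have hM := nat_lt hm'; have szM := size_lt x' y'.
  apply: ht_seq; apply: (ht_wset (v := (size (P x' y') - 1) %/ 2)).
    by apply: wdiv; [apply: wsub; [by apply: (wsize c') => //; rd|ev|]|ev|]; lia.
  rewrite subn1 -/h; set s1 := set_wreg s' 94 h.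
  have k1 : keeps 94 s' s1 by rewrite /s1; keeps_tac.
  have c1 : ctx o s1 by apply: ctx_keeps k1 c'.
  apply: ht_seq; apply: (ht_wset (v := z)).
    by apply: (wmid c1); rewrite /s1; [rd|rd|lia].
  have [z1 z2 _ _] := ps_sub S hh; rewrite -/z in z1 z2.
  have pw : 2 ^ (L - i) = (2 ^ (L - i.+1)).*2.
    by rewrite -mul2n -expnS; congr expn; lia.
  apply: (ht_if (v := h < m')); first by rewrite /s1 /= h2.
    move=> lt; apply: ht_seq; apply: (ht_wset (v := z)); first by rd.
    apply: (ht_wset (v := m' - h)); first by apply: wsub; [rewrite /s1; rd|rewrite /s1; rd|lia].
    split; first by rewrite /s1; rd.
    split; first by rewrite /s1; keeps_tac.
    exists z, y', (m' - h); split; try by rewrite /s1; rd.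
      by rewrite z2 size_drop; lia.
    rewrite z2 nth_drop subnKC; last by lia.
    rewrite (set_nth_default x') // en size_drop; split=> //.
    by rewrite /h; lia.
  rewrite -leqNgt => le; apply: (ht_wset (v := z)); first by rd.
  split; first by rewrite /s1; rd.
  split; first by rewrite /s1; keeps_tac.
  exists x', z, m'; split; try by rewrite /s1; rd.
    by rewrite z1 size_takel.
  rewrite z1 nth_take // en size_takel //; split=> //.
  by rewrite /h; lia.
move=> s' [k [x' [y' [m' [h0 h1 h2 hm' [en sz]]]]]].
rewrite subnn expn0 in sz.
apply: (ht_if (v := m' == 0)); first by rewrite /= h2 mod0n.
  move=> /eqP m0; apply: ht_skip; apply: H => //.
  by rewrite h0 -en m0 (ps_head S) //; lia.
move=> m0; apply: (ht_wset (v := y')); first by rd.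
apply: H; first by keeps_tac.
by rewrite /= -en (ps_last S (y := y')) //; lia.
Qed.

Lemma level_ok i s Q : ctx o s -> wreg s 70 = i -> i < n ->
  (forall s' l, keeps 70 s s' -> wreg s' 71 = l -> wreg s' 72 = 2 ^ l ->
     2 ^ l <= i.+1 < 2 ^ l.+1 -> Q s') -> ht level s Q.
Proof.
move=> c e0 hi H; have [b1 b2 b3 b4 b5] := bnds.
apply: ht_seq; apply: (ht_wset (v := 0)); first by ev.
apply: ht_seq; apply: (ht_wset (v := 1)); first by ev.
set s1 := set_wreg _ 72 1.
apply: (ht_for (N := L) (Inv := fun j s' => keeps 70 s s' /\ wreg s' 70 = i /\ exists l,
  [/\ wreg s' 71 = l, wreg s' 72 = 2 ^ l, 2 ^ l <= i.+1 & i.+1 < 2 ^ l.+1 \/ l = j])) => //; try lia.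
- by move=> j s' [k _]; rd; apply: regs11 c.
- by split; [rewrite /s1; keeps_tac|split; [rewrite /s1; rd|exists 0; split=> //; right]].
- move=> j s' jL ej [k [h0 [l [h1 h2 h3 h4]]]].
  have lM : l < L.
    by rewrite -(ltn_exp2l _ _ (ltnSn 1)); apply: leq_ltn_trans nL; lia.
  apply: (ht_if (v := i + 1 < 2 ^ l + 2 ^ l)).
    rewrite [beval _ _ _]/(weval M s' _ < weval M s' _).
    rewrite (wadd (v1 := i) (v2 := 1)) ?(wadd (v1 := 2 ^ l) (v2 := 2 ^ l)) //; try ev; lia.
  move=> lt; apply: ht_skip; split=> //; split; first by keeps_tac.
    split; first by rd.
    by exists l; split=> //; left; rewrite expnS; lia.
  move=> le; apply: ht_seq; apply: (ht_wset (v := 2 ^ l + 2 ^ l)); first by ev; lia.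
  apply: (ht_wset (v := l + 1)); first by ev; lia.
  split; first by rd.
  split; first by keeps_tac.
  split; first by rd.
  exists (l + 1); rewrite addn1 expnS; split; try by rd; lia.
    by rewrite /= mul2n -addnn.
  by case: h4 => h4; [move: h4; rewrite expnS|]; lia.
move=> s' [k [h0 [l [h1 h2 h3 h4]]]]; apply: (H s' l) => //.
rewrite h3 /=; case: h4 => // lL; rewrite lL in h3; lia.
Qed.

Lemma cprefix_ok (x c z : 'I_n) s Q : ctx o s -> wreg s 75 = x -> wreg s 76 = c ->
  wreg s 77 = z -> 0 < size (P x c) -> 0 < size (P x z) ->
  (forall s' k, keeps 75 s s' -> wreg s' 78 = k -> agree P x c z k ->
     (forall k', agree P x c z k' -> k' <= k) -> Q s') -> ht cprefix s Q.
Proof.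
move=> cx e0 e1 e2 hc hz H; have [b1 b2 b3 b4 b5] := bnds.
apply: ht_seq; apply: (ht_wset (v := 0)); first by ev.
apply: ht_seq; apply: (ht_wset (v := 2 ^ L)); first by rd; apply: regs13 cx.
set s1 := set_wreg _ 79 _.
apply: (ht_for (N := L) (Inv := fun i s' => keeps 75 s s' /\
  [/\ wreg s' 75 = x, wreg s' 76 = c & wreg s' 77 = z] /\ exists m,
  [/\ wreg s' 78 = m, wreg s' 79 = 2 ^ (L - i), agree P x c z m &
      forall k, agree P x c z k -> k < m + 2 ^ (L - i)])) => //; try lia.
- by move=> i s' [k _]; rd; apply: regs11 cx.
- split; first by rewrite /s1; keeps_tac.
  split; first by rewrite /s1; split; rd.
  exists 0; rewrite subn0; split; try by rewrite /s1; rd.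
    exact: (agree0 S).
  by move=> k [hk _ _]; have := size_lt x c; lia.
- move=> i s' iL ei [k [[h0 h1 h2] [m [h3 h4 am mx]]]].
  have c' : ctx o s' by apply: ctx_keeps k cx.
  have pw : 2 ^ (L - i) = (2 ^ (L - i.+1)).*2.
    by rewrite -mul2n -expnS; congr expn; lia.
  set p := 2 ^ (L - i.+1) in pw.
  have p0 : 0 < p by rewrite /p expn_gt0.
  have pL : p <= 2 ^ L by rewrite /p leq_exp2l //; lia.
  have mL : m < 2 ^ L by case: am => hm _ _; have := size_lt x c; lia.
  apply: ht_seq; apply: (ht_wset (v := 2 ^ (L - i) %/ 2)); first by ev; rewrite pw; lia.
  have -> : 2 ^ (L - i) %/ 2 = p by rewrite pw -muln2 mulnK.
  set s2 := set_wreg _ 79 _.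
  have k2 : keeps 75 s s2 by rewrite /s2; keeps_tac.
  have c2 : ctx o s2 by apply: ctx_keeps k2 cx.
  have v1 : weval M s2 ($78 +' $79) = m + p by apply: wadd; [rewrite /s2; rd|rewrite /s2; rd|lia].
  apply: (ht_if (v := (m + p < size (P x c)) && (m + p < size (P x z)))).
    by apply: band; apply: blt => //; apply: (wsize c2); rewrite /s2; rd.
  - case/andP=> hmc hmz; apply: ht_seq; apply: ht_args => // s3 k3 a3 _.
    have k3' : keeps 75 s s3 by rewrite /s2 in k3; keeps_tac.
    have c3 : ctx o s3 by apply: ctx_keeps k3' cx.
    apply: (anc_ok c3 (x := x) (y := c) (m := m + p)) => //.
    + by arg a3 0; rewrite /s2; rd.
    + by arg a3 1; rewrite /s2; rd.
    + by arg a3 2; rewrite ?/s2; rd; lia.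
    move=> s4 k4 e4; apply: ht_seq; apply: (ht_wset (v := nth x (P x c) (m + p))); first by rd.
    set s5 := set_wreg _ 81 _.
    have k5 : keeps 75 s s5 by rewrite /s5; keeps_tac.
    have c5 : ctx o s5 by apply: ctx_keeps k5 cx.
    apply: ht_seq; apply: ht_args => // s6 k6 a6 _.
    have k6' : keeps 75 s s6 by keeps_tac.
    have c6 : ctx o s6 by apply: ctx_keeps k6' cx.
    apply: (anc_ok c6 (x := x) (y := z) (m := m + p)) => //.
    + by arg a6 0; rewrite /s5; rd; rewrite /s2; rd.
    + by arg a6 1; rewrite /s5; rd; rewrite /s2; rd.
    + by arg a6 2; rewrite /s5; rd; rewrite /s2; rd; lia.
    move=> s7 k7 e7.
    have k7' : keeps 75 s s7 by keeps_tac.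
    have [r0 r1 r2] : [/\ wreg s7 75 = x, wreg s7 76 = c & wreg s7 77 = z].
      by split; rd; rewrite /s5; rd; rewrite /s2; rd.
    have [r3 r4] : wreg s7 78 = m /\ wreg s7 79 = p.
      by split; rd; rewrite /s5; rd; rewrite /s2; rd.
    have r5 : wreg s7 80 = i.
      by rd; rewrite /s5; rd; rewrite /s2; rd.
    apply: (ht_if (v := nth x (P x c) (m + p) == nth x (P x z) (m + p))).
      by apply: beq; [rd; rewrite /s5; rd|rd].
    + move=> /eqP en; apply: (ht_wset (v := m + p)); first by ev; lia.
      split; first by rd.
      split; first by keeps_tac.
      split; first by split; rd.
      exists (m + p); split; try by rd.
      by move=> k0 /mx; rewrite pw; lia.
    + move=> /eqP ne; apply: ht_skip; split; first by rd.
      split; first by keeps_tac.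
      split; first by split; rd.
      exists m; split; try by rd.
      move=> k0 ak; rewrite ltnNge; apply/negP => le.
      by case: ne; case: (agree_le S le ak).
  - move=> nlt; apply: ht_skip; split; first by rewrite /s2; rd.
    split; first by rewrite /s2; keeps_tac.
    split; first by rewrite /s2; split; rd.
    exists m; split; try by rewrite /s2; rd.
    by move=> k0 [h5 h6 _]; rewrite ltnNge; apply: contra nlt => ?; lia.
move=> s' [k [_ [m [h3 _ am mx]]]]; apply: (H s' m) => // k' /mx.
by rewrite subnn expn0; lia.
Qed.

Lemma fetch_ok r ej ex ey j x y s Q : wreg s 10 = n -> 10 < r ->
  weval M s ej = j -> weval M s ex = x -> weval M s ey = y ->
  j < 2 * PP -> x < n -> y < n -> [&& wbelow r ej, wbelow r ex & wbelow r ey] ->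
  (forall s', only r s s' ->
     oreg s' r = oval (wmem s (addr n j x y)) (xmem s (addr n j x y)) -> Q s') ->
  ht (c_fetch r ej ex ey) s Q.
Proof.
move=> e10 r10 h1 h2 h3 hj hx hy bl H.
have e := wcell e10 h1 h2 h3 hj hx hy.
apply: ht_seq; apply: (ht_wset (v := wmem s (addr n j x y))).
  by rewrite -e.
set s1 := set_wreg _ _ _.
have k1 : keeps r s s1 by apply: keeps_wset (keeps_refl _ _).
apply: (ht_xset (v := xmem s (addr n j x y))).
  have -> : xeval M s1 (XLoad (cell ej ex ey)) = xmem s1 (weval M s1 (cell ej ex ey)) by [].
  rewrite (weval_keeps _ k1) ?e //.
  by case/and3P: bl => b1 b2 b3; rewrite /= b1 b2 b3 r10.
apply: H; first by apply/only_xset/only_wset/only_refl.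
by rewrite /oreg /= !eqxx.
Qed.

Lemma log_lt m l : m < n -> 2 ^ l <= m.+1 -> l < L.
Proof.
by move=> mn le; rewrite -(ltn_exp2l _ _ (ltnSn 1)); apply: leq_ltn_trans nL; lia.
Qed.

Lemma interval_ok (x z : 'I_n) i j s Q : ctx o s -> wreg s 50 = x -> wreg s 51 = z ->
  wreg s 52 = i -> wreg s 53 = j -> i < j -> j < size (P x z) ->
  (forall s', keeps 50 s s' -> good G K (seg (P x z) i j) x z (oreg s' 54) -> Q s') ->
  ht interval_query s Q.
Proof.
move=> c e0 e1 e2 e3 ij js H; have [b1 b2 b3 b4 b5] := bnds.
have sn := ps_size_le S x z.
apply: ht_seq; apply: ht_args => // s1 k1 a1 _.
have c1 : ctx o s1 by apply: ctx_keeps k1 c.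
apply: (level_ok c1 (i := i)); [by arg a1 0|by lia|move=> s2 l k2 l1 l2 /andP[l3 l4]].
have lL : l < L by apply: (log_lt (m := i)) => //; lia.
have k2' : keeps 50 s s2 by keeps_tac.
apply: ht_seq; apply: (ht_wset (v := l)); first by rd.
set s3 := set_wreg _ 54 _.
apply: ht_seq; apply: (ht_wset (v := 2 ^ l)); first by rewrite /s3; rd.
set s4 := set_wreg _ 55 _.
have k4 : keeps 50 s s4 by rewrite /s4 /s3; keeps_tac.
have c4 : ctx o s4 by apply: ctx_keeps k4 c.
have g0 : wreg s4 50 = x by rewrite /s4 /s3; rd.
have g1 : wreg s4 51 = z by rewrite /s4 /s3; rd.
have g2 : wreg s4 52 = i by rewrite /s4 /s3; rd.
have g3 : wreg s4 53 = j by rewrite /s4 /s3; rd.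
have g4 : wreg s4 54 = l by [].
have g5 : wreg s4 55 = 2 ^ l by [].
move: {s1 s2 s3 k1 a1 c1 k2 l1 l2 k2'} s4 k4 c4 g0 g1 g2 g3 g4 g5 => s1 k1 c1 g0 g1 g2 g3 g4 g5.
apply: ht_seq; apply: ht_args => // s2 k2 a2 _.
have k2' : keeps 50 s s2 by keeps_tac.
have c2 : ctx o s2 by apply: ctx_keeps k2' c.
apply: (level_ok c2 (i := size (P x z) - 1 - j)).
- by arg a2 0; try lia; apply: (wsize c1); rd.
- by lia.
move=> s3 r k3 r1 r2 /andP[r3 r4].
have rL : r < L by apply: (log_lt (m := size (P x z) - 1 - j)) => //; lia.
apply: ht_seq; apply: (ht_wset (v := r)); first by rd.
apply: ht_seq; apply: (ht_wset (v := 2 ^ r)); first by rd.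
set s4 := set_wreg _ 57 _.
have k4 : keeps 50 s s4 by rewrite /s4; keeps_tac.
have c4 : ctx o s4 by apply: ctx_keeps k4 c.
have {}g0 : wreg s4 50 = x by rewrite /s4; rd.
have {}g1 : wreg s4 51 = z by rewrite /s4; rd.
have {}g2 : wreg s4 52 = i by rewrite /s4; rd.
have {}g3 : wreg s4 53 = j by rewrite /s4; rd.
have {}g4 : wreg s4 54 = l by rewrite /s4; rd.
have {}g5 : wreg s4 55 = 2 ^ l by rewrite /s4; rd.
have g6 : wreg s4 56 = r by [].
have g7 : wreg s4 57 = 2 ^ r by [].
move: {s1 s2 s3 k1 a2 c1 k2 r1 r2 k2' c2 k3} s4 k4 c4 g0 g1 g2 g3 g4 g5 g6 g7
  => s1 k1 c1 g0 g1 g2 g3 g4 g5 g6 g7.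
rewrite expnS in l4; rewrite expnS in r4.
have l0 : 0 < 2 ^ l by rewrite expn_gt0.
have r0 : 0 < 2 ^ r by rewrite expn_gt0.
set pl := 2 ^ l in l3 l4 l0 g5; set pr := 2 ^ r in r3 r4 r0 g7.
apply: ht_seq; apply: ht_args => // s2 k2 a2 _.
have k2' : keeps 50 s s2 by keeps_tac.
have c2 : ctx o s2 by apply: ctx_keeps k2' c.
pose x' := nth x (P x z) (i - (pl - 1)); pose y' := nth x (P x z) (j + (pr - 1)).
apply: (anc_ok c2 (x := x) (y := z) (m := i - (pl - 1))); [by arg a2 0|by arg a2 1| | |].
- by arg a2 2; lia.
- by lia.
move=> s3 k3 ex'; apply: ht_seq; apply: (ht_wset (v := x')); first by rd.
set s4 := set_wreg _ 58 _.
have k4 : keeps 50 s s4 by rewrite /s4; keeps_tac.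
have c4 : ctx o s4 by apply: ctx_keeps k4 c.
apply: ht_seq; apply: ht_args => // s5 k5 a5 _.
have k5' : keeps 50 s s5 by keeps_tac.
have c5 : ctx o s5 by apply: ctx_keeps k5' c.
apply: (anc_ok c5 (x := x) (y := z) (m := j + (pr - 1))).
- by arg a5 0; rewrite /s4; rd.
- by arg a5 1; rewrite /s4; rd.
- by arg a5 2; rewrite /s4; rd; lia.
- by lia.
move=> s6 k6 ey'; apply: ht_seq; apply: (ht_wset (v := y')); first by rd.
set s7 := set_wreg _ 59 _.
have k7 : keeps 50 s s7 by rewrite /s7; keeps_tac.
have c7 : ctx o s7 by apply: ctx_keeps k7 c.
pose pp := o + (2 + (l * L + r)).
have llr : l * L + r < L * L by nia.
have pp2 : pp < 2 * PP by move: oP; rewrite /pp /planes; lia.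
have ppM : pp < M by lia.
apply: ht_seq; apply: (ht_wset (v := pp)).
  rewrite /pp; apply: wadd; [exact: regs14 c7|apply: wadd; [ev|apply: wadd|]|]; try lia.
  - apply: wmul; [by rewrite /s7; rd; rewrite /s4; rd|exact: regs11 c7|lia].
  - by rewrite /s7; rd; rewrite /s4; rd.
set s8 := set_wreg _ 60 _.
have k8 : keeps 50 s s8 by rewrite /s8; keeps_tac.
have {}g0 : wreg s8 50 = x by rewrite /s8 /s7; rd; rewrite /s4; rd.
have {}g1 : wreg s8 51 = z by rewrite /s8 /s7; rd; rewrite /s4; rd.
have h8 : wreg s8 58 = x' by rewrite /s8 /s7; rd; rewrite /s4; rd.
have h9 : wreg s8 59 = y' by [].
have h10 : wreg s8 60 = pp by [].
have m8 : forall a, wmem s8 a = wmem s a by move=> a; rewrite (kwm k8).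
have mx8 : forall a, xmem s8 a = xmem s a by move=> a; rewrite (kxm k8).
move: {s1 s2 s3 s4 s5 s6 s7 k1 c1 g2 g3 g4 g5 g6 g7 k2 a2 k2' c2 k3 ex' k4 c4 k5 a5 k5' c5 k6 ey' k7 c7}
  s8 k8 g0 g1 h8 h9 h10 m8 mx8 => s1 k1 g0 g1 h8 h9 h10 m8 mx8.
have c1 : ctx o s1 by apply: ctx_keeps k1 c.
have hx' : i - (pl - 1) < size (P x z) by lia.
have hy' : j + (pr - 1) < size (P x z) by lia.
have [x1 x2 x3 x4] := ps_sub S hx'; have [y1 y2 y3 y4] := ps_sub S hy'.
rewrite -/x' in x1 x2 x3 x4; rewrite -/y' in y1 y2 y3 y4.
have sx' : 0 < size (P x x') by rewrite x1 size_takel.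
have sx'z : size (P x' z) = size (P x z) - (i - (pl - 1)) by rewrite x2 size_drop.
have sy' : 0 < size (P y' z) by rewrite y2 size_drop subn_gt0.
have sxy' : size (P x y') = (j + (pr - 1)).+1 by rewrite y1 size_takel.
have hx'' : i - (pl - 1) < size (P x y') by lia.
have nx' : nth x (P x y') (i - (pl - 1)) = x' by rewrite y1 nth_take //; lia.
have sx'y' : size (P x' y') = size (P x y') - (i - (pl - 1)).
  by rewrite -[in LHS]nx' (ps_size_suf S hx'').
pose V u v := oval (wmem s (addr n pp u v)) (xmem s (addr n pp u v)).
have gV (u v : 'I_n) : pl + pr <= size (P u v) ->
    good G K (seg (P u v) (pl - 1) (size (P u v) - (pr - 1).+1)) u v (V u v).
  move=> h; have -> : (pr - 1).+1 = pr by lia.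
  by case: c => _ /(_ u v)[_ _ _]; apply.
apply: ht_seq; apply: (fetch_ok (j := pp) (x := x') (y := y') (regs10 c1)) => // s2 o2 v2.
rewrite m8 mx8 -/(V x' y') in v2.
have k2 : keeps 50 s s2 by keeps_tac.
have c2 : ctx o s2 by apply: ctx_keeps k2 c.
apply: ht_seq; apply: (ht_addx (v := D x x')); first by apply: (xdist c2) => //; rd.
move=> s3 o3; rewrite v2 => v3.
have k3 : keeps 50 s s3 by keeps_tac.
have c3 : ctx o s3 by apply: ctx_keeps k3 c.
apply: ht_seq; apply: (ht_addx (v := D y' z)); first by apply: (xdist c3) => //; rd.
move=> s4 o4; rewrite v3 => v4.
have k4 : keeps 50 s s4 by keeps_tac.
have c4 : ctx o s4 by apply: ctx_keeps k4 c.
have [f0 f1 f2 f3 f4] : [/\ wreg s4 50 = x, wreg s4 51 = z, wreg s4 58 = x', wreg s4 59 = y' & wreg s4 60 = pp].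
  by split; rd.
move: {s2 s3 o2 v2 k2 c2 o3 v3 k3 c3 o4} s4 k4 c4 v4 f0 f1 f2 f3 f4 => s2 k2 c2 v2 f0 f1 f2 f3 f4.
apply: ht_seq; apply: (fetch_ok (j := pp) (x := x') (y := z) (regs10 c2)) => // s3 o3 v3.
rewrite (kwm k2) (kxm k2) -/(V x' z) in v3.
have k3 : keeps 50 s s3 by keeps_tac.
have c3 : ctx o s3 by apply: ctx_keeps k3 c.
apply: ht_seq; apply: (ht_addx (v := D x x')); first by apply: (xdist c3) => //; rd.
move=> s4 o4; rewrite v3 => v4.
apply: ht_seq; apply: ht_min; [lia|by []|move=> s5 o5].
rewrite v4 (only_oreg o4) // (only_oreg o3) // v2 => v5.
have k5 : keeps 50 s s5 by keeps_tac.
have c5 : ctx o s5 by apply: ctx_keeps k5 c.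
have [q0 q1 q3 q4] : [/\ wreg s5 50 = x, wreg s5 51 = z, wreg s5 59 = y' & wreg s5 60 = pp].
  by split; rd.
move: {s3 s4 o3 v3 k3 c3 o4 v4 o5} s5 k5 c5 v5 q0 q1 q3 q4 => s3 k3 c3 v3 q0 q1 q3 q4.
apply: ht_seq; apply: (fetch_ok (j := pp) (x := x) (y := y') (regs10 c3)) => // s4 o4 v4.
rewrite (kwm k3) (kxm k3) -/(V x y') in v4.
have k4 : keeps 50 s s4 by keeps_tac.
have c4 : ctx o s4 by apply: ctx_keeps k4 c.
apply: ht_seq; apply: (ht_addx (v := D y' z)); first by apply: (xdist c4) => //; rd.
move=> s5 o5; rewrite v4 => v5.
have k5 : keeps 50 s s5 by keeps_tac.
have c5 : ctx o s5 by apply: ctx_keeps k5 c.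
apply: ht_seq; apply: (fetch_ok (j := pp) (x := x) (y := z) (regs10 c5)) => //; try by rd.
move=> s6 o6; rewrite (kwm k5) (kxm k5) -/(V x z) => v6.
apply: ht_seq; apply: ht_min; [lia|by []|move=> s7 o7].
rewrite v6 (only_oreg o6) // v5 => v7.
apply: ht_seq; apply: ht_min; [lia|by []|move=> s8 o8].
rewrite v7 (only_oreg o7) // (only_oreg o6) // (only_oreg o5) // (only_oreg o4) // v3 => v8.
apply: ht_copy => // s9 o9 v9; apply: H; first by keeps_tac.
rewrite v9 v8; apply: (interval_good wG S (pi := pl - 1) (pr := pr - 1)) => //; try lia.
- by apply: (gV x' y'); lia.
- by apply: (gV x' z); lia.
- by apply: (gV x y'); lia.
- by apply: (gV x z); lia.
Qed.

Lemma clip_ok (x c z : 'I_n) i j s Q : ctx o s -> wreg s 40 = x -> wreg s 41 = c ->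
  wreg s 42 = z -> wreg s 43 = i -> wreg s 44 = j -> 0 < size (P x c) ->
  (forall s', keeps 40 s s' -> good G K (seg (P x c) i j) x z (oreg s' 45) -> Q s') ->
  ht clip s Q.
Proof.
move=> cx e0 e1 e2 e3 e4 hc H; have [b1 b2 b3 b4 b5] := bnds.
apply: (ht_if (v := size (P x z) == 0)).
  by apply: beq; [apply: (wsize cx)|ev].
  move=> /eqP z0; apply: (ht_wset (v := 0)); first by ev.
  apply: H; first by keeps_tac.
  rewrite /oreg /=; split=> // r w.
  have w' : wk G K (fun _ _ => false) x z r by apply: wk_mono w.
  by have [] := ps_min S w'; rewrite z0.
move=> z0; have hz : 0 < size (P x z) by lia.
apply: ht_seq; apply: ht_args => // s1 k1 a1 _.
have k1' : keeps 40 s s1 by keeps_tac.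
have c1 : ctx o s1 by apply: ctx_keeps k1' cx.
apply: (cprefix_ok c1 (x := x) (c := c) (z := z)) => //; [by arg a1 0|by arg a1 1|by arg a1 2|].
move=> s2 k k2 ek ak mk.
have k2' : keeps 40 s s2 by keeps_tac.
have [g0 g2 g3 g4] : [/\ wreg s2 40 = x, wreg s2 42 = z, wreg s2 43 = i & wreg s2 44 = j].
  by split; rd.
move: {s1 k1 a1 k1' c1 k2} s2 ek k2' g0 g2 g3 g4 => s1 ek k1 g0 g2 g3 g4.
pose m := minn j k.
have rest s2 : wreg s2 46 = m -> keeps 46 s1 s2 -> ht
    (If (BLt $43 $46) (args 50 [:: $40; $42; $43; $46] interval_query ;; c_copy 45 54)
       (WSet 45 #1 ;; XSet 45 (distE $40 $42))) s2 Q.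
  move=> em k2; have k2' : keeps 40 s s2 by keeps_tac.
  have c2 : ctx o s2 by apply: ctx_keeps k2' cx.
  apply: (ht_if (v := i < m)); first by apply: blt; rd.
    move=> im; apply: ht_seq; apply: ht_args => // s3 k3 a3 _.
    have k3' : keeps 40 s s3 by keeps_tac.
    have c3 : ctx o s3 by apply: ctx_keeps k3' cx.
    apply: (interval_ok c3 (x := x) (z := z) (i := i) (j := m)) => //.
    - by arg a3 0.
    - by arg a3 1.
    - by arg a3 2.
    - by arg a3 3.
    - by case: ak => _ h _; apply: leq_ltn_trans h; apply: geq_minr.
    move=> s4 k4 gd; apply: ht_copy => // s5 o5 v5; apply: H; first by keeps_tac.
    by rewrite v5; apply: (clip_good S ak mk) => //; rewrite im.
  move=> im; apply: ht_seq; apply: (ht_wset (v := 1)); first by ev.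
  set s3 := set_wreg _ _ _.
  have k3 : keeps 40 s s3 by rewrite /s3; keeps_tac.
  have c3 : ctx o s3 by apply: ctx_keeps k3 cx.
  apply: (ht_xset (v := D x z)); first by apply: (xdist c3); rewrite /s3; rd.
  apply: H; first by rewrite /s3; keeps_tac.
  by apply: (clip_good S ak mk) => // h; rewrite h in im.
apply: ht_seq; apply: (ht_if (v := j < k)); first by apply: blt; rd.
  move=> jk; apply: (ht_wset (v := j)); first by rd.
  by apply: rest; [rewrite /= /m; lia|keeps_tac].
move=> jk; apply: (ht_wset (v := k)); first by rd.
by apply: rest; [rewrite /= /m; lia|keeps_tac].
Qed.

Lemma sizeE_keeps k s s' p q : 14 < k -> p < k -> q < k -> keeps k s s' ->
  weval M s' (sizeE $p $q) = weval M s (sizeE $p $q).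
Proof.
move=> k14 pk qk ks; apply: (weval_keeps _ ks).
by rewrite /= pk qk k14 (ltn_trans _ k14).
Qed.

Lemma try_edge_ok p q (u v e f : 'I_n) s Q : ctx o s -> wreg s 0 = u -> wreg s 1 = v ->
  p < 4 -> q < 4 -> wreg s p = e -> wreg s q = f ->
  (forall s', (forall r, r < 15 -> r != 5 -> r != 6 -> wreg s' r = wreg s r) ->
     wmem s' = wmem s -> xmem s' = xmem s ->
     (oreg s' 5 = oreg s 5 /\ forall k, k.+1 < size (P u v) ->
        nth u (P u v) k = e -> nth u (P u v) k.+1 = f -> False) \/
     good G K (same_pair e f) u v (oreg s' 5) -> Q s') ->
  ht (try_edge p q) s Q.
Proof.
move=> c eu ev_ p4 q4 ee ef H; have [b1 b2 b3 b4 b5] := bnds.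
have sz0 := ps_size_le S u e; have sz1 := ps_size_le S u v.
have Hk s' : keeps 15 s s' ->
    (oreg s' 5 = oreg s 5 /\ forall k, k.+1 < size (P u v) ->
        nth u (P u v) k = e -> nth u (P u v) k.+1 = f -> False) \/
     good G K (same_pair e f) u v (oreg s' 5) -> Q s'.
  by case=> [h1 h2 h3 h4] h5; apply: H => // r hr _ _; apply: h1.
have uniq_k k : k.+1 < size (P u v) -> nth u (P u v) k = e -> size (P u e) = k.+1.
  by move=> hk ek; rewrite -ek (ps_size_pre S (ltnW hk)).
have wse s' : keeps 15 s s' -> weval M s' (sizeE $0 $p) = size (P u e).
  move=> ks; rewrite (sizeE_keeps _ _ _ ks) //; last by lia.
  exact: (wsize c).
apply: (ht_if (v := (0 < size (P u e)) && (size (P u e) < size (P u v)))).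
  apply: band; apply: blt; [ev|exact: (wsize c)|exact: (wsize c)|exact: (wsize c)].
- case/andP=> h1 h2.
  apply: ht_seq; apply: ht_args => [|s1 k1 a1 _]; first by rewrite /=; lia.
  have c1 : ctx o s1 by apply: ctx_keeps k1 c.
  apply: (anc_ok c1 (x := u) (y := v) (m := size (P u e) - 1)); [by arg a1 0|by arg a1 1| | |].
  + by arg a1 2; try lia; apply: (wsize c).
  + by lia.
  move=> s2 k2 e2; set g := nth _ _ _ in e2.
  apply: ht_seq; apply: (ht_wset (v := g)); first by rd.
  set s3 := set_wreg _ _ _.
  have w3 r : r < 90 -> r != 6 -> wreg s3 r = wreg s r.
    by move=> hr h6; rewrite /= (negbTE h6) (kw k2) // (kw k1).
  have k23 : keeps 90 s s2 by keeps_tac.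
  have m3 : wmem s3 = wmem s by rewrite /= (kwm k23).
  have x3 : xmem s3 = xmem s by rewrite /= (kxm k23).
  have o3 : oreg s3 5 = oreg s 5 by apply: (keeps_oreg k23).
  have c3 : ctx o s3.
    case: c => [[q1 q2 q3 q4' q5] t]; split; first by split; rewrite w3.
    by move=> x y; rewrite /entries m3 x3; apply: t.
  have ep3 : wreg s3 p = e by rewrite w3 //; lia.
  have eq3 : wreg s3 q = f by rewrite w3 //; lia.
  have eu3 : wreg s3 0 = u by rewrite w3.
  have ev3 : wreg s3 1 = v by rewrite w3.
  have e63 : wreg s3 6 = g by [].
  have H3 s' : keeps 15 s3 s' -> (oreg s' 5 = oreg s 5 /\ forall k, k.+1 < size (P u v) ->
        nth u (P u v) k = e -> nth u (P u v) k.+1 = f -> False) -> Q s'.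
    move=> [h3 h4 h5 h6] h7; apply: H; rewrite ?h5 ?h6 //; last by left.
    by move=> r hr h8 h9; rewrite h3 // w3 //; lia.
  move: {s1 k1 a1 c1 s2 k2 e2 k23} s3 w3 m3 x3 o3 c3 ep3 eq3 eu3 ev3 e63 H3
    => s1 w1 m1 x1 o1 c1 ep1 eq1 eu1 ev1 e61 H1.
  apply: ht_seq; apply: ht_args => [|s2 k2 a2 _]; first by rewrite /=; lia.
  have c2 : ctx o s2 by apply: ctx_keeps k2 c1.
  apply: (anc_ok c2 (x := u) (y := v) (m := size (P u e))); [by arg a2 0|by arg a2 1| |by []|].
  + by arg a2 2; exact: (wsize c1).
  move=> s3 k3 e3; set g' := nth _ _ _ in e3.
  have k13 : keeps 90 s1 s3 by keeps_tac.
  have c3 : ctx o s3 by apply: ctx_keeps k13 c1.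
  have p90 : p < 90 by lia.
  have q90 : q < 90 by lia.
  have ep3 : wreg s3 p = e by rewrite (kw k13).
  have eq3 : wreg s3 q = f by rewrite (kw k13).
  apply: (ht_if (v := (g == e) && (g' == f))).
    by apply: band; apply: beq; rd.
  + case/andP=> /eqP ge /eqP gf.
    apply: ht_seq; apply: ht_args => [|s4 k4 a4 _]; first by rewrite /=; lia.
    have c4 : ctx o s4 by apply: ctx_keeps k4 c3.
    apply: (interval_ok c4 (x := u) (z := v) (i := size (P u e) - 1) (j := size (P u e))) => //.
    * by arg a4 0; rd.
    * by arg a4 1; rd.
    * by arg a4 2; try lia; apply: (wsize c3) => //; rd.
    * by arg a4 3; apply: (wsize c3) => //; rd.
    * by lia.
    move=> s5 k5 gd; apply: ht_copy => // s6 [o61 o62 o63 o64] e6.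
    have k35 : keeps 50 s1 s5 by keeps_tac.
    apply: H.
    * move=> r hr h5 h6; rewrite o61 //.
      by rewrite (kw k35) ?w1 //; lia.
    * by rewrite o63 (kwm k35).
    * by rewrite o64 (kxm k35).
    * right; rewrite e6.
      apply: (edge_of_path_good (p := e) (q := f) (s := P u v) (i := size (P u e) - 1)).
      - by lia.
      - exact: ge.
      - by rewrite -gf; congr nth; lia.
      - by apply/same_pairP; left.
      - by have -> : (size (P u e) - 1).+1 = size (P u e) by lia.
  + move=> ne; apply: ht_skip; apply: H1; first by keeps_tac.
    split; first by rewrite (keeps_oreg k13).
    move=> k hk ek ek1; move: ne; have sk := uniq_k k hk ek.
    by rewrite /g /g' sk subn1 /= ek ek1 !eqxx.
- move=> nc; apply: ht_skip; apply: Hk; first exact: keeps_refl.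
  left; split=> // k hk ek ek1; move: nc; rewrite (uniq_k k hk ek) hk.
  by [].
Qed.

Lemma query_ok (u v e f : 'I_n) s Q : ctx o s -> wreg s 0 = u -> wreg s 1 = v ->
  wreg s 2 = e -> wreg s 3 = f ->
  (forall s', ctx o s' -> good G K (same_pair e f) u v (oreg s' 0) -> Q s') ->
  ht c_query s Q.
Proof.
move=> c eu ev_ ee ef H; have [b1 b2 b3 b4 b5] := bnds.
have ctx_of s' : (forall r, r < 15 -> r != 0 -> r != 5 -> r != 6 -> wreg s' r = wreg s r) ->
    wmem s' = wmem s -> xmem s' = xmem s -> ctx o s'.
  move=> h1 h2 h3; case: c => [[q1 q2 q3 q4 q5] t]; split; first by split; rewrite h1.
  by move=> x y; rewrite /entries h2 h3; apply: t.
apply: (ht_if (v := size (P u v) == 0)).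
  by apply: beq; [exact: (wsize c)|ev].
- move=> /eqP z0; apply: (ht_wset (v := 0)); first by ev.
  apply: H.
    by apply: ctx_of => // r hr h0 _ _; rewrite /= (negbTE h0).
  rewrite /oreg /=; split=> // r w.
  have w' : wk G K (fun _ _ => false) u v r by apply: wk_mono w.
  by have [] := ps_min S w'; rewrite z0.
- move=> z0; have hz : 0 < size (P u v) by lia.
  apply: ht_seq; apply: (ht_wset (v := 1)); first by ev.
  set s1 := set_wreg _ _ _.
  have c1 : ctx o s1.
    by apply: ctx_of => // r hr _ h5 _; rewrite /= (negbTE h5).
  apply: ht_seq; apply: (ht_xset (v := D u v)); first exact: (xdist c1).
  set s2 := set_xreg _ _ _.
  have c2 : ctx o s2.
    by apply: ctx_of => // r hr _ h5 _; rewrite /= (negbTE h5).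
  have o2 : oreg s2 5 = Some (D u v) by [].
  apply: ht_seq; apply: (try_edge_ok (p := 2) (q := 3) c2 eu ev_ _ _ ee ef) => // s3 w3 m3 x3 d3.
  have c3 : ctx o s3.
    by apply: ctx_of; rewrite ?m3 ?x3 // => r hr _ h5 h6; rewrite w3 //= (negbTE h5).
  apply: ht_seq; apply: (try_edge_ok (p := 3) (q := 2) c3 (u := u) (v := v) (e := f) (f := e));
    rewrite ?w3 // => s4 w4 m4 x4 d4.
  apply: ht_copy => // s5 [o51 o52 o53 o54] e5; apply: H.
    apply: ctx_of; rewrite ?o53 ?o54 ?m4 ?x4 ?m3 ?x3 // => r hr h0 h5 h6.
    by rewrite o51 // w4 // w3 //= (negbTE h5).
  rewrite e5; case: d4 => [[-> n4]|gd]; last first.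
    by apply: good_ext gd => a b; rewrite same_pairAC.
  case: d3 => [[-> n3]|//]; rewrite o2; apply: (avoid_good S hz).
  apply/negP => /(segP u)[k [_ hk /same_pairP[] [h1 h2]]].
    exact: (n3 k hk (esym h1) (esym h2)).
  exact: (n4 k hk (esym h2) (esym h1)).
Qed.

Section Relaxation.
Variables (G' : wgraph R n) (K' : pred 'I_n).
Variables (a b : 'I_n) (w : R) (lam : bool).
Hypothesis (E : extension G G' K K' a b w lam).
Local Notation newP := (newP P D a b w lam).
Local Notation newD := (newD P D a b w).
Local Notation improves := (improves P D w).
Local Notation link := (link a b).
Local Notation route := (route P D a b w).
Local Notation crosses := (crosses P D a b w lam).
Local Notation newP_cases := (newP_cases wG S E).
Local Notation newP_link := (newP_link wG S E).
Local Notation size_newP := (size_newP wG S E).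
Local Notation improves_sym := (improves_sym w wG S).
Local Notation newP_rev := (newP_rev wG S E).
Hypothesis o_base : o = 0 \/ o = PP.
Local Notation o' := (PP - o).

Definition relax_args s := [/\ wreg s 0 = a, wreg s 1 = b, wreg s 2 = lam & xreg s 0 = w].

Lemma relax_args_keeps k s s' : 2 < k -> keeps k s s' -> relax_args s -> relax_args s'.
Proof.
move=> k2 [h1 h2 _ _] [a0 a1 a2 a3].
by split; rewrite ?h1 ?h2 //; apply: leq_trans k2.
Qed.

Lemma improvesE_ok p q (g g' x y : 'I_n) s : ctx o s -> wreg s 20 = x -> wreg s 21 = y ->
  wreg s p = g -> wreg s q = g' -> xreg s 0 = w ->
  beval M s (improvesE p q) = improves g g' x y.
Proof.
move=> c ex ey ep eq ew; have [b1 b2 b3 b4 b5] := bnds; rewrite /improves.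
have bxle s1 e1 e2 : beval M s1 (BXle e1 e2) = (xeval M s1 e1 <= xeval M s1 e2)%R by [].
have xadd s1 e1 e2 : xeval M s1 (XAdd e1 e2) = (xeval M s1 e1 + xeval M s1 e2)%R by [].
have bandE s1 e1 e2 : beval M s1 (BAnd e1 e2) = beval M s1 e1 && beval M s1 e2 by [].
have bnotE s1 e1 : beval M s1 (BNot e1) = ~~ beval M s1 e1 by [].
rewrite /improvesE !bandE bnotE bandE bxle !xadd.
have lt e1 v1 : weval M s e1 = v1 -> beval M s (BLt #0 e1) = (0 < v1).
  by move=> h; apply: blt => //; ev.
rewrite (lt _ (size (P x g))); last exact: (wsize c).
rewrite (lt _ (size (P g' y))); last exact: (wsize c).
rewrite (lt _ (size (P x y))); last exact: (wsize c).
case: (ltnP 0 (size (P x g))) => h1; last by [].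
case: (ltnP 0 (size (P g' y))) => h2; last by [].
case: (ltnP 0 (size (P x y))) => h3; last by [].
rewrite !andTb.
by rewrite (xdist c (ex := $20) (ey := $21) ex ey h3)
  (xdist c (ex := $20) (ey := $p) ex ep h1) (xdist c (ex := $q) (ey := $21) eq ey h2) /= ew.
Qed.

Lemma set_via_ok p q (g g' x y : 'I_n) s Q : ctx o s -> relax_args s ->
  wreg s 20 = x -> wreg s 21 = y -> p < 22 -> q < 22 ->
  wreg s p = g -> wreg s q = g' -> link g g' -> improves g g' x y ->
  (forall s', keeps 22 s s' -> wreg s' 22 = g -> wreg s' 23 = g' ->
     wreg s' 24 = size (newP x y) -> xreg s' 24 = newD x y -> Q s') ->
  ht (set_via p q) s Q.
Proof.
move=> c [a0 a1 a2 a3] ex ey p22 q22 ep eq l im H; have [b1 b2 b3 b4 b5] := bnds.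
have [eP eD] := newP_link l im; have sz := size_newP l im.
have [h1 h2 _] := and3P im.
have s1 := ps_size_le S x g; have s2 := ps_size_le S g' y.
apply: ht_seq; apply: (ht_wset (v := size (newP x y))).
  have -> : size (newP x y) = size (P x g) + size (P g' y) - (1 - lam).
    by rewrite sz; case: (lam).
  apply: wsub; [apply: wadd|apply: wsub|]; try lia.
  - exact: (wsize c).
  - exact: (wsize c).
  - by ev.
  - by ev.
set s3 := set_wreg _ _ _.
have k3 : keeps 22 s s3 by rewrite /s3; keeps_tac.
have c3 : ctx o s3 by apply: ctx_keeps k3 c.
have kk r : r < 22 -> wreg s3 r = wreg s r by exact: (kw k3).
apply: ht_seq; apply: (ht_xset (v := newD x y)).
  have xaddE e1 e2 v1 v2 : xeval M s3 e1 = v1 -> xeval M s3 e2 = v2 ->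
      xeval M s3 (XAdd e1 e2) = (v1 + v2)%R by move=> /= -> ->.
  rewrite eD; apply: (xaddE); first (apply: (xaddE); last by rewrite /= a3).
    by apply: (xdist c3) => //; rewrite -?ex -?ep; apply: kk.
  by apply: (xdist c3) => //; rewrite -?ey -?eq; apply: kk.
apply: ht_seq; apply: (ht_wset (v := g)); first by rewrite /= ?ifN; [rewrite -ep|lia].
apply: (ht_wset (v := g')); first by rewrite /= !ifN; [rewrite -eq|lia|lia].
by apply: H => //; rewrite /s3; keeps_tac.
Qed.

Lemma choose_ok (x y : 'I_n) s Q : ctx o s -> relax_args s -> wreg s 20 = x -> wreg s 21 = y ->
  (forall s' (c c' : 'I_n), keeps 22 s s' -> wreg s' 22 = c -> wreg s' 23 = c' ->
     wreg s' 24 = size (newP x y) -> (0 < size (newP x y) -> xreg s' 24 = newD x y) ->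
     route c c' x y -> (0 < size (newP x y) -> 0 < size (P x c) /\ 0 < size (P y c')) -> Q s') ->
  ht choose_route s Q.
Proof.
move=> c ra ex ey H; have [b1 b2 b3 b4 b5] := bnds; have [a0 a1 a2 a3] := ra.
apply: (ht_if (improvesE_ok c ex ey a0 a1 a3)) => im.
  have l : link a b by left.
  apply: (set_via_ok c ra ex ey _ _ a0 a1 l im) => // s' k e1 e2 e3 e4.
  apply: (H s' a b) => //; first by left.
  by move=> _; case/and3P: im => ? ? _; rewrite (ps_size_rev S b y).
apply: (ht_if (improvesE_ok c ex ey a1 a0 a3)) => im'.
  have l : link b a by right.
  apply: (set_via_ok c ra ex ey _ _ a1 a0 l im') => // s' k e1 e2 e3 e4.
  apply: (H s' b a) => //; first by left.
  by move=> _; case/and3P: im' => ? ? _; rewrite (ps_size_rev S a y).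
have rt : route y x x y by right; split=> // d d' [] [-> ->].
have [eP eD] : newP x y = P x y /\ newD x y = D x y.
  by rewrite /newP /newD (negbTE im) (negbTE im').
apply: ht_seq; apply: (ht_wset (v := size (P x y))); first exact: (wsize c).
set s1 := set_wreg _ _ _.
have k1 : keeps 22 s s1 by rewrite /s1; keeps_tac.
have c1 : ctx o s1 by apply: ctx_keeps k1 c.
apply: ht_seq; apply: (ht_xset (erefl _)).
set s2 := set_xreg _ _ _.
apply: ht_seq; apply: (ht_wset (v := y)); first by rewrite /s2 /s1; rd.
apply: (ht_wset (v := x)); first by rewrite /s2 /s1; rd.
apply: (H _ y x) => //.
- by rewrite /s2; keeps_tac.
- by rewrite eP.
- rewrite eP eD => h; transitivity (xeval M s1 (distE $20 $21)); first by [].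
  by apply: (xdist c1) => //; rewrite /s1; rd.
- by rewrite eP (ps_size_rev S x y).
Qed.

Section Entry.
Variables (x y c c' : 'I_n) (pl pr : nat).
Definition pair_regs s := [/\ ctx o s, relax_args s,
  [/\ wreg s 20 = x, wreg s 21 = y, wreg s 22 = c & wreg s 23 = c'] &
  [/\ wreg s 24 = size (newP x y), wreg s 27 = pl & wreg s 28 = pr]].

Hypotheses (rt : route c c' x y) (hxc : 0 < size (P x c)) (hyc : 0 < size (P y c'))
  (l0 : 0 < pl) (r0 : 0 < pr) (lr : pl + pr <= size (newP x y)).

Lemma pair_regs_keeps k s s' : 28 < k -> keeps k s s' -> pair_regs s -> pair_regs s'.
Proof.
move=> k28 ks [h1 h2 [h3 h4 h5 h6] [h7 h8 h9]]; split.
- by apply: ctx_keeps ks h1; apply: leq_trans k28.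
- by apply: relax_args_keeps ks h2; apply: leq_trans k28.
- by split; rewrite (kw ks) //; apply: leq_trans k28.
- by split; rewrite (kw ks) //; apply: leq_trans k28.
Qed.

Lemma newP_size_lt : size (newP x y) <= n.
Proof. exact: (ps_size_le (new_system wG S E)). Qed.

Lemma clip_x_ok q (z : 'I_n) s Q : pair_regs s -> q < 40 -> wreg s q = z ->
  (forall s', keeps 40 s s' ->
     good G K (seg (P x c) (pl - 1) (size (newP x y) - pr)) x z (oreg s' 45) -> Q s') ->
  ht (clip_x q) s Q.
Proof.
move=> [h1 h2 [h3 h4 h5 h6] [h7 h8 h9]] q40 eq H; have [b1 b2 b3 b4 b5] := bnds.
have sn := newP_size_lt.
apply: ht_args => [|s1 k1 a1 _]; first by rewrite /= q40.
have c1 : ctx o s1 by apply: ctx_keeps k1 h1.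
apply: (clip_ok c1 (x := x) (c := c) (z := z) (i := pl - 1) (j := size (newP x y) - pr)) => //.
- by arg a1 0.
- by arg a1 1.
- by arg a1 2.
- by arg a1 3; lia.
- by arg a1 4; lia.
- by move=> s2 k2 g; apply: H => //; keeps_tac.
Qed.

Lemma clip_y_ok q (z : 'I_n) s Q : pair_regs s -> q < 40 -> wreg s q = z ->
  (forall s', keeps 40 s s' ->
     good G K (seg (P y c') (pr - 1) (size (newP x y) - pl)) y z (oreg s' 45) -> Q s') ->
  ht (clip_y q) s Q.
Proof.
move=> [h1 h2 [h3 h4 h5 h6] [h7 h8 h9]] q40 eq H; have [b1 b2 b3 b4 b5] := bnds.
have sn := newP_size_lt.
apply: ht_args => [|s1 k1 a1 _]; first by rewrite /= q40.
have c1 : ctx o s1 by apply: ctx_keeps k1 h1.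
apply: (clip_ok c1 (x := y) (c := c') (z := z) (i := pr - 1) (j := size (newP x y) - pl)) => //.
- by arg a1 0.
- by arg a1 1.
- by arg a1 2.
- by arg a1 3; lia.
- by arg a1 4; lia.
- by move=> s2 k2 g; apply: H => //; keeps_tac.
Qed.

Lemma crossesE_ok s : pair_regs s ->
  beval M s crossesE = crosses c c' x y (pl - 1) (size (newP x y) - pr).
Proof.
move=> [h1 h2 [h3 h4 h5 h6] [h7 h8 h9]]; have [b1 b2 b3 b4 b5] := bnds.
have sn := newP_size_lt; have s1 := ps_size_le S x c; have s2 := ps_size_le S c' y.
rewrite /crosses [X in _ && (_ && X)]leqNgt; apply: band; [|apply: band; [|apply: bnot]].
- apply: beq; last by rd.
  by apply: wadd; [apply: (wsize h1)|apply: (wsize h1)|lia].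
- by apply: blt; [ev; lia|apply: (wsize h1)].
- by apply: blt; [ev; lia|apply: (wsize h1)].
Qed.

Lemma new_entry_ok s Q : pair_regs s ->
  (forall s', keeps 29 s s' -> good G' K'
     (seg (newP x y) (pl - 1) (size (newP x y) - pr)) x y (oreg s' 29) -> Q s') ->
  ht new_entry s Q.
Proof.
move=> pg H; have [cx [ra rb rl rw] [h20 h21 _ _] _] := pg.
pose F1 := seg (P x c) (pl - 1) (size (newP x y) - pr).
pose F2 := seg (P y c') (pr - 1) (size (newP x y) - pl).
have H' s' vxy vyx vxa vyb vxb vya : keeps 29 s s' ->
  good G K F1 x y vxy -> good G K F2 y x vyx ->
  (~~ crosses c c' x y (pl - 1) (size (newP x y) - pr) ->
     [/\ good G K F1 x a vxa, good G K F2 y b vyb,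
         good G K F1 x b vxb & good G K F2 y a vya]) ->
  oreg s' 29 = omin (omax vxy vyx)
    (if crosses c c' x y (pl - 1) (size (newP x y) - pr) then None
     else omin (oadd (oadd vxa (Some w)) vyb) (oadd (oadd vxb (Some w)) vya)) -> Q s'.
  move=> ks g1 g2 g3 e; apply: (H s' ks); rewrite e.
  have ei : (size (newP x y)).-1 - (size (newP x y) - pr) = pr - 1 by lia.
  have ej : (size (newP x y)).-1 - (pl - 1) = size (newP x y) - pl by lia.
  by apply: (new_interval_good wG S E rt) => //; rewrite ?ei ?ej //; lia.
apply: ht_seq; apply: (clip_x_ok pg _ h21) => // s1 k1 g1.
apply: ht_seq; apply: ht_copy => // s2 o2 v2.
have k2 : keeps 29 s s2 by keeps_tac.
have p2 : pair_regs s2 by apply: pair_regs_keeps k2 pg.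
apply: ht_seq; apply: (clip_y_ok p2 (z := x)) => // [|s3 k3 g3]; first by rd.
apply: ht_seq; apply: ht_max => // s4 o4.
rewrite (keeps_oreg k3) // v2 => v4.
have k4 : keeps 29 s s4 by keeps_tac.
have p4 : pair_regs s4 by apply: pair_regs_keeps k4 pg.
move: (oreg s1 45) (oreg s3 45) g1 g3 v4 => vxy vyx gxy gyx v4.
move: {s1 k1 s2 o2 v2 k2 p2 s3 k3 o4} s4 k4 p4 v4 => s1 k1 p1 v1.
apply: (ht_if (crossesE_ok p1)) => cr.
  apply: ht_skip; apply: (H' s1 _ _ None None None None _ gxy gyx) => //.
    by rewrite cr.
  by rewrite cr v1; case: (omax _ _).
have ww s' : keeps 29 s s' -> xreg s' 0 = w by move=> k; rewrite (kx k).
apply: ht_seq; apply: (clip_x_ok p1 (z := a)) => // [|s2 k2 g2]; first by rd.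
apply: ht_seq; apply: ht_copy => // s3 o3 v3.
apply: ht_seq; apply: (ht_addx (erefl _)) => s4 o4.
have -> : xeval M s3 (XReg 0) = w by rd.
rewrite v3 => v4.
have k4 : keeps 30 s1 s4 by keeps_tac.
have p4 : pair_regs s4 by apply: pair_regs_keeps k4 p1.
apply: ht_seq; apply: (clip_y_ok p4 (z := b)) => // [|s5 k5 g5]; first by rd.
apply: ht_seq; apply: ht_add => // s6 o6.
rewrite (keeps_oreg k5) // v4 => v6.
have k6 : keeps 30 s1 s6 by keeps_tac.
have p6 : pair_regs s6 by apply: pair_regs_keeps k6 p1.
move: (oreg s2 45) (oreg s5 45) g2 g5 v6 => vxa vyb gxa gyb v6.
move: {s2 k2 s3 o3 v3 s4 o4 v4 k4 p4 s5 k5 o6} s6 k6 p6 v6 => s2 k2 p2 v2.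
apply: ht_seq; apply: (clip_x_ok p2 (z := b)) => // [|s3 k3 g3]; first by rd.
apply: ht_seq; apply: ht_copy => // s4 o4 v4.
apply: ht_seq; apply: (ht_addx (erefl _)) => s5 o5.
have -> : xeval M s4 (XReg 0) = w by rd.
rewrite v4 => v5.
have k5 : keeps 31 s2 s5 by keeps_tac.
have p5 : pair_regs s5 by apply: pair_regs_keeps k5 p2.
apply: ht_seq; apply: (clip_y_ok p5 (z := a)) => // [|s6 k6 g6]; first by rd.
apply: ht_seq; apply: ht_add => // s7 o7.
rewrite (keeps_oreg k6) // v5 => v7.
have k7 : keeps 31 s2 s7 by keeps_tac.
have M1 : 1 < M by have [b1 b2 b3 b4 b5] := bnds; lia.
apply: ht_seq; apply: (ht_min M1) => // s8 o8.
rewrite v7 (keeps_oreg k7) // v2 => v8.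
have k8 : keeps 30 s1 s8 by keeps_tac.
apply: (ht_min M1) => // s9 o9; rewrite v8 (keeps_oreg k8) // v1 => v9.
apply: (H' s9 _ _ _ _ _ _ _ gxy gyx (fun _ => And4 gxa gyb g3 g6)); first by keeps_tac.
by rewrite v9 (negbTE cr).
Qed.

End Entry.

Let S' := new_system wG S E.

Definition rkeeps k s s' := (forall r, r < k -> wreg s' r = wreg s r) /\
  (forall r, r < k -> xreg s' r = xreg s r).

Lemma rkeeps_trans k k' s1 s2 s3 : k <= k' -> rkeeps k s1 s2 -> rkeeps k' s2 s3 -> rkeeps k s1 s3.
Proof.
move=> le [h1 h2] [h3 h4]; split=> r rk; first by rewrite h3 ?h1 //; lia.
by rewrite h4 ?h2 //; lia.
Qed.

Lemma keeps_rkeeps k s s' : keeps k s s' -> rkeeps k s s'.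
Proof. by case. Qed.

Definition same_mem (C : pred nat) s s' := forall A, ~~ C A ->
  wmem s' A = wmem s A /\ xmem s' A = xmem s A.

Lemma same_mem_trans C s1 s2 s3 : same_mem C s1 s2 -> same_mem C s2 s3 -> same_mem C s1 s3.
Proof. by move=> h1 h2 A nC; have [-> ->] := h2 A nC; apply: h1. Qed.

Lemma same_mem_sub (C C' : pred nat) s s' : (forall A, C A -> C' A) -> same_mem C s s' ->
  same_mem C' s s'.
Proof. by move=> sub h A nC; apply: h; apply: contra nC; apply: sub. Qed.

Lemma keeps_same_mem k C s s' : keeps k s s' -> same_mem C s s'.
Proof. by case=> _ _ h1 h2 A _; rewrite h1 h2. Qed.

Definition column (x y : 'I_n) : pred nat := fun A => [exists j : 'I_PP, A == addr n (o' + j) x y].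

Lemma column_mem (x y : 'I_n) j : j < PP -> column x y (addr n (o' + j) x y).
Proof. by move=> h; apply/existsP; exists (Ordinal h); rewrite eqxx. Qed.

Lemma column_other (x y u v : 'I_n) j : (u, v) <> (x, y) -> ~~ column x y (addr n j u v).
Proof.
move=> ne; apply/negP => /existsP[k /eqP e]; apply: ne.
have [_ e2 e3] := addr_inj (ltn_ord _) (ltn_ord _) (ltn_ord _) (ltn_ord _) e.
by rewrite (val_inj e2) (val_inj e3).
Qed.

Lemma column_old (x y u v : 'I_n) j : o <= j < o + PP -> ~~ column x y (addr n j u v).
Proof.
move=> hj; apply/negP => /existsP[k /eqP e].
have [e1 _ _] := addr_inj (ltn_ord _) (ltn_ord _) (ltn_ord _) (ltn_ord _) e.
have := ltn_ord k; case: o_base => eo; move: hj e1; rewrite eo; lia.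
Qed.

Lemma valid_lt m l r : m <= n -> 2 ^ l + 2 ^ r <= m -> l < L /\ r < L.
Proof.
move=> mn h; have := expn_gt0 2 l; have := expn_gt0 2 r => /= h1 h2.
have hm : m.-1 < n by lia.
have hl : 2 ^ l <= m.-1.+1 by lia.
have hr : 2 ^ r <= m.-1.+1 by lia.
by split; [exact: (log_lt hm hl)|exact: (log_lt hm hr)].
Qed.

Lemma entry_plane l r : l < L -> r < L -> 2 + (l * L + r) < PP.
Proof. by move=> hl hr; rewrite /planes; nia. Qed.

Lemma ctx_same_mem (x y : 'I_n) k s s' : 14 < k -> rkeeps k s s' -> same_mem (column x y) s s' ->
  ctx o s -> ctx o s'.
Proof.
move=> k14 [h1 _] sm [[e1 e2 e3 e4 e5] t]; have [b1 b2 b3 b4 b5] := bnds; split.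
  by split; rewrite h1 //; apply: leq_trans k14.
move=> u v; have [t1 t2 t3 t4] := t u v.
have sm' j : o <= j < o + PP -> wmem s' (addr n j u v) = wmem s (addr n j u v) /\
    xmem s' (addr n j u v) = xmem s (addr n j u v).
  by move=> hj; apply: sm; apply: column_old.
split.
- by have [-> _] := sm' o (ltac:(lia)).
- by have [_ ->] := sm' o (ltac:(lia)).
- by have [-> _] := sm' (o + 1) (ltac:(lia)).
- move=> l r lr; have [hl hr] := valid_lt (ps_size_le S u v) lr.
  have := entry_plane hl hr => ep.
  by have [-> ->] := sm' (o + (2 + (l * L + r))) (ltac:(lia)); apply: t4.
Qed.

Lemma entries_same_mem (x y u v : 'I_n) s s' : (u, v) <> (x, y) -> same_mem (column x y) s s' ->
  entries L G' K' newP newD o' s u v -> entries L G' K' newP newD o' s' u v.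
Proof.
move=> ne sm [t1 t2 t3 t4].
have sm' j : wmem s' (addr n j u v) = wmem s (addr n j u v) /\
    xmem s' (addr n j u v) = xmem s (addr n j u v) by apply: sm; apply: column_other.
split.
- by have [-> _] := sm' o'.
- by have [_ ->] := sm' o'.
- by have [-> _] := sm' (o' + 1).
- by move=> l r lr; have [-> ->] := sm' (o' + (2 + (l * L + r))); apply: t4.
Qed.

Section Pair.
Variables (x y : 'I_n).

Lemma store_ok ej j r s Q : ctx o s -> wreg s 20 = x -> wreg s 21 = y -> j < PP ->
  (forall s', wreg s' = wreg s -> weval M s' ej = j) ->
  (forall s', wreg s' = wreg s -> xreg s' = xreg s ->
     same_mem (pred1 (addr n (o' + j) x y)) s s' ->
     wmem s' (addr n (o' + j) x y) = wreg s r ->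
     xmem s' (addr n (o' + j) x y) = xreg s r -> Q s') ->
  ht (c_store ej r) s Q.
Proof.
move=> c e20 e21 jP ej_ok H; have [b1 b2 b3 b4 b5] := bnds.
have ec s' : wreg s' = wreg s -> weval M s' (cell ($12 -' $14 +' ej) $20 $21) = addr n (o' + j) x y.
  move=> es; apply: wcell; rewrite ?ltn_ord //; try by rewrite /= es.
  - by rewrite es; apply: regs10 c.
  - apply: wadd; [apply: wsub|exact: ej_ok|]; try lia.
      by rewrite /= es; apply: regs12 c.
    by rewrite /= es; apply: regs14 c.
  - by lia.
have lt : addr n (o' + j) x y < Sp.
  by rewrite /mem_size; apply: addr_lt; rewrite ?ltn_ord //; lia.
apply: ht_seq; apply: (ht_wstore (ec _ erefl) (erefl _) lt).
apply: (ht_xstore (ec _ _) (erefl _) lt) => //.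
apply: H => //=; rewrite ?eqxx //.
by move=> A; rewrite /= => /negbTE ->.
Qed.

Variables (c c' : 'I_n).
Hypotheses (rt : route c c' x y) (hP : 0 < size (newP x y)).
Hypotheses (hxc : 0 < size (P x c)) (hyc : 0 < size (P y c')).

Lemma newP_size_le : size (newP x y) <= n.
Proof. exact: (ps_size_le S' x y). Qed.

Lemma nth_newP m : m < size (newP x y) -> nth x (newP x y) m =
  if m < size (P x c) then nth x (P x c) m
  else nth y (P y c') (size (newP x y) - 1 - m).
Proof.
move=> hm; case: rt => [[l im]|[cy c'x ni]]; last first.
  case: (newP_cases x y) => [[d [d' [l im]]]|[_ e _]].
    by move: (ni _ _ l); rewrite im.
  by rewrite cy -e hm.
have [eP _] := newP_link l im.
case: ltnP => h; first by rewrite eP nth_cat h.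
have im' : improves c' c y x by rewrite -improves_sym.
have [eP' _] := newP_link (link_sym l) im'; have sz := size_newP l im.
have -> : nth y (P y c') (size (newP x y) - 1 - m) = nth y (newP y x) (size (newP x y) - 1 - m).
  rewrite eP' nth_cat ifT // (ps_size_rev S c' y).
  by have := leq_b1 (~~ lam); move: sz => /= sz; lia.
rewrite (newP_rev x y) nth_rev; last by lia.
rewrite (_ : size _ - _ = m); last by lia.
exact: set_nth_default.
Qed.

Lemma new_mid_ok s Q : ctx o s -> wreg s 20 = x -> wreg s 21 = y -> wreg s 22 = c ->
  wreg s 23 = c' -> wreg s 24 = size (newP x y) ->
  (forall s', rkeeps 25 s s' -> same_mem (pred1 (addr n (o' + 1) x y)) s s' ->
     wmem s' (addr n (o' + 1) x y) = nth x (newP x y) ((size (newP x y)).-1 %/ 2) -> Q s') ->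
  ht new_mid s Q.
Proof.
move=> cx e0 e1 e2 e3 e4 H; have [b1 b2 b3 b4 b5] := bnds.
have sn := newP_size_le.
set m := (size (newP x y)).-1 %/ 2.
apply: ht_seq; apply: (ht_wset (v := m)).
  by rewrite /m -subn1; ev; lia.
set s1 := set_wreg _ _ _.
have k1 : keeps 25 s s1 by rewrite /s1; keeps_tac.
have c1 : ctx o s1 by apply: ctx_keeps k1 cx.
have mlt : m < size (newP x y) by rewrite /m; lia.
have rest s2 : keeps 25 s s2 -> wreg s2 90 = nth x (newP x y) m -> ht (c_store #1 90) s2 Q.
  move=> k2 e90; have c2 : ctx o s2 by apply: ctx_keeps k2 cx.
  apply: (store_ok (j := 1) c2); [by rd|by rd|lia|by move=> s' _; ev|].
  move=> s3 r3 x3 sm e _; apply: H.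
  - have [h1 h2] := keeps_rkeeps k2; split=> r hr; rewrite ?r3 ?x3; [exact: h1|exact: h2].
  - by apply: same_mem_trans sm; apply: keeps_same_mem k2.
  - by rewrite e e90.
apply: ht_seq; apply: (ht_if (v := m < size (P x c))).
  by apply: blt; [by rewrite /s1; rd|apply: (wsize c1); rewrite /s1; rd].
- move=> lt; apply: ht_args => // s2 k2 a2 _.
  have c2 : ctx o s2 by apply: ctx_keeps k2 c1.
  apply: (anc_ok c2 (x := x) (y := c) (m := m)) => //.
  + by arg a2 0; rewrite /s1; rd.
  + by arg a2 1; rewrite /s1; rd.
  + by arg a2 2; rewrite /s1; rd.
  move=> s3 k3 e90; apply: rest; first by keeps_tac.
  by rewrite e90 nth_newP // lt.
- rewrite -leqNgt => le; apply: ht_args => // s2 k2 a2 _.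
  have c2 : ctx o s2 by apply: ctx_keeps k2 c1.
  apply: (anc_ok c2 (x := y) (y := c') (m := size (newP x y) - 1 - m)) => //.
  + by arg a2 0; rewrite /s1; rd.
  + by arg a2 1; rewrite /s1; rd.
  + by arg a2 2; rewrite /s1; rd; lia.
  + case: rt => [[l im]|[cy _ ni]].
      have sz := size_newP l im; rewrite (ps_size_rev S c' y).
      by have := leq_b1 (~~ lam); move: sz => /= sz; lia.
    case: (newP_cases x y) => [[d [d' [l im]]]|[_ e _]].
      by move: (ni _ _ l); rewrite im.
    by rewrite cy -e in le; lia.
  move=> s3 k3 e90; apply: rest; first by keeps_tac.
  by rewrite e90 nth_newP // ltnNge le.
Qed.

Definition new_good s l r := good G' K'
  (seg (newP x y) (2 ^ l - 1) (size (newP x y) - 2 ^ r)) x y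
  (oval (wmem s (addr n (o' + (2 + (l * L + r))) x y))
        (xmem s (addr n (o' + (2 + (l * L + r))) x y))).

Definition table_cells : pred nat := fun A =>
  [exists j : 'I_(L * L), A == addr n (o' + (2 + j)) x y].

Lemma table_cells_mem l r : l < L -> r < L ->
  table_cells (addr n (o' + (2 + (l * L + r))) x y).
Proof.
move=> hl hr; have h : l * L + r < L * L by nia.
by apply/existsP; exists (Ordinal h); rewrite eqxx.
Qed.

Lemma new_table_ok s Q : ctx o s -> relax_args s -> wreg s 20 = x -> wreg s 21 = y ->
  wreg s 22 = c -> wreg s 23 = c' -> wreg s 24 = size (newP x y) ->
  (forall s', rkeeps 25 s s' -> same_mem table_cells s s' ->
     (forall l r, 2 ^ l + 2 ^ r <= size (newP x y) -> new_good s' l r) -> Q s') ->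
  ht new_table s Q.
Proof.
move=> cx ra e0 e1 e2 e3 e4 H; have [b1 b2 b3 b4 b5] := bnds.
have sn := newP_size_le.
have tc A : table_cells A -> column x y A.
  case/existsP=> j /eqP ->; apply: column_mem; rewrite /planes.
  by have := ltn_ord j; lia.
have ctx_of s' : rkeeps 25 s s' -> same_mem table_cells s s' -> ctx o s'.
  by move=> h1 h2; apply: (ctx_same_mem _ h1 (same_mem_sub tc h2) cx).
have ra_of s' : rkeeps 25 s s' -> relax_args s'.
  by move=> [h1 h2]; case: ra => *; split; rewrite ?h1 ?h2.
have M1 : 1 < M by lia.
have rset s1 r v : 25 <= r -> rkeeps 25 s s1 -> rkeeps 25 s (set_wreg s1 r v).
  move=> r25 h; apply: (rkeeps_trans (leqnn 25) h); apply: keeps_rkeeps.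
  by apply: keeps_wset; [exact: r25|exact: keeps_refl].
apply: ht_seq; apply: (ht_wset (v := 1)); first by ev.
apply: (ht_for (N := L) (Inv := fun i s' => [/\ rkeeps 25 s s', same_mem table_cells s s',
  wreg s' 27 = 2 ^ i & forall l r, l < i -> 2 ^ l + 2 ^ r <= size (newP x y) -> new_good s' l r]))
  => //; try lia.
- by move=> i s' [h1 h2 _ _]; apply: regs11 (ctx_of _ h1 h2).
- by split=> //; do 2!(apply: (rset) => //).
- move=> i s1 iL ei [h1 h2 h3 h4].
  apply: ht_seq; apply: (ht_wset (v := 1)); first by ev.
  apply: ht_seq.
  apply: (ht_for (N := L) (Inv := fun j s' => [/\ rkeeps 25 s s', same_mem table_cells s s',
    [/\ wreg s' 25 = i, wreg s' 27 = 2 ^ i & wreg s' 28 = 2 ^ j] &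
    forall l r, l < i \/ l = i /\ r < j -> 2 ^ l + 2 ^ r <= size (newP x y) -> new_good s' l r]))
    => //; try lia.
  + by move=> j s' [g1 g2 _ _]; apply: regs11 (ctx_of _ g1 g2).
  + split=> //; first by do 2!(apply: (rset) => //).
    by move=> l r [|[_]] // li; apply: h4.
  + move=> j s2 jL ej [g1 g2 [g3 g4 g5] g6].
    have pi0 : 0 < 2 ^ i by rewrite expn_gt0.
    have pj0 : 0 < 2 ^ j by rewrite expn_gt0.
    have iL2 : 2 ^ i < 2 ^ L by rewrite ltn_exp2l.
    have jL2 : 2 ^ j < 2 ^ L by rewrite ltn_exp2l.
    have c2 := ctx_of _ g1 g2; have ra2 := ra_of _ g1; have [w1 x1] := g1.
    have next s3 : rkeeps 28 s2 s3 -> wreg s3 28 = 2 ^ j -> same_mem table_cells s s3 ->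
      (forall l r, l < i \/ l = i /\ r < j.+1 -> 2 ^ l + 2 ^ r <= size (newP x y) -> new_good s3 l r) ->
      ht (WSet 28 ($28 +' $28)) s3 (fun s4 => wreg s4 26 = j /\
         [/\ rkeeps 25 s (set_wreg s4 26 j.+1), same_mem table_cells s (set_wreg s4 26 j.+1),
          [/\ wreg (set_wreg s4 26 j.+1) 25 = i, wreg (set_wreg s4 26 j.+1) 27 = 2 ^ i &
              wreg (set_wreg s4 26 j.+1) 28 = 2 ^ j.+1] &
          forall l r, l < i \/ l = i /\ r < j.+1 -> 2 ^ l + 2 ^ r <= size (newP x y) ->
            new_good (set_wreg s4 26 j.+1) l r]).
      move=> rk e28 sm ng; apply: (ht_wset (v := 2 ^ j + 2 ^ j)).
        by apply: wadd => //; lia.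
      have [k1 k2] := rk; split; first by rewrite /= k1.
      split=> //; first by do 2!(apply: (rset) => //); apply: rkeeps_trans g1 rk.
      by split; rewrite /= ?k1 //= expnS mul2n -addnn.
    apply: ht_seq; apply: (ht_if (v := size (newP x y) < 2 ^ i + 2 ^ j)).
      by apply: blt; [rewrite /= w1|apply: wadd => //; lia].
    * move=> inv; apply: ht_skip; apply: next => // l r lr v.
      case: (ltnP l i) => li; first by apply: g6 => //; left.
      case: lr => [|[el rj]]; first by lia.
      move: rj; rewrite ltnS leq_eqVlt => /orP[/eqP er|rj].
        by move: v inv; rewrite el er; lia.
      by apply: g6 => //; right.
    * rewrite -leqNgt => val_ij.
      have pg : pair_regs x y c c' (2 ^ i) (2 ^ j) s2.
        by split=> //; split=> //; rewrite w1.
      apply: ht_seq; apply: (new_entry_ok (x := x) (y := y) (c := c) (c' := c')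
        (pl := 2 ^ i) (pr := 2 ^ j)) => // s3 k3 gd.
      have ep := entry_plane iL jL.
      have c3 : ctx o s3 by apply: ctx_keeps k3 c2.
      have llr : i * L + j < L * L by nia.
      apply: (store_ok (j := 2 + (i * L + j)) c3) => //.
      - by rd; rewrite w1.
      - by rd; rewrite w1.
      - move=> s4 e; apply: wadd; [by ev|apply: wadd; [apply: wmul| |]|]; try lia.
        + by rewrite /= e; rd.
        + by rewrite /= e; apply: regs11 c3.
        + by rewrite /= e; rd.
      move=> s4 r4 x4 sm4 ew ex.
      have sm34 : same_mem table_cells s2 s4.
        apply: (same_mem_trans (@keeps_same_mem _ table_cells _ _ k3)).
        by apply: same_mem_sub sm4 => A /eqP ->; apply: table_cells_mem.
      apply: next.
      - by split=> r hr; rewrite ?r4 ?x4; rewrite ?(kw k3) ?(kx k3) //; lia.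
      - by rewrite r4; rd.
      - exact: same_mem_trans g2 sm34.
      move=> l r lr v; have [lL rL] := valid_lt sn v.
      case: (boolP ((l == i) && (r == j))) => [/andP[/eqP -> /eqP ->]|ne].
        by rewrite /new_good ew ex; apply: gd.
      have ng : new_good s2 l r.
        by apply: g6 => //; case: lr => [|[el rj]]; [left|right; split=> //; move: ne; rewrite el eqxx /=; lia].
      have nA : ~~ pred1 (addr n (o' + (2 + (i * L + j))) x y) (addr n (o' + (2 + (l * L + r))) x y).
        apply: contra ne => /eqP eA.
        have [e _ _] := addr_inj (ltn_ord _) (ltn_ord _) (ltn_ord _) (ltn_ord _) eA.
        have e' : l * L + r = i * L + j by lia.
        have := congr1 (divn^~ L) e'; have := congr1 (modn^~ L) e'.
        have L0 := L_gt0.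
        rewrite !modnMDl !modn_small // !divnMDl // !divn_small // !addn0 => -> ->.
        by rewrite !eqxx.
      by rewrite /new_good; have [-> ->] := sm4 _ nA; rewrite (kwm k3) (kxm k3).
  move=> s2 [g1 g2 [g3 g4 g5] g6].
  have iL2 : 2 ^ i < 2 ^ L by rewrite ltn_exp2l.
  apply: (ht_wset (v := 2 ^ i + 2 ^ i)); first by apply: wadd => //; lia.
  split=> //; split=> //.
  + by do 2!(apply: (rset) => //).
  + by rewrite /= expnS mul2n -addnn.
  + move=> l r li v; apply: g6 => //; have [lL rL] := valid_lt sn v.
    by move: li; rewrite ltnS leq_eqVlt => /orP[/eqP|]; auto.
move=> s' [h1 h2 _ h4]; apply: H => // l r v.
by have [lL rL] := valid_lt sn v; apply: h4.
Qed.

End Pair.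

Lemma relax_pair_ok (x y : 'I_n) s Q : ctx o s -> relax_args s -> wreg s 20 = x -> wreg s 21 = y ->
  (forall s', rkeeps 22 s s' -> same_mem (column x y) s s' ->
     entries L G' K' newP newD o' s' x y -> Q s') ->
  ht relax_pair s Q.
Proof.
move=> cx ra e0 e1 H; have [b1 b2 b3 b4 b5] := bnds.
apply: ht_seq; apply: (choose_ok cx ra e0 e1) => s1 c c' k1 f2 f3 f4 f5 rt hpos.
have c1 : ctx o s1 by apply: ctx_keeps k1 cx.
have ra1 : relax_args s1 by apply: relax_args_keeps k1 ra.
have f0 : wreg s1 20 = x by rd.
have f1 : wreg s1 21 = y by rd.
apply: ht_seq; apply: (store_ok (j := 0) c1 f0 f1); [lia|by move=> s' _; ev|].
rewrite addn0 => s2 r2 x2 sm2 ew ex.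
have cell0 : same_mem (column x y) s1 s2.
  apply: same_mem_sub sm2 => A /eqP ->.
  by rewrite -[o' in addr _ o']addn0; apply: column_mem; lia.
have rk1 : rkeeps 22 s s1 by apply: keeps_rkeeps.
have rk2 : rkeeps 25 s1 s2 by split=> r _; rewrite ?r2 ?x2.
have smA : same_mem (column x y) s s2 by apply: (same_mem_trans (@keeps_same_mem _ (column x y) _ _ k1)).
have c2 : ctx o s2 by apply: (ctx_same_mem _ rk2 cell0 c1).
apply: (ht_if (v := 0 < size (newP x y))).
  by apply: blt; [ev|rewrite /= r2].
- move=> hp; have [hxc hyc] := hpos hp.
  apply: ht_seq; apply: (new_mid_ok rt hp hxc hyc c2); rewrite ?r2 //.
  move=> s3 rk3 sm3 em.
  have sm3' : same_mem (column x y) s2 s3.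
    by apply: same_mem_sub sm3 => A /eqP ->; apply: column_mem; lia.
  have c3 : ctx o s3 by apply: (ctx_same_mem _ rk3 sm3' c2).
  have [w3 x3] := rk3.
  apply: (new_table_ok rt hp hxc hyc c3); rewrite ?w3 ?r2 //.
    by case: ra1 => *; split; rewrite ?w3 ?x3 ?r2 ?x2.
  move=> s4 rk4 sm4 tb.
  have sm4' : same_mem (column x y) s3 s4.
    apply: same_mem_sub sm4 => A /existsP[j /eqP ->]; apply: column_mem.
    by have := ltn_ord j; rewrite /planes; lia.
  have nt j : j < 2 -> ~~ table_cells x y (addr n (o' + j) x y).
    move=> j2; apply/negP => /existsP[k /eqP e].
    by have [e' _ _] := addr_inj (ltn_ord _) (ltn_ord _) (ltn_ord _) (ltn_ord _) e; lia.
  have n1 : ~~ pred1 (addr n (o' + 1) x y) (addr n o' x y).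
    apply/negP => /eqP e.
    by have [e' _ _] := addr_inj (ltn_ord _) (ltn_ord _) (ltn_ord _) (ltn_ord _) e; lia.
  have [] := sm4 _ (nt 0 isT); rewrite addn0 => m40 x40.
  have [m41 _] := sm4 _ (nt 1 isT).
  have [m30 x30] := sm3 _ n1.
  apply: H.
  - apply: (rkeeps_trans (leqnn 22) rk1).
    have rk25 : rkeeps 25 s1 s4.
      by apply: (rkeeps_trans _ rk2 (rkeeps_trans _ rk3 rk4)).
    by case: rk25 => h1 h2; split=> r hr; [apply: h1|apply: h2]; lia.
  - exact: (same_mem_trans smA (same_mem_trans sm3' sm4')).
  - split.
    + by rewrite m40 m30 ew f4.
    + by move=> _; rewrite x40 x30 ex f5.
    + by move=> _; rewrite m41 em.
    + exact: tb.
- rewrite -leqNgt leqn0 => /eqP hp; apply: ht_skip; apply: H => //.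
  + have [h1 h2] := rk1; split=> r hr; first by rewrite r2 h1.
    by rewrite x2 h2.
  + split; rewrite ?hp //; first by rewrite ew f4.
    by move=> l r; have := expn_gt0 2 l; move=> /= ? ?; lia.
Qed.

Lemma relax_ok s Q : ctx o s -> relax_args s ->
  (forall s', machine_ok L G' K' newP newD o' s' ->
    (forall r, r < 20 -> r != 14 -> wreg s' r = wreg s r) ->
    (forall r, r < 20 -> xreg s' r = xreg s r) -> Q s') ->
  ht relax s Q.
Proof.
move=> cx ra H; have [b1 b2 b3 b4 b5] := bnds.
have ra_of s' : rkeeps 20 s s' -> relax_args s'.
  by move=> [h1 h2]; case: ra => *; split; rewrite ?h1 ?h2.
have rset s1 r v : 20 <= r -> rkeeps 20 s s1 -> rkeeps 20 s (set_wreg s1 r v).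
  move=> r20 h; apply: (rkeeps_trans (leqnn 20) h); apply: keeps_rkeeps.
  by apply: keeps_wset; [exact: r20|exact: keeps_refl].
have cset s1 r v : 20 <= r -> ctx o s1 -> ctx o (set_wreg s1 r v).
  move=> r20 h; have k : keeps 20 s1 (set_wreg s1 r v).
    by apply: keeps_wset; [exact: r20|exact: keeps_refl].
  by apply: ctx_keeps k h.
pose done_ s' (u v : 'I_n) := entries L G' K' newP newD o' s' u v.
have M1 : 1 < M by lia.
have NM : n < M by lia.
apply: ht_seq.
apply: (ht_for (N := n) (Inv := fun i s' => [/\ rkeeps 20 s s', ctx o s' &
  forall u v : 'I_n, u < i -> done_ s' u v])) => //.
- by move=> i s' [_ h _]; apply: regs10 h.
- by split=> //; apply: (rset).
- move=> i s1 hi ei [h1 h2 h3].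
  apply: (ht_for (N := n) (Inv := fun j s' => [/\ rkeeps 20 s s', ctx o s', wreg s' 20 = i &
    forall u v : 'I_n, u < i \/ val u = i /\ v < j -> done_ s' u v])) => //.
  + by move=> j s' [_ h _ _]; apply: regs10 h.
  + split=> //; first by apply: (rset).
    by move=> u v [|[_]] // ui; apply: h3.
  + move=> j s2 hj ej [g1 g2 g3 g4].
    have ra2 := ra_of _ g1.
    apply: (relax_pair_ok (x := Ordinal hi) (y := Ordinal hj) g2 ra2) => // s3 rk sm en.
    have [k1 k2] := rk.
    have rk' : rkeeps 20 s s3.
      by have [p1 p2] := g1; split=> r hr; rewrite ?k1 ?k2 ?p1 ?p2 //; lia.
    have c3 : ctx o s3 by apply: (ctx_same_mem _ rk sm g2).
    split; first by rewrite k1.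
    split; [by apply: (rset)|by apply: (cset)|by rewrite /= k1|].
    move=> u v uv; case: (eqVneq (u, v) (Ordinal hi, Ordinal hj)) => [[-> ->] //|ne].
    have : done_ s2 u v.
      apply: g4; case: uv => [|[eu vj]]; [by left|right; split=> //].
      move: vj; rewrite ltnS leq_eqVlt => /orP[/eqP ev|//].
      by case/eqP: ne; congr (_, _); apply: val_inj.
    by apply: (entries_same_mem _ sm); apply/eqP.
  move=> s2 [g1 g2 g3 g4]; split=> //; split; [by apply: (rset)|by apply: (cset)|].
  move=> u v; rewrite ltnS leq_eqVlt => /orP[/eqP|] h; apply: g4; [by right|by left].
move=> s1 [h1 h2 h3]; apply: (ht_wset (v := o')).
  apply: wsub; [exact: regs12 h2|exact: regs14 h2|lia].
have [p1 p2] := h1; apply: H.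
- split; last by move=> u v; apply: h3.
  by case: h2 => [[q1 q2 q3 q4 q5] _]; split.
- by move=> r r20 r14; rewrite /= (negbTE r14) p1.
- by move=> r r20; rewrite /= p2.
Qed.

End Relaxation.
End Tables.

Section Build.
Lemma init_registers_ok s Q : wreg s 0 = n ->
  (forall s', wmem s' = wmem s -> xmem s' = xmem s -> regs_ok n L 0 s' -> Q s') ->
  ht init_registers s Q.
Proof.
move=> e0 H; have [b1 b2 b3 b4 b5] := bnds; have M1 : 1 < M by lia.
apply: ht_seq; apply: (ht_wset (v := n)); first by rd.
apply: ht_seq; apply: (ht_wset (v := 0)); first by ev.
apply: ht_seq; apply: (ht_wset (v := 1)); first by ev.
apply: ht_seq; apply: (ht_for (N := n) (Inv := fun i s' => [/\ wmem s' = wmem s, xmem s' = xmem s,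
  wreg s' 10 = n & exists l, [/\ wreg s' 11 = l, wreg s' 13 = 2 ^ l,
    l = 0 \/ 2 ^ l.-1 <= n & n < 2 ^ l \/ l = i]])) => //; try lia.
- by move=> i s' [].
- by split=> //; exists 0; split; auto.
- move=> i s' hi ei [m x e10 [l [e11 e13 lo hi']]].
  have lL : l <= L.
    case: lo => [->|lo] //; rewrite leqNgt; apply/negP => lt.
    have : 2 ^ L <= 2 ^ l.-1 by rewrite leq_exp2l //; lia.
    by lia.
  have pL : 2 ^ l <= 2 ^ L by rewrite leq_exp2l.
  apply: (ht_if (v := n < 2 ^ l)); first by apply: blt; rd.
    move=> lt; apply: ht_skip; split=> //; split=> //.
    by exists l; split=> //; left.
  rewrite -leqNgt => le; apply: ht_seq; apply: (ht_wset (v := 2 ^ l + 2 ^ l)).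
    by apply: wadd => //; lia.
  apply: (ht_wset (v := l + 1)); first by ev; lia.
  split=> //; split=> //; exists (l + 1); split=> //.
  - by rewrite /= addn1 expnS mul2n -addnn.
  - by right; rewrite addn1.
  - by right; case: hi' => h; lia.
move=> s' [m x e10 [l [e11 e13 lo hi]]].
have lt_l : n < 2 ^ l by case: hi => // ->; apply: ltn_expl.
have eL : l = L.
  apply/eqP; rewrite eqn_leq; apply/andP; split.
    case: lo => [->|lo] //; rewrite leqNgt; apply/negP => lt.
    have : 2 ^ L <= 2 ^ l.-1 by rewrite leq_exp2l //; lia.
    by lia.
  rewrite leqNgt; apply/negP => lt.
  have : 2 ^ l.+1 <= 2 ^ L by rewrite leq_exp2l.
  by rewrite expnS; lia.
apply: ht_seq; apply: (ht_wset (v := PP)).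
  rewrite /planes; apply: wadd; [by ev|apply: wmul|]; rewrite /planes in b1 b2; try lia.
  - by rewrite /= e11 eL.
  - by rewrite /= e11 eL.
apply: (ht_wset (v := 0)); first by ev.
by apply: H => //; split; rewrite /= ?e11 ?e13 ?eL.
Qed.

Variables (G : wgraph R n).
Hypothesis (wG : is_wgraph G).

Lemma matrix_entry_addr (x y : 'I_n) : matrix_entry G (addr n 0 x y) = G x y.
Proof.
rewrite /matrix_entry /addr mul0n add0n divnMDl // divn_small // addn0 modnMDl modn_small //.
by rewrite !valK.
Qed.

Lemma matrix_entry_out j (x y : 'I_n) : 0 < j -> matrix_entry G (addr n j x y) = None.
Proof.
move=> j0; rewrite /matrix_entry /addr divnMDl // divn_small // addn0.
by rewrite insubN // -leqNgt; nia.
Qed.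

Definition below (i : nat) : pred 'I_n := fun v => v < i.

Lemma init_tables_ok s Q : regs_ok n L 0 s ->
  wmem s = wmem (input_state G) -> xmem s = xmem (input_state G) ->
  (forall s', machine_ok L G (below 0) (edgeP G) (edgeD G) 0 s' -> Q s') ->
  ht (For 20 10 (For 21 10 init_pair)) s Q.
Proof.
move=> rs em ex H; have [b1 b2 b3 b4 b5] := bnds; have M1 : 1 < M by lia.
have NM : n < M by lia.
pose Inv (done_ : 'I_n -> 'I_n -> bool) s' := [/\ regs_ok n L 0 s', xmem s' = xmem s,
  forall j (u v : 'I_n), 1 < j -> wmem s' (addr n j u v) = 0 &
  forall u v : 'I_n, if done_ u v then
       wmem s' (addr n 0 u v) = size (edgeP G u v) /\ wmem s' (addr n 1 u v) = u
     else wmem s' (addr n 0 u v) = isSome (G u v)].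
apply: (ht_for (N := n) (Inv := fun i s' => Inv (fun u v => u < i) s')) => //.
- by move=> i s' [[]].
- split=> //.
  + by move=> j u v j1; rewrite /= em /= matrix_entry_out //; lia.
  + by move=> u v; rewrite /= em /= matrix_entry_addr.
- move=> i s1 hi ei I1.
  apply: (ht_for (N := n) (Inv := fun j s' => wreg s' 20 = i /\
    Inv (fun u v => (u < i) || ((val u == i) && (v < j))) s')) => //.
  + by move=> j s' [_ [[]]].
  + split=> //; case: I1 => h1 h2 h3 h4; split=> //.
    by move=> u v; rewrite ltn0 andbF orbF; apply: h4.
  + move=> j s2 hj ej [e20 [h1 h2 h3 h4]].
    pose x := Ordinal hi; pose y := Ordinal hj.
    have [q1 q2 q3 q4 q5] := h1.
    have lt0 : addr n 0 x y < Sp by rewrite /mem_size; apply: addr_lt; rewrite ?ltn_ord //; lia.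
    have lt1 : addr n 1 x y < Sp by rewrite /mem_size; apply: addr_lt; rewrite ?ltn_ord //; lia.
    have wc s' : wreg s' = wreg s2 -> weval M s' (cell $14 $20 $21) = addr n 0 x y.
      by move=> es; apply: wcell; rewrite ?ltn_ord //= ?es // ; lia.
    have wc1 s' : wreg s' = wreg s2 -> weval M s' (cell ($14 +' #1) $20 $21) = addr n 1 x y.
      move=> es; apply: wcell; rewrite ?ltn_ord ?es //; try by rewrite /= es.
      - by rewrite -[1]add0n; apply: wadd; [rewrite /= es|ev|lia].
    have rest s3 : wreg s3 = wreg s2 -> xmem s3 = xmem s2 ->
       (forall A, A != addr n 0 x y -> wmem s3 A = wmem s2 A) ->
       wmem s3 (addr n 0 x y) = size (edgeP G x y) ->
       ht (WStore (cell ($14 +' #1) $20 $21) $20) s3 (fun s4 => wreg s4 21 = j /\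
         wreg (set_wreg s4 21 j.+1) 20 = i /\
         Inv (fun u v => (u < i) || ((val u == i) && (v < j.+1))) (set_wreg s4 21 j.+1)).
      move=> r3 x3 m3 e3; apply: (ht_wstore (wc1 _ r3) (v := x)) => //.
        by rewrite /= r3.
      split; first by rewrite /= r3.
      split; first by rewrite /= r3.
      split.
      - by split; rewrite /= r3.
      - by rewrite /= x3.
      - move=> k u v k1; rewrite /= ifN; first rewrite m3; first exact: h3.
          apply/negP => /eqP e.
          by have [e' _ _] := addr_inj (ltn_ord u) hi (ltn_ord v) hj e; lia.
        apply/negP => /eqP e.
        by have [e' _ _] := addr_inj (ltn_ord u) hi (ltn_ord v) hj e; lia.
      - move=> u v; have n01 : (addr n 0 u v == addr n 1 x y) = false.
          apply/negP => /eqP e.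
          by have [e' _ _] := addr_inj (ltn_ord u) hi (ltn_ord v) hj e; lia.
        rewrite /= n01; case: (eqVneq (u, v) (x, y)) => [[-> ->]|ne].
          by rewrite /= eqxx ltnSn orbT eqxx e3.
        have ne0 k : addr n k u v != addr n k x y.
          apply: contra ne => /eqP e.
          have [_ e1 e2] := addr_inj (ltn_ord u) hi (ltn_ord v) hj e.
          by apply/eqP; congr (_, _); apply: val_inj.
        have n10 : addr n 1 u v != addr n 0 x y.
          apply/negP => /eqP e.
          by have [e' _ _] := addr_inj (ltn_ord u) hi (ltn_ord v) hj e; lia.
        rewrite (negbTE (ne0 1)) !m3 //; have := h4 u v.
        suff -> : (u < i) || (val u == i) && (v < j) = (u < i) || (val u == i) && (v < j.+1) by [].
        congr (_ || _); case: (eqVneq (val u) i) => // eu; rewrite !andTb [v < j.+1]ltnS [v <= j]leq_eqVlt.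
        case: (eqVneq (val v) j) => // ev; case/eqP: ne.
        by congr (_, _); apply: val_inj.
    apply: ht_seq; apply: (ht_if (v := i == j)); first by apply: beq; rd.
    * move=> /eqP ij; apply: (ht_wstore (wc _ erefl) (v := 1)) => //; first by ev.
      apply: rest => //=; first by move=> A /negbTE ->.
      rewrite eqxx /edgeP; have -> : x = y by apply: val_inj.
      by rewrite eqxx.
    * move=> ij; have xy : x != y by [].
      have := h4 x y; rewrite /= ltnn eqxx ltnn /= => exy.
      have ws : weval M s2 (sizeE $20 $21) = isSome (G x y).
        have -> : weval M s2 (sizeE $20 $21) = wmem s2 (weval M s2 (cell $14 $20 $21)) by [].
        by rewrite wc.
      apply: (ht_wstore (wc _ erefl) (v := isSome (G x y) + isSome (G x y))) => //.
        by apply: wadd => //; case: (G x y) => /=; lia.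
      apply: rest => //=; first by move=> A /negbTE ->.
      by rewrite eqxx /edgeP (negbTE xy); case: (G x y).
  move=> s2 [e20 [h1 h2 h3 h4]]; split=> //; split=> //.
  move=> u v; have := h4 u v; rewrite ltn_ord andbT /=.
  by rewrite [u < i.+1]ltnS [u <= i]leq_eqVlt orbC.
move=> s' [h1 h2 h3 h4]; apply: H; split=> // u v.
have := h4 u v; rewrite ltn_ord => -[m0 m1].
have x0 : xmem s' (addr n 0 u v) = odflt 0%R (G u v) by rewrite h2 ex /= matrix_entry_addr.
split.
- by [].
- rewrite x0 /edgeP /edgeD; case: eqP => [->|_ _] //; by rewrite (wgraph_irr wG).
- rewrite add0n m1 /edgeP; case: eqP => // _; by case: (G u v).
- move=> l r; rewrite add0n h3 //= /oval /= => lr.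
  have su : size (edgeP G u v) <= 2 by rewrite /edgeP; case: eqP => // _; case: (G u v).
  have l1 := ltn_expl l (ltnSn 1); have r1 := ltn_expl r (ltnSn 1).
  have el : l = 0 by lia.
  have er : r = 0 by lia.
  have uv : u != v.
    by apply: contraTneq lr => ->; rewrite /edgeP eqxx el er.
  have sz : size (edgeP G u v) = 2 by rewrite el er /= in lr; lia.
  by rewrite sz el er; apply: (edge_good wG).
Qed.

Definition oracle_ok (H : wgraph R n) s := is_wgraph H /\ exists o P D,
  [/\ o = 0 \/ o = PP, path_system H (below n) P D & machine_ok L H (below n) P D o s].

Lemma build_ok : ht c_build (input_state G) (oracle_ok G).
Proof.
have [b1 b2 b3 b4 b5] := bnds; have M1 : 1 < M by lia.
apply: ht_seq; apply: init_registers_ok => // s1 m1 x1 r1.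
apply: ht_seq; apply: init_tables_ok => // s2 c2.
apply: (ht_for (N := n) (Inv := fun i s' => exists o P D,
  [/\ o = 0 \/ o = PP, path_system G (below i) P D & machine_ok L G (below i) P D o s'])) => //; try lia.
- by move=> i s' [o [P [D [_ _ [[]]]]]].
- exists 0, (edgeP G), (edgeD G); split; [by left|exact: (edge_system wG)|].
  by case: c2 => [[q1 q2 q3 q4 q5] t]; split.
- move=> i s3 hi ei [o [P [D [ob S c3]]]].
  have oP : o <= PP by case: ob => ->.
  pose k := Ordinal hi.
  apply: ht_seq; apply: (ht_wset (v := i)); first by rd.
  apply: ht_seq; apply: (ht_wset (v := i)); first by rd.
  apply: ht_seq; apply: (ht_wset (v := 0)); first by ev.
  apply: ht_seq; apply: (ht_xset (v := 0%R)); first by [].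
  set s4 := set_xreg _ _ _.
  have c4 : machine_ok L G (below i) P D o s4.
    by case: c3 => [[q1 q2 q3 q4 q5] t]; split.
  have E : extension G G (below i) (below i.+1) k k 0 false.
    apply: vertex_extension => // x.
    by rewrite /below ltnS leq_eqVlt; congr (_ || _).
  apply: (relax_ok wG S oP E ob c4) => // s5 c5 w5 _.
  split; first by rewrite w5.
  exists (PP - o); do 2!eexists; split; [|exact: (new_system wG S E)|].
    by case: ob => ->; [right; rewrite subn0|left; rewrite subnn].
  have [[q1 q2 q3 q4 q5] t] := c5.
  by split.
Qed.

Lemma insert_ok s (a b : 'I_n) w : oracle_ok G s -> a <> b -> G a b = None -> (0 <= w)%R ->
  ht c_insert (set_args s [:: a : nat; b : nat] [:: w]) (oracle_ok (insert_edge G a b w)).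
Proof.
move=> [_ [o [P [D [ob S c]]]]] ab eG w0; have [b1 b2 b3 b4 b5] := bnds.
have oP : o <= PP by case: ob => ->.
apply: ht_seq; apply: (ht_wset (v := 1)); first by ev.
set s1 := set_wreg _ _ _.
have c1 : machine_ok L G (below n) P D o s1.
  by case: c => [[q1 q2 q3 q4 q5] t]; split.
have E : extension G (insert_edge G a b w) (below n) (below n) a b w true.
  by apply: insert_extension => // x; apply: ltn_ord.
apply: (relax_ok wG S oP E ob c1) => // s2 c2 _ _.
split; first exact: insert_wgraph.
exists (PP - o); do 2!eexists; split; [|exact: (new_system wG S E)|exact: c2].
by case: ob => ->; [right; rewrite subn0|left; rewrite subnn].
Qed.

Lemma answer_ok s (u v a b : 'I_n) : oracle_ok G s ->
  ht c_query (set_args s [:: u : nat; v : nat; a : nat; b : nat] [::])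
    (fun s' => oracle_ok G s' /\ is_dist (remove_edge G a b) u v (answer s')).
Proof.
move=> [_ [o [P [D [ob S c]]]]].
have oP : o <= PP by case: ob => ->.
set s1 := set_args _ _ _.
have c1 : machine_ok L G (below n) P D o s1.
  by case: c => [[q1 q2 q3 q4 q5] t]; split.
apply: (query_ok wG S oP c1 (u := u) (v := v) (e := a) (f := b)) => //.
move=> s' c' gd; split; first by split=> //; exists o, P, D.
by apply: good_is_dist gd => // z; apply: ltn_ord.
Qed.
End Build.
End Programs.

Lemma modulus_large n (L := (trunc_log 2 n).+1) : 0 < n ->
  [/\ n < 2 ^ L, 2 ^ L <= n.*2 & 4 * mem_size n L + 16 <= modulus 10 n].
Proof.
move=> n0; have lt : n < 2 ^ L by apply: trunc_log_ltn.
have le : 2 ^ L <= n.*2 by rewrite /L expnS mul2n leq_double trunc_logP.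
split=> //; rewrite /modulus -/L.
have L0 : 0 < L by [].
have LL : L < 2 ^ L by apply: ltn_expl.
have e1 : 2 ^ (10 * L) = (2 ^ L) ^ 4 * (2 ^ L) ^ 6 by rewrite -!expnM -expnD; congr expn; lia.
have e2 : 2 ^ 6 <= (2 ^ L) ^ 6 by rewrite -expnM leq_exp2l //; lia.
have e3 : mem_size n L <= 6 * (2 ^ L) ^ 4.
  rewrite /mem_size /planes; set T := 2 ^ L in lt LL *.
  have h1 : L * L <= T * T by apply: leq_mul; apply: ltnW.
  have h2 : n * n <= T * T by apply: leq_mul; apply: ltnW.
  have h0 : 0 < T * T by rewrite muln_gt0; lia.
  have h3 : (2 + L * L) * (n * n) <= (3 * (T * T)) * (T * T).
    by apply: leq_mul => //; lia.
  have -> : T ^ 4 = T * T * (T * T) by rewrite !expnS expn0 muln1 !mulnA.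
  lia.
have h4 : 0 < (2 ^ L) ^ 4 by rewrite !expn_gt0.
rewrite e1; apply: leq_trans (leq_mul (leqnn _) e2).
by move: e3 h4; rewrite -[2 ^ 6]/64; lia.
Qed.

Lemma cost_soft_O c d : deg 10 c = d ->
  soft_O (fun n => cost n (trunc_log 2 n).+1 c) (fun n => n ^ d).
Proof.
move=> ed; have [C h] := cost_poly c; exists C, (deg 11 c) => n n0.
by have := h n (trunc_log 2 n).+1 n0 isT; rewrite ed.
Qed.

Theorem theorem2 (R : realDomainType) :
  exists (O : oracle) (k : nat) (Tbuild Tinsert Tquery S : nat -> nat),
    [/\ soft_O Tbuild (fun n => n ^ 3),
        soft_O Tinsert (fun n => n ^ 2),
        soft_O Tquery (fun=> 1),
        soft_O S (fun n => n ^ 2)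
      & forall n, 0 < n ->
          incremental_DSO R O k n (S n) (Tbuild n) (Tinsert n) (Tquery n)].
Proof.
pose lg n := (trunc_log 2 n).+1.
exists (Oracle c_build c_insert c_query), 10, (fun n => cost n (lg n) c_build),
  (fun n => cost n (lg n) c_insert), (fun n => cost n (lg n) c_query),
  (fun n => mem_size n (lg n)); split.
- exact: cost_soft_O.
- exact: cost_soft_O.
- exact: (@cost_soft_O c_query 0).
- exists 6, 2 => n n0; rewrite /mem_size /planes -/(lg n).
  have l0 : 0 < lg n by [].
  have : 2 + lg n * lg n <= 3 * (lg n * lg n) by have := leq_mul l0 l0; lia.
  move=> h; rewrite -!mulnn -!mulnA; have := leq_mul h (leqnn (n * n)); lia.
move=> n n0; have [nL Ln SM] := modulus_large n0; rewrite -/(lg n) in nL Ln SM.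
pose ok := @oracle_ok R n (lg n).
have inv (G : wgraph R n) s :
    oracle_state (Oracle c_build c_insert c_query) 10 (mem_size n (lg n)) G s -> ok G s.
  elim=> {G s} [G t s wG run|G s a b w t s' _ IH ab eG w0 run|G s u v a b t s' _ IH adj run].
  - have [t' [s' [run' _ q]]] := build_ok n0 nL Ln SM wG.
    by rewrite -(exec_det run run').
  - have [t' [s2 [run' _ q]]] := insert_ok n0 nL Ln SM (proj1 IH) IH (elimN eqP ab) eG w0.
    by rewrite -(exec_det run run').
  - have [t' [s2 [run' _ [q _]]]] := answer_ok n0 nL Ln SM (proj1 IH) u v a b IH.
    by rewrite -(exec_det run run').
split.
- move=> G wG; have [t [s [run le _]]] := build_ok n0 nL Ln SM wG.
  by exists t, s.
- move=> G s a b w /inv IH ab eG w0.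
  have [t [s' [run le _]]] := insert_ok n0 nL Ln SM (proj1 IH) IH (elimN eqP ab) eG w0.
  by exists t, s'.
- move=> G s u v a b /inv IH _.
  have [t [s' [run le [_ d]]]] := answer_ok n0 nL Ln SM (proj1 IH) u v a b IH.
  by exists t, s'.
Qed.
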